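(* Let $p\ge 1$ and $\lambda>0$ be given. Then: (1) $E_{p,\lambda}$ admits a minimizer in $\mathcal{A}$. (2) All minimizers of $E_{p,\lambda}$ in $\mathcal{A}$ are compact, convex, $C^{1,1}$-regular sets, with Hausdorff dimension equal to $2$. (3) The perimeter-to-area ratio of any minimizer $\Omega$ of $E_{p,\lambda}$ in $\mathcal{A}$ satisfies $$\frac{\mathcal{H}^1(\partial\Omega)}{\mathcal{H}^2(\Omega)}=\frac{p+2}{\lambda(p+3)}\,\min_{\mathcal{A}}E_{p,\lambda}.$$
   Context: $\mathcal{A}$ denotes the family of all sets $\Omega\subset\mathbb{R}^2$ that are compact, convex and have Hausdorff dimension $2$. $\mathcal{H}^k$ is the $k$-dimensional Hausdorff measure, $\partial\Omega$ is the topological boundary of $\Omega$, and $\operatorname{dist}(x,\partial\Omega):=\inf_{y\in\partial\Omega}|x-y|$ with $|\cdot|$ the Euclidean norm. For $p\ge1$, $\lambda>0$ and $\Omega\in\mathcal{A}$, $$E_{p,\lambda}(\Omega):=\int_\Omega \operatorname{dist}^p(x,\partial\Omega)\,dx+\lambda\,\frac{\mathcal{H}^1(\partial\Omega)}{\mathcal{H}^2(\Omega)}.$$ A set $\Omega$ is called $C^{1,1}$-regular (resp. $C^k$-regular) if its boundary $\partial\Omega$ is $C^{1,1}$-regular (resp. $C^k$-regular), i.e. $\partial\Omega$ admits a regular (nowhere vanishing derivative) parameterization of class $C^{1,1}$ (resp. $C^k$), where $C^{1,1}$ means $C^1$ with Lipschitz derivative. *)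

(* Defs.v *)
From mathcomp Require Export all_boot all_order all_algebra.
From mathcomp Require Export all_classical all_reals all_analysis.
Export Order.TTheory GRing.Theory Num.Theory numFieldNormedType.Exports.

Set Implicit Arguments.
Unset Strict Implicit.
Unset Printing Implicit Defensive.

Local Open Scope classical_set_scope.
Local Open Scope ring_scope.

Section Plane.
Context {R : realType}.
Implicit Types (A Omega U : set (R * R)) (x y : R * R) (s p lambda : R).

(* The library norm on [R * R] is the max norm; it induces the same topology,
   but distances and diameters must be Euclidean. *)
Definition euclid x : R := Num.sqrt (x.1 ^+ 2 + x.2 ^+ 2).

Definition boundary A : set (R * R) := closure A `\` interior A.

Definition dist x A : R := inf [set euclid (x - y) | y in A].

Definition diam U : \bar R :=
  ereal_sup [set (euclid (z.1 - z.2))%:E | z in U `*` U].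

(* The empty set has gauge 0 for every [s], including [s = 0], where the
   convention [0 `^ 0 = 1] is the right one for singletons. *)
Definition gauge s U : \bar R :=
  if U == set0 then 0%E else (diam U `^ s)%E.

Definition hausdorff_delta s (delta : R) A : \bar R :=
  ereal_inf [set (\sum_(0 <= i <oo) gauge s (U i))%E
            | U in [set U : (set (R * R))^nat |
                A `<=` \bigcup_i U i /\
                forall i, (diam (U i) <= delta%:E)%E]].

(* The limit as [delta] tends to 0 is a supremum, by monotonicity. *)
Definition unnormalized_hausdorff s A : \bar R :=
  ereal_sup [set hausdorff_delta s delta A | delta in [set d : R | 0 < d]].

(* omega_k = 2 pi / k * omega_(k - 2), with omega_0 = 1 and omega_1 = 2. *)
Fixpoint unit_ball_volume (k : nat) : R :=
  match k with
  | 0 => 1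
  | 1 => 2
  | (k'.+2)%N => 2 * pi / k'.+2%:R * unit_ball_volume k'
  end.

(* The factor omega_k / 2 ^ k makes [hausdorff_measure 2] the Lebesgue measure
   of the plane and [hausdorff_measure 1] the length of curves. *)
Definition hausdorff_measure (k : nat) A : \bar R :=
  ((unit_ball_volume k / 2 ^+ k)%:E * unnormalized_hausdorff k%:R A)%E.

(* Normalizing constants do not affect the dimension. *)
Definition hausdorff_dim A : \bar R :=
  ereal_inf [set s%:E | s in [set s : R | 0 <= s /\ unnormalized_hausdorff s A = 0%E]].

Definition admissible : set (set (R * R)) :=
  [set Omega | [/\ compact Omega,
                   convex_set (Omega : set (convex_lmodType (R * R)%type)) &
                   hausdorff_dim Omega = 2%:E]].

Definition perimeter_area_ratio Omega : \bar R :=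
  (hausdorff_measure 1 (boundary Omega) / hausdorff_measure 2 Omega)%E.

Definition energy p lambda Omega : \bar R :=
  (\int[lebesgue_measure \x lebesgue_measure]_(x in Omega)
     (dist x (boundary Omega) `^ p)%:E
   + lambda%:E * perimeter_area_ratio Omega)%E.

Definition minimizer p lambda Omega : Prop :=
  admissible Omega /\
  forall Omega', admissible Omega' ->
    (energy p lambda Omega <= energy p lambda Omega')%E.

(* The boundary of a planar convex body is a closed curve, so a parameterization
   is periodic and injective on a period. Regularity is required on all of [R]:
   on a single compact interval a corner could hide at the endpoints.
   Being Lipschitz for the max norm or the Euclidean norm is the same. *)
Definition C11_closed_parameterization A (gamma : R -> R * R) (L : R) : Prop :=
  [/\ 0 < L, periodic gamma L,
      {in `[0, L[ &, injective gamma} &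
      range gamma = A] /\
  [/\ forall t, derivable gamma t 1,
      continuous (derive1 gamma),
      lipschitz (derive1 gamma) &
      forall t, derive1 gamma t != 0].

Definition C11_regular Omega : Prop :=
  exists gamma L, C11_closed_parameterization (boundary Omega) gamma L.

End Plane.

(* Main.v *)
Require Import Defs.
From mathcomp Require Import measurable_realfun ring lra.

(* A convex set [K] contained in [Omega] has a smaller perimeter (nearest-point
   projection) and a smaller distance integral.  So only monotonicity, scaling
   and crude bounds of Hausdorff measures are needed, never the identity between
   [hausdorff_measure 2] and Lebesgue measure.

   - The energy of [t Omega] is [t^(p+2) I + lambda r / t], with [I] the distance
     integral and [r] the ratio; minimality at [t = 1] gives
     [(p + 2) I = lambda r], which is the formula for [r].
   - An upper bound on the energy bounds the inradius from below (through [r])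
     and then the diameter from above (through [I]).  A minimizing sequence of
     sets, each recentered at the center of an inscribed disk, converges along
     an ultrafilter, and the limit and the sets are nested up to dilations of
     ratio close to 1, so monotonicity and scaling give lower semicontinuity.
   - A minimizer is its own Cheeger set among its convex subsets.  Cutting off
     the cap over a chord of length [w] whose height is [k] shortens the boundary
     by at least [sqrt (w^2 + 4 k^2) - w] and removes an area of order [w k]; so
     [k = O(w^2)].  Hence the Minkowski gauge, restricted to the unit circle,
     has second differences of size [O(s^2)], and the polar parameterization of
     the boundary is C^{1,1}. *)

Set Implicit Arguments.
Unset Strict Implicit.
Unset Printing Implicit Defensive.

Local Open Scope classical_set_scope.
Local Open Scope ring_scope.

(** * Euclidean plane *)

Section Euclid.
Context {R : realType}.
Implicit Types (x y z : R * R) (t c r : R) (A B : set (R * R)).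

(** Why [k = O(w^2)]: for [k] small against [w] the saved length is about [2 k^2 / w], the lost area
    is of order [w k], and the Cheeger property bounds the first by a multiple of the second.

    The obstacle is the comparison of boundary lengths. Hausdorff measure is handled as an outer
    measure, additive only on sets at positive distance, and the cap is bounded by an arc of unknown
    shape. So this arc is never measured: the perimeter is bounded below by that of a convex subset
    whose boundary contains two sides of a triangle, and these sides are trimmed at their ends to
    make all pieces separated.

    The gauge suits this because it is sublinear: by [dir (t + s) + dir (t - s) = 2 cos s dir t],
    the lower bound for second differences on the circle holds for every body, and only the upper
    bound uses minimality. With a bound on both sides, the gauge and its opposite are convex up to a
    parabola; their supporting lines agree and give a Lipschitz derivative. *)

Definition dot x y := x.1 * y.1 + x.2 * y.2.
Definition det x y := x.1 * y.2 - x.2 * y.1.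

Lemma euclid_ge0 x : 0 <= euclid x.
Proof. exact: sqrtr_ge0. Qed.

Lemma sqr_euclid x : euclid x ^+ 2 = x.1 ^+ 2 + x.2 ^+ 2.
Proof. by rewrite sqr_sqrtr// addr_ge0// sqr_ge0. Qed.

Lemma le_euclid x c : 0 <= c -> (euclid x <= c) = (x.1 ^+ 2 + x.2 ^+ 2 <= c ^+ 2).
Proof. by move=> c0; rewrite -sqr_euclid ler_sqr ?nnegrE ?euclid_ge0. Qed.

Lemma dot_le x y : dot x y <= euclid x * euclid y.
Proof.
have [//|d0] := leP (dot x y) 0; first by move=> h; rewrite (le_trans h)// mulr_ge0// euclid_ge0.
rewrite -ler_sqr ?nnegrE ?mulr_ge0 ?euclid_ge0 ?(ltW d0)//.
rewrite exprMn !sqr_euclid /dot -subr_ge0.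
have -> : (x.1 ^+ 2 + x.2 ^+ 2) * (y.1 ^+ 2 + y.2 ^+ 2) - (x.1 * y.1 + x.2 * y.2) ^+ 2
  = (x.1 * y.2 - x.2 * y.1) ^+ 2 by ring.
exact: sqr_ge0.
Qed.

Lemma euclidN x : euclid (- x) = euclid x.
Proof. by rewrite /euclid /= !sqrrN. Qed.

Lemma euclidBC x y : euclid (x - y) = euclid (y - x).
Proof. by rewrite -opprB euclidN. Qed.

Lemma euclid0 : euclid (0 : R * R) = 0.
Proof. by rewrite /euclid/= expr0n/= addr0 sqrtr0. Qed.

Lemma euclidZ t x : euclid (t *: x) = `|t| * euclid x.
Proof.
rewrite /euclid /=.
have -> : (t *: x.1) ^+ 2 + (t *: x.2) ^+ 2 = t ^+ 2 * (x.1 ^+ 2 + x.2 ^+ 2).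
  by rewrite /GRing.scale/=; ring.
by rewrite sqrtrM ?sqr_ge0// sqrtr_sqr.
Qed.

Lemma euclidD x y : euclid (x + y) <= euclid x + euclid y.
Proof.
rewrite le_euclid ?addr_ge0 ?euclid_ge0//=.
have := dot_le x y; rewrite /dot => h.
by rewrite (sqrrD (euclid x)) !sqr_euclid; lra.
Qed.

Lemma euclidB_trans y x z : euclid (x - z) <= euclid (x - y) + euclid (y - z).
Proof. by have := euclidD (x - y) (y - z); rewrite addrA subrK. Qed.

Lemma euclid_eq0 x : euclid x = 0 -> x = 0.
Proof.
move=> h; have := sqr_euclid x; rewrite h expr0n/= => h2.
case: x h h2 => a b _ /= h2.
have [a0 b0] : a ^+ 2 = 0 /\ b ^+ 2 = 0 by have := sqr_ge0 a; have := sqr_ge0 b; split; lra.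
move/eqP: a0; rewrite sqrf_eq0 => /eqP ->; move/eqP: b0; rewrite sqrf_eq0 => /eqP ->.
by [].
Qed.

Lemma euclid_gt0 x : x != 0 -> 0 < euclid x.
Proof.
by move=> x0; rewrite lt_neqAle euclid_ge0 andbT eq_sym; apply: contra_neq x0 => /euclid_eq0.
Qed.

Lemma norm1_le_euclid x : `|x.1| <= euclid x.
Proof. by rewrite -ler_sqr ?nnegrE ?euclid_ge0// sqr_euclid real_normK ?num_real// lerDl sqr_ge0. Qed.

Lemma norm2_le_euclid x : `|x.2| <= euclid x.
Proof. by rewrite -ler_sqr ?nnegrE ?euclid_ge0// sqr_euclid real_normK ?num_real// lerDr sqr_ge0. Qed.

Lemma euclid_le_norm12 x : euclid x <= `|x.1| + `|x.2|.
Proof.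
rewrite -ler_sqr ?nnegrE ?addr_ge0 ?euclid_ge0//.
rewrite sqr_euclid sqrrD !real_normK ?num_real//.
have := mulr_ge0 (normr_ge0 x.1) (normr_ge0 x.2); lra.
Qed.

Lemma norm_le_euclid x : `|x| <= euclid x.
Proof. by rewrite prod_normE ge_max norm1_le_euclid norm2_le_euclid. Qed.

Lemma euclid_le_norm x : euclid x <= 2 * `|x|.
Proof.
apply: le_trans (euclid_le_norm12 x) _; rewrite prod_normE mulr_natl mulr2n lerD// le_max lexx ?orbT//.
Qed.

Lemma nbhs_euclid x A : nbhs x A <-> exists2 r, 0 < r & forall y, euclid (y - x) < r -> A y.
Proof.
split=> [/nbhs_ballP[r /= r0 h]|[r r0 h]].
  exists r => // y yx; apply: h; rewrite -ball_normE /ball_/= -normrN opprB.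
  exact: le_lt_trans (norm_le_euclid _) yx.
apply/nbhs_ballP; exists (r / 2); first by rewrite /= divr_gt0.
move=> y; rewrite -ball_normE /ball_/= => xy; apply: h; rewrite euclidBC.
by apply: le_lt_trans (euclid_le_norm _) _; rewrite -ltr_pdivlMl// mulrC.
Qed.

Lemma interiorE A x : interior A x <-> exists2 r, 0 < r & forall y, euclid (y - x) < r -> A y.
Proof. exact: nbhs_euclid. Qed.

Lemma closureE A x : closure A x <-> forall r, 0 < r -> exists2 y, A y & euclid (y - x) < r.
Proof.
split=> [h r r0|h B].
  have [|y [Ay yr]] := h [set y | euclid (y - x) < r]; last by exists y.
  by apply/nbhs_euclid; exists r.
move/nbhs_euclid => [r r0 hr]; have [y Ay yx] := h _ r0.
by exists y; split => //; apply: hr.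
Qed.

Lemma closedE A : (forall x, (forall r, 0 < r -> exists2 y, A y & euclid (y - x) < r) -> A x) ->
  closed A.
Proof. by move=> h x /closureE; exact: h. Qed.

Lemma lipschitz_continuous (f : R * R -> R) c :
  (forall x y, `|f x - f y| <= c * euclid (x - y)) -> continuous f.
Proof.
move=> h x; apply/cvgrPdist_lt => e e0.
have c1 : 0 < `|c| + 1 by rewrite ltr_wpDl.
apply/nbhs_euclid; exists (e / (`|c| + 1)); first by rewrite divr_gt0.
move=> y yx; apply: le_lt_trans (h _ _) _.
rewrite euclidBC; apply: (@le_lt_trans _ _ ((`|c| + 1) * euclid (y - x))).
  by rewrite ler_wpM2r ?euclid_ge0// (le_trans (ler_norm _))// lerDl.
by rewrite mulrC -ltr_pdivlMr.
Qed.

Lemma lipschitz_continuous2 (f : R * R -> R * R) c :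
  (forall x y, euclid (f x - f y) <= c * euclid (x - y)) -> continuous f.
Proof.
move=> h x B /nbhs_euclid[e e0 hB].
have c1 : 0 < `|c| + 1 by rewrite ltr_wpDl.
apply/nbhs_euclid; exists (e / (`|c| + 1)); first by rewrite divr_gt0.
move=> y yx; apply: hB; apply: le_lt_trans (h _ _) _.
apply: (@le_lt_trans _ _ ((`|c| + 1) * euclid (y - x))).
  by rewrite ler_wpM2r ?euclid_ge0// (le_trans (ler_norm _))// lerDl.
by rewrite mulrC -ltr_pdivlMr.
Qed.

Lemma ler_dist_euclid x y : `|euclid x - euclid y| <= euclid (x - y).
Proof.
rewrite ler_norml; have := euclidB_trans y x 0; have := euclidB_trans x y 0.
by rewrite !subr0 (euclidBC y x) => ? ?; apply/andP; split; lra.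
Qed.

Lemma compact_closed2 A : compact A -> closed A.
Proof. by apply: compact_closed; exact: norm_hausdorff. Qed.

Lemma compact_bounded2 A : compact A -> exists2 M, 0 < M & forall x, A x -> euclid x <= M.
Proof.
move=> /compact_bounded[M [Mr hM]].
have m0 : M < `|M| + 1 by rewrite (le_lt_trans (ler_norm _))// ltrDl.
exists (2 * (`|M| + 1)); first by rewrite mulr_gt0// ltr_wpDl.
move=> x Ax; apply: le_trans (euclid_le_norm x) _; rewrite ler_pM2l//.
exact: hM m0 x Ax.
Qed.

Lemma bounded_closed_compact2 A M : (forall x, A x -> euclid x <= M) -> closed A -> compact A.
Proof.
move=> hM cA.
apply: (@subclosed_compact _ _ (`[- M, M] `*` `[- M, M])) => //.
  by apply: compact_setX; exact: segment_compact.
move=> x /hM h; rewrite /= !in_itv/= -!ler_norml.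
by rewrite (le_trans (norm1_le_euclid x))// (le_trans (norm2_le_euclid x)).
Qed.

Lemma boundary_closed A x : closed A -> boundary A x <-> A x /\ ~ interior A x.
Proof. by move=> cA; rewrite /boundary /setD/= -(closure_id A).1. Qed.

Lemma closed_boundary A : closed (boundary A).
Proof. by rewrite /boundary setDE; apply: closedI; [exact: closed_closure|apply: open_closedC; exact: open_interior]. Qed.

Lemma compact_boundary A : compact A -> compact (boundary A).
Proof.
move=> cA; apply: (@subclosed_compact _ _ A) => //; first exact: closed_boundary.
by move=> x /(boundary_closed x (compact_closed2 cA))[].
Qed.

(** Convexity with a plain real weight, for which witnesses are easy to give; [convex_setP]
    identifies it with the library notion. *)
Definition cvx A := forall x y t, A x -> A y -> 0 <= t -> t <= 1 -> A (t *: x + (1 - t) *: y).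

Lemma convex_setP A : convex_set (A : set (convex_lmodType (R * R)%type)) <-> cvx A.
Proof.
split=> [h x y t Ax Ay t0 t1|h x y t].
  have t01 : Itv.spec (@Itv.num_sem R) (Itv.Real `[0%Z, 1%Z]) t.
    by rewrite /Itv.spec/= /Itv.num_sem/= in_itv/= num_real t0 t1.
  have := h x y (Itv.Def t01); rewrite !inE => /(_ Ax Ay).
  by [].
by rewrite !inE => Ax Ay; apply: h.
Qed.

End Euclid.

(** * Hausdorff measures *)

Section Hausdorff.
Context {R : realType}.
Implicit Types (A B U : set (R * R)) (x y z p q u v : R * R) (s t c d : R).
Local Notation H := unnormalized_hausdorff.
Local Open Scope ereal_scope.

Lemma nneseries_le (u : nat -> \bar R) (M : \bar R) : (forall i, 0 <= u i) ->
  (forall n, \sum_(0 <= i < n) u i <= M) -> \sum_(0 <= i <oo) u i <= M.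
Proof.
move=> u0 h; apply: lime_le; first by apply: is_cvg_nneseries => n _ _; exact: u0.
exact: nearW.
Qed.

Lemma diam_le U c : (forall x y, U x -> U y -> (euclid (x - y) <= c)%R) ->
  diam U <= c%:E.
Proof. by move=> h; apply: ge_ereal_sup => _ [[x y]/= [Ux Uy] <-]; rewrite lee_fin h. Qed.

Lemma diam_ge U x y : U x -> U y -> (euclid (x - y))%:E <= diam U.
Proof. by move=> Ux Uy; apply: ereal_sup_ubound; exists (x, y). Qed.

Lemma diam_finite U c x : U x -> diam U <= c%:E ->
  exists d, [/\ diam U = d%:E, (0 <= d)%R, (d <= c)%R &
    forall y z, U y -> U z -> (euclid (y - z) <= d)%R].
Proof.
move=> Ux Uc; have U0 : 0 <= diam U.
  by have := diam_ge Ux Ux; rewrite subrr euclid0.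
have Uf : diam U = (fine (diam U))%:E.
  by rewrite fineK// fin_numElt (lt_le_trans _ U0)// (le_lt_trans Uc)// ltry.
exists (fine (diam U)); split => //; first exact: fine_ge0.
- by rewrite -lee_fin -Uf.
- by move=> y z Uy Uz; rewrite -lee_fin -Uf; exact: diam_ge.
Qed.

Lemma gauge_ge0 s U : 0 <= gauge s U.
Proof. by rewrite /gauge; case: ifP => // _; exact: poweR_ge0. Qed.

Lemma gauge_set0 s : gauge s set0 = 0 :> \bar R.
Proof. by rewrite /gauge eqxx. Qed.

Lemma gaugeE s U d : U !=set0 -> diam U = d%:E -> gauge s U = (d `^ s)%:E.
Proof. by rewrite /gauge => /set0P/negPf -> ->. Qed.

Lemma gauge_le s U c : (0 <= s)%R -> (0 <= c)%R ->
  (forall x y, U x -> U y -> (euclid (x - y) <= c)%R) -> gauge s U <= (c `^ s)%:E.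
Proof.
move=> s0 c0 h; have [->|U0] := eqVneq U set0.
  by rewrite gauge_set0 lee_fin powR_ge0.
have /set0P[x Ux] := U0; have [d [Ud d0 dc _]] := diam_finite Ux (diam_le h).
by rewrite (gaugeE _ _ Ud) ?lee_fin ?ge0_ler_powR//; exists x.
Qed.

Lemma hausdorff_delta_le s d A (U : nat -> set (R * R)) :
  A `<=` \bigcup_i U i -> (forall i, diam (U i) <= d%:E) ->
  hausdorff_delta s d A <= \sum_(0 <= i <oo) gauge s (U i).
Proof. by move=> AU Ud; apply: ereal_inf_lbound; exists U. Qed.

Lemma hausdorff_delta_ge s d A (M : \bar R) :
  (forall U : nat -> set (R * R), A `<=` \bigcup_i U i ->
    (forall i, diam (U i) <= d%:E) -> M <= \sum_(0 <= i <oo) gauge s (U i)) ->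
  M <= hausdorff_delta s d A.
Proof. by move=> h; apply: le_ereal_inf_tmp => _ [U [? ?] <-]; exact: h. Qed.

Lemma hausdorff_delta_ge0 s d A : 0 <= hausdorff_delta s d A.
Proof. by apply: hausdorff_delta_ge => U _ _; apply: nneseries_ge0 => i _ _; exact: gauge_ge0. Qed.

Lemma hausdorff_delta_adherent s d A e : (0 < e)%R -> hausdorff_delta s d A < +oo ->
  exists U : nat -> set (R * R), [/\ A `<=` \bigcup_i U i,
    forall i, diam (U i) <= d%:E &
    \sum_(0 <= i <oo) gauge s (U i) < hausdorff_delta s d A + e%:E].
Proof.
move=> e0 hoo.
have [_ [U [AU Ud] <-] h] : exists2 x, [set (\sum_(0 <= i <oo) gauge s (U i))
            | U in [set U : (set (R * R))^nat |
                A `<=` \bigcup_i U i /\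
                forall i, (diam (U i) <= d%:E)]] x & x < hausdorff_delta s d A + e%:E.
  apply: lb_ereal_inf_adherent => //.
  by rewrite fin_numElt hoo andbT (lt_le_trans _ (hausdorff_delta_ge0 s d A)).
by exists U.
Qed.

Lemma le_hausdorff_delta s d A B : A `<=` B -> hausdorff_delta s d A <= hausdorff_delta s d B.
Proof.
move=> AB; apply: hausdorff_delta_ge => U BU Ud.
by apply: hausdorff_delta_le => //; exact: subset_trans BU.
Qed.

Lemma hausdorff_delta_anti s d d' A : (d <= d')%R ->
  hausdorff_delta s d' A <= hausdorff_delta s d A.
Proof.
move=> dd; apply: hausdorff_delta_ge => U BU Ud.
by apply: hausdorff_delta_le => // i; rewrite (le_trans (Ud i))// lee_fin.
Qed.

Lemma hausdorff_delta_le_unnormalized s d A : (0 < d)%R -> hausdorff_delta s d A <= H s A.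
Proof. by move=> d0; apply: ereal_sup_ubound; exists d. Qed.

Lemma unnormalized_le s A (M : \bar R) :
  (forall d, (0 < d)%R -> hausdorff_delta s d A <= M) -> H s A <= M.
Proof. by move=> h; apply: ge_ereal_sup => _ [d d0 <-]; exact: h. Qed.

Lemma unnormalized_ge0 s A : 0 <= H s A.
Proof. exact: le_trans (hausdorff_delta_ge0 s 1 A) (hausdorff_delta_le_unnormalized _ _ ltr01). Qed.

Lemma le_unnormalized s A B : A `<=` B -> H s A <= H s B.
Proof.
move=> AB; apply: unnormalized_le => d d0.
exact: le_trans (le_hausdorff_delta s d AB) (hausdorff_delta_le_unnormalized _ _ d0).
Qed.

(** The finite cover is completed to a sequence by empty sets, whose gauge is 0 even for [s = 0]. *)
Lemma hausdorff_delta_finite_cover s d A (n : nat) (U : nat -> set (R * R)) c :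
  (0 <= s)%R -> (0 <= c)%R -> (c <= d)%R ->
  (forall x, A x -> exists2 i, (i < n)%N & U i x) ->
  (forall i x y, U i x -> U i y -> (euclid (x - y) <= c)%R) ->
  hausdorff_delta s d A <= (n%:R * c `^ s)%:E.
Proof.
move=> s0 c0 cd AU Ud; pose V i := if (i < n)%N then U i else set0.
have VU i : V i `<=` U i by rewrite /V; case: ifP => _ x.
apply: le_trans (@hausdorff_delta_le s d A V _ _) _.
- by move=> x /AU[i i_n Ux]; exists i => //; rewrite /V i_n.
- move=> i; apply: (@le_trans _ _ c%:E); last by rewrite lee_fin.
  by apply: diam_le => x y /VU Ux /VU; exact: (Ud i).
apply: nneseries_le => [i|m]; first exact: gauge_ge0.
suff : \sum_(0 <= i < m) gauge s (V i) <= ((minn m n)%:R * c `^ s)%:E.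
  move/le_trans; apply; rewrite lee_fin ler_wpM2r ?powR_ge0// ler_nat geq_minr//.
elim: m => [|m IH]; first by rewrite big_geq// min0n mul0r.
rewrite big_nat_recr//=; have [mn|nm] := ltnP m n.
  have -> : minn m.+1 n = (minn m n).+1 by rewrite (minn_idPl mn) (minn_idPl (ltnW mn)).
  rewrite -natr1 mulrDl mul1r EFinD leeD//; apply: gauge_le => // x y /VU Ux /VU; exact: (Ud m).
rewrite /V ltnNge nm/= gauge_set0 adde0.
have -> : minn m.+1 n = minn m n by rewrite (minn_idPr nm) (minn_idPr (leqW nm)).
exact: IH.
Qed.

Lemma hausdorff_deltaU s d A B :
  hausdorff_delta s d (A `|` B) <= hausdorff_delta s d A + hausdorff_delta s d B.
Proof.
have [Aoo|Aoo] := ltP (hausdorff_delta s d A) +oo; last first.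
  move: Aoo; rewrite leye_eq => /eqP ->; rewrite addye ?leey//.
  by rewrite gt_eqF// (lt_le_trans _ (hausdorff_delta_ge0 s d B)).
have [Boo|Boo] := ltP (hausdorff_delta s d B) +oo; last first.
  move: Boo; rewrite leye_eq => /eqP ->; rewrite addey ?leey//.
  by rewrite gt_eqF// (lt_le_trans _ (hausdorff_delta_ge0 s d A)).
apply/lee_addgt0Pr => e e0; have e20 : (0 < e / 2)%R by rewrite divr_gt0.
have [U [AU Ud hU]] := hausdorff_delta_adherent e20 Aoo.
have [V [BV Vd hV]] := hausdorff_delta_adherent e20 Boo.
(* Interleaving: even indices run through the cover of [A], odd ones through that of [B]. *)
pose W i := if odd i then V i./2 else U i./2.
have -> : hausdorff_delta s d A + hausdorff_delta s d B + e%:E =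
  (hausdorff_delta s d A + (e / 2)%:E) + (hausdorff_delta s d B + (e / 2)%:E).
  by rewrite addeACA -EFinD -splitr.
apply: le_trans (leeD (ltW hU) (ltW hV)).
apply: le_trans (@hausdorff_delta_le s d _ W _ _) _.
- move=> x [/AU[i _ Ux]|/BV[i _ Vx]].
    by exists i.*2 => //; rewrite /W odd_double doubleK.
  by exists i.*2.+1 => //; rewrite /W /= odd_double /= uphalf_double.
- by move=> i; rewrite /W; case: ifP.
have W0 i : 0 <= gauge s (W i) by exact: gauge_ge0.
apply: nneseries_le => // n.
apply: (@le_trans _ _ (\sum_(0 <= i < n.*2) gauge s (W i))).
  rewrite [leRHS](@big_cat_nat _ _ _ n)//=; last by rewrite -addnn leq_addr.
  by rewrite leeDl// sume_ge0.
have -> : \sum_(0 <= i < n.*2) gauge s (W i) =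
   \sum_(0 <= i < n) gauge s (U i) + \sum_(0 <= i < n) gauge s (V i).
  elim: n => [|n IH]; first by rewrite double0 !big_geq// adde0.
  rewrite doubleS !big_nat_recr//= IH -addeA addeACA; congr (_ + (_ + _)).
    by rewrite /W odd_double doubleK.
  by rewrite /W/= odd_double/= uphalf_double.
by apply: leeD; apply: nneseries_lim_ge => i _ _; exact: gauge_ge0.
Qed.

Lemma unnormalizedU s A B : H s (A `|` B) <= H s A + H s B.
Proof.
apply: unnormalized_le => d d0; apply: le_trans (hausdorff_deltaU _ _ _ _) _.
by apply: leeD; exact: hausdorff_delta_le_unnormalized.
Qed.

(** The metric outer measure property: a set of diameter less than [d] cannot meet both [A] and [B],
    so a fine cover of the union splits into two families without common nonempty members. All
    additivity of Hausdorff measures below comes from here. *)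
Lemma unnormalized_separated s A B d : (0 < d)%R ->
  (forall x y, A x -> B y -> (d <= euclid (x - y))%R) -> H s A + H s B <= H s (A `|` B).
Proof.
move=> d0 AB.
have key e : (e < d)%R ->
    hausdorff_delta s e A + hausdorff_delta s e B <= hausdorff_delta s e (A `|` B).
  move=> ed; apply: hausdorff_delta_ge => U ABU Ud.
  pose V i := if `[< U i `&` A !=set0 >] then U i else set0.
  pose W i := if `[< U i `&` B !=set0 >] then U i else set0.
  apply: le_trans (@leeD _ _ _ _ _ (@hausdorff_delta_le s e A V _ _) (@hausdorff_delta_le s e B W _ _)) _.
  - move=> x Ax; have [i _ Ux] := ABU x (or_introl Ax); exists i => //.
    by rewrite /V ifT//; apply/asboolP; exists x.
  - move=> i; rewrite /V; case: ifP => // _; rewrite (le_trans _ (Ud i))// ereal_sup_le//.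
    by move=> _ [x [[] //]].
  - move=> x Bx; have [i _ Ux] := ABU x (or_intror Bx); exists i => //.
    by rewrite /W ifT//; apply/asboolP; exists x.
  - move=> i; rewrite /W; case: ifP => // _; rewrite (le_trans _ (Ud i))// ereal_sup_le//.
    by move=> _ [x [[] //]].
  rewrite -nneseriesD; [|by move=> *; exact: gauge_ge0..].
  apply: lee_nneseries => [i _ _|i _]; first by rewrite adde_ge0// gauge_ge0.
  rewrite /V /W; case: ifPn => [/asboolP[x [Ux Ax]]|_]; last first.
    by rewrite gauge_set0 add0e; case: ifP => // _; rewrite gauge_set0 gauge_ge0.
  case: ifPn => [/asboolP[y [Uy By]]|_]; last by rewrite gauge_set0 adde0.
  have := AB _ _ Ax By; rewrite leNgt => /negP; case.
  apply: le_lt_trans ed; rewrite -lee_fin; apply: le_trans (Ud i); exact: diam_ge.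
have HA : H s A <= H s (A `|` B) by apply: le_unnormalized; exact: subsetUl.
have HB : H s B <= H s (A `|` B) by apply: le_unnormalized; exact: subsetUr.
have [oo|] := ltP (H s (A `|` B)) +oo; last by rewrite leye_eq => /eqP ->; rewrite leey.
have fA : H s A \is a fin_num.
  by rewrite fin_numElt (le_lt_trans HA)// (lt_le_trans _ (unnormalized_ge0 s A)).
have fB : H s B \is a fin_num.
  by rewrite fin_numElt (le_lt_trans HB)// (lt_le_trans _ (unnormalized_ge0 s B)).
apply/lee_addgt0Pr => e e0; have e20 : (0 < e / 2)%R by rewrite divr_gt0.
have [_ [d1 d10 <-] h1] := ub_ereal_sup_adherent e20 fA.
have [_ [d2 d20 <-] h2] := ub_ereal_sup_adherent e20 fB.
pose dd := Num.min (d / 2)%R (Num.min d1 d2).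
have dd0 : (0 < dd)%R by rewrite !lt_min divr_gt0//= d10.
have ddd : (dd < d)%R by rewrite gt_min; apply/orP; left; lra.
have := le_trans (key _ ddd) (hausdorff_delta_le_unnormalized s (A `|` B) dd0).
have l1 : H s A - (e / 2)%:E <= hausdorff_delta s dd A.
  by apply: le_trans (ltW h1) _; apply: hausdorff_delta_anti; rewrite !ge_min lexx orbT.
have l2 : H s B - (e / 2)%:E <= hausdorff_delta s dd B.
  by apply: le_trans (ltW h2) _; apply: hausdorff_delta_anti; rewrite !ge_min lexx !orbT.
move/(le_trans (leeD l1 l2)) => h.
rewrite (_ : H s A + H s B = (H s A - (e / 2)%:E + (H s B - (e / 2)%:E)) + e%:E); last first.
  rewrite -(fineK fA) -(fineK fB) -!EFinB -!EFinD; congr EFin; lra.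
exact: leeD.
Qed.

Lemma unnormalized_lipschitz s c (f : R * R -> R * R) A : (0 <= s)%R -> (0 < c)%R ->
  (forall x y, (euclid (f x - f y) <= c * euclid (x - y))%R) ->
  H s (f @` A) <= (c `^ s)%:E * H s A.
Proof.
move=> s0 c0 fc; have cs0 : (0 < c `^ s)%R by rewrite powR_gt0.
apply: unnormalized_le => d d0.
have dc0 : (0 < d / c)%R by rewrite divr_gt0.
apply: (@le_trans _ _ ((c `^ s)%:E * hausdorff_delta s (d / c) A)); last first.
  by rewrite lee_pmul2l// ?lte_fin// hausdorff_delta_le_unnormalized.
rewrite -lee_pdivrMl//; apply: hausdorff_delta_ge => U AU Ud.
rewrite lee_pdivrMl// -nneseriesZl; last by move=> *; exact: gauge_ge0.
have fU i : forall x y, (f @` U i) x -> (f @` U i) y -> exists e,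
   [/\ diam (U i) = e%:E, (0 <= e)%R, (c * e <= d)%R & (euclid (x - y) <= c * e)%R].
  move=> _ _ [x Ux <-] [y Uy <-].
  have [e [Ue e0 edc eU]] := diam_finite Ux (Ud i); exists e; split => //.
    by rewrite mulrC -ler_pdivlMr.
  by apply: le_trans (fc _ _) _; rewrite ler_pM2l// eU.
apply: le_trans (@hausdorff_delta_le s d (f @` A) (fun i => f @` U i) _ _) _.
- by move=> _ [x /AU[i _ Ux] <-]; exists i => //; exists x.
- move=> i; apply: diam_le => x y fx fy.
  by have [e [_ _ + h]] := fU i _ _ fx fy; exact: le_trans.
apply: lee_nneseries => [i _ _|i _]; first exact: gauge_ge0.
have [->|U0] := eqVneq (U i) set0; first by rewrite image_set0 gauge_set0 mule0.
have /set0P[x Ux] := U0.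
have [e [Ue e0 _ eU]] := diam_finite Ux (Ud i).
rewrite (gaugeE _ (ex_intro _ x Ux) Ue) -EFinM -powRM// ?(ltW c0)//.
apply: gauge_le => //; first by rewrite mulr_ge0// ltW.
move=> y z fy fz; have [e' [+ _ _]] := fU i _ _ fy fz.
by rewrite Ue => -[<-].
Qed.

Lemma hausdorff_delta_exponent s t d A : (0 <= s)%R -> (s < t)%R -> (0 < d)%R ->
  hausdorff_delta t d A <= (d `^ (t - s))%:E * hausdorff_delta s d A.
Proof.
move=> s0 st d0; have dt0 : (0 < d `^ (t - s))%R by rewrite powR_gt0.
rewrite -lee_pdivrMl//; apply: hausdorff_delta_ge => U AU Ud.
rewrite lee_pdivrMl// -nneseriesZl; last by move=> *; exact: gauge_ge0.
apply: le_trans (hausdorff_delta_le t AU Ud) _.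
apply: lee_nneseries => [i _ _|i _]; first exact: gauge_ge0.
have [->|U0] := eqVneq (U i) set0; first by rewrite !gauge_set0 mule0.
have /set0P[x Ux] := U0.
have [e [Ue e0 ed eU]] := diam_finite Ux (Ud i).
rewrite !(gaugeE _ (ex_intro _ x Ux) Ue) -EFinM lee_fin.
(* Diameter 0 is treated apart, since the addition law for exponents may fail at base 0; here
   [t > 0] makes the left side 0. *)
have [->|en0] := eqVneq e 0%R.
  by rewrite powR0 ?mulr_ge0 ?powR_ge0// gt_eqF// (le_lt_trans s0).
have -> : (e `^ t = e `^ (t - s) * e `^ s)%R.
  by rewrite -powRD ?subrK//; apply/implyP.
rewrite ler_wpM2r ?powR_ge0// ge0_ler_powR ?nnegrE//; lra.
Qed.

Lemma unnormalized_exponent0 s t A : (0 <= s)%R -> (s < t)%R -> H s A < +oo -> H t A = 0.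
Proof.
move=> s0 st Hoo; apply/eqP; rewrite eq_le unnormalized_ge0 andbT.
have fH : H s A \is a fin_num.
  by rewrite fin_numElt Hoo andbT (lt_le_trans _ (unnormalized_ge0 s A)).
set M := fine (H s A); have M0 : (0 <= M)%R by rewrite fine_ge0// unnormalized_ge0.
apply: unnormalized_le => d d0; apply/lee_addgt0Pr => e e0; rewrite add0e.
(* A mesh so fine that its power [t - s], times [M], is at most [e]; the [+ 1] covers [M = 0]. *)
pose e' := ((e / (M + 1)) `^ ((t - s)^-1))%R.
have eM : (0 < e / (M + 1))%R by rewrite divr_gt0// ltr_wpDl.
have e'0 : (0 < e')%R by rewrite powR_gt0.
pose dd := Num.min d e'; have dd0 : (0 < dd)%R by rewrite lt_min d0.
apply: (@le_trans _ _ (hausdorff_delta t dd A)).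
  by apply: hausdorff_delta_anti; rewrite ge_min lexx.
apply: le_trans (hausdorff_delta_exponent A s0 st dd0) _.
apply: (@le_trans _ _ ((dd `^ (t - s))%:E * H s A)).
  by rewrite lee_pmul2l// ?lte_fin ?powR_gt0// hausdorff_delta_le_unnormalized.
rewrite -(fineK fH) -/M -EFinM lee_fin.
have ts : (0 < t - s)%R by rewrite subr_gt0.
apply: (@le_trans _ _ (e' `^ (t - s) * M)%R).
  rewrite ler_wpM2r// ge0_ler_powR ?nnegrE ?(ltW ts) ?(ltW dd0) ?(ltW e'0)//.
  by rewrite ge_min lexx orbT.
rewrite -powRrM mulVf ?gt_eqF// powRr1 ?(ltW eM)//.
rewrite mulrAC ler_pdivrMr ?ltr_wpDl// ler_pM2l//; lra.
Qed.

End Hausdorff.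

(** * Segments, parallelograms and comparison with Lebesgue measure *)

Section Hausdorff2.
Context {R : realType}.
Implicit Types (A B U : set (R * R)) (x y z o p q u v : R * R) (s t c d : R).
Local Notation H := unnormalized_hausdorff.

Definition seg p q : set (R * R) :=
  [set x | exists2 t, 0 <= t <= 1 & x = t *: p + (1 - t) *: q].

Lemma grid t (n : nat) : (0 < n)%N -> 0 <= t -> t <= 1 ->
  exists2 i : nat, (i < n)%N & i%:R / n%:R <= t <= i.+1%:R / n%:R.
Proof.
move=> n0 t0 t1; have n0R : 0 < n%:R :> R by rewrite ltr0n.
have tn0 : 0 <= t * n%:R by rewrite mulr_ge0// ltW.
have /andP[h1 h2] := truncn_itv tn0.
have [i_n|ni] := ltnP (Num.truncn (t * n%:R)) n.
  by exists (Num.truncn (t * n%:R)) => //; rewrite ler_pdivrMr// h1 ler_pdivlMr// ltW.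
(* Only [t = 1] falls beyond the last cell; it is assigned to cell [n - 1]. *)
exists n.-1; first by rewrite prednK.
rewrite prednK// divff ?gt_eqF// t1 andbT.
have : n%:R <= t * n%:R by apply: le_trans h1; rewrite ler_nat.
rewrite -ler_pdivrMr// divff ?gt_eqF// => {}t1'.
by apply: le_trans t1'; rewrite ler_pdivrMr// mul1r ler_nat leq_pred.
Qed.

Lemma grid_diameter a b (i n : nat) : (0 < n)%N -> i%:R / n%:R <= a <= i.+1%:R / n%:R ->
  i%:R / n%:R <= b <= i.+1%:R / n%:R -> `|a - b| <= n%:R^-1 :> R.
Proof.
move=> n0; rewrite -natr1 mulrDl mul1r => /andP[? ?] /andP[? ?].
by rewrite ler_norml; apply/andP; split; lra.
Qed.

(** The upper bound on [n] gives [n s <= c + s], which controls the sum of gauges when two such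
    subdivisions are combined. *)
Lemma mesh_size c s : 0 <= c -> 0 < s ->
  exists2 n : nat, (0 < n)%N & c / n%:R <= s /\ n%:R <= c / s + 1.
Proof.
move=> c0 s0; have cs0 : 0 <= c / s by rewrite divr_ge0// ltW.
have /andP[h1 h2] := truncn_itv cs0.
exists (Num.truncn (c / s)).+1 => //; split; last by rewrite -natr1 lerD2r.
by rewrite ler_pdivrMr ?ltr0n// mulrC -ler_pdivrMr// ltW.
Qed.

Lemma unnormalized1_seg_le p q A : A `<=` seg p q -> (H 1 A <= (euclid (p - q))%:E)%E.
Proof.
move=> Apq; apply: unnormalized_le => d d0; set L := euclid (p - q).
have [n n0 [Lnd _]] := mesh_size (euclid_ge0 (p - q)) d0.
have nR : n%:R != 0 :> R by rewrite pnatr_eq0 -lt0n.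
pose U (i : nat) : set (R * R) := [set x | exists2 t, i%:R / n%:R <= t <= i.+1%:R / n%:R & x = t *: p + (1 - t) *: q].
apply: (@le_trans _ _ (n%:R * (L / n%:R) `^ 1)%:E).
  apply: (@hausdorff_delta_finite_cover _ 1 d A n U) => //.
  - by rewrite divr_ge0// euclid_ge0.
  - move=> x /Apq[t /andP[t0 t1] ->]; have [i i_n h] := grid n0 t0 t1.
    by exists i => //; exists t.
  - move=> i _ _ [t ht ->] [t' ht' ->].
    have -> : t *: p + (1 - t) *: q - (t' *: p + (1 - t') *: q) = (t - t') *: (p - q).
      by congr pair; rewrite /= /GRing.scale /=; ring.
    by rewrite euclidZ mulrC ler_wpM2l ?euclid_ge0// (grid_diameter n0 ht ht').
rewrite powRr1 ?divr_ge0 ?euclid_ge0// lee_fin mulrCA divff// mulr1 lexx//.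
Qed.

(** Cells with sides at most [s] have diameter at most [2 s], and about [|u| |v| / s^2] of them
    contribute [(2 s)^2] each; hence the factor 4. *)
Lemma unnormalized2_parallelogram_le o u v A :
  (forall x, A x -> exists a b, [/\ 0 <= a <= 1, 0 <= b <= 1 & x = o + a *: u + b *: v]) ->
  (H 2 A <= (4 * euclid u * euclid v)%:E)%E.
Proof.
move=> hA; apply: unnormalized_le => d d0.
apply/lee_addgt0Pr => e e0; set a := euclid u; set b := euclid v.
have a0 : 0 <= a by exact: euclid_ge0.
have b0 : 0 <= b by exact: euclid_ge0.
(* [s <= 1] bounds the error term [s^2] by [s], and the last entry makes [4 s (a + b + 1)] at most
   [e]. *)
pose s := Num.min (d / 2) (Num.min 1 (e / (4 * (a + b + 1)))).
have K0 : 0 < 4 * (a + b + 1) by lra.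
have s0 : 0 < s by rewrite !lt_min divr_gt0//= ltr01 divr_gt0.
have sd : s <= d / 2 by rewrite ge_min lexx.
have s1 : s <= 1 by rewrite !ge_min lexx orbT.
have se : s * (4 * (a + b + 1)) <= e by rewrite -ler_pdivlMr// !ge_min lexx !orbT.
have [m m0 [am ma]] := mesh_size a0 s0.
have [n n0 [bn nb]] := mesh_size b0 s0.
(* Cell [(i, j)] of the grid has number [i * n + j]. *)
pose U (k : nat) : set (R * R) := [set x | exists al be,
  [/\ (k %/ n)%:R / m%:R <= al <= (k %/ n).+1%:R / m%:R,
      (k %% n)%:R / n%:R <= be <= (k %% n).+1%:R / n%:R & x = o + al *: u + be *: v]].
apply: (@le_trans _ _ ((m * n)%:R * (2 * s) `^ 2)%:E).
  apply: (@hausdorff_delta_finite_cover _ 2 d A (m * n)%N U) => //.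
  - by rewrite mulr_ge0// ltW.
  - lra.
  - move=> x /hA[al [be [/andP[al0 al1] /andP[be0 be1] ->]]].
    have [i im hi] := grid m0 al0 al1; have [j jn hj] := grid n0 be0 be1.
    exists (i * n + j)%N; last first.
      by exists al, be; rewrite divnMDl// divn_small// addn0 modnMDl modn_small.
    apply: (@leq_trans (i.+1 * n)%N); last by rewrite leq_mul2r im orbT.
    by rewrite mulSn [X in (X < _)%N]addnC ltn_add2r.
  - move=> k _ _ [al [be [h1 h2 ->]]] [al' [be' [h3 h4 ->]]].
    have -> : o + al *: u + be *: v - (o + al' *: u + be' *: v) = (al - al') *: u + (be - be') *: v.
      by congr pair; rewrite /= /GRing.scale /=; ring.
    apply: le_trans (euclidD _ _) _; rewrite !euclidZ mulr_natl mulr2n; apply: lerD.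
      by apply: le_trans am; rewrite mulrC ler_wpM2l// (grid_diameter m0 h1 h3).
    by apply: le_trans bn; rewrite mulrC ler_wpM2l// (grid_diameter n0 h2 h4).
rewrite powR_mulrn; last by rewrite mulr_ge0// ltW.
rewrite -EFinD lee_fin natrM.
have ma' : m%:R * s <= a + s.
  have -> : a + s = (a / s + 1) * s by field; rewrite gt_eqF.
  by rewrite ler_wpM2r// ltW.
have nb' : n%:R * s <= b + s.
  have -> : b + s = (b / s + 1) * s by field; rewrite gt_eqF.
  by rewrite ler_wpM2r// ltW.
have -> : m%:R * n%:R * (2 * s) ^+ 2 = 4 * ((m%:R * s) * (n%:R * s)) by ring.
have : (m%:R * s) * (n%:R * s) <= (a + s) * (b + s).
  by apply: ler_pM => //; rewrite mulr_ge0// ltW.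
have : s * s <= s by rewrite -[leRHS]mulr1 ler_pM2l.
nra.
Qed.

(** The parameters of points of the segment in one covering set span at most its diameter over
    [|p - q|]. Countable subadditivity of Lebesgue measure on [[0, 1]] then bounds the sum of the
    diameters from below. *)
Lemma unnormalized1_seg_ge p q A : seg p q `<=` A -> ((euclid (p - q))%:E <= H 1 A)%E.
Proof.
move=> pqA; have [->|pq] := eqVneq p q; first by rewrite subrr euclid0 unnormalized_ge0.
have L0 : 0 < euclid (p - q) by rewrite euclid_gt0// subr_eq0.
apply: le_trans (hausdorff_delta_le_unnormalized _ _ ltr01).
apply: hausdorff_delta_ge => U AU Ud; set L := euclid (p - q).
pose T i : set R := [set t | 0 <= t <= 1 /\ U i (t *: p + (1 - t) *: q)].
(* The enclosing interval is measurable, whereas [T i] itself may fail to be. *)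
pose J i : set R := if T i == set0 then set0 else `[inf (T i), sup (T i)]%classic.
have Tdiff i t t' : T i t -> T i t' -> (exists d, [/\ diam (U i) = d%:E, 0 <= d & t - t' <= d / L]).
  move=> [_ h] [_ h']; have [d [Ue e0 _ eU]] := diam_finite h (Ud i).
  exists d; split => //; rewrite ler_pdivlMr//; apply: le_trans (eU _ _ h h').
  have -> : t *: p + (1 - t) *: q - (t' *: p + (1 - t') *: q) = (t - t') *: (p - q).
    by congr pair; rewrite /= /GRing.scale /=; ring.
  by rewrite euclidZ ler_wpM2r ?(ltW L0)// ler_norm.
have Tub i : has_ubound (T i) by exists 1 => t [/andP[]].
have Tlb i : has_lbound (T i) by exists 0 => t [/andP[]].
have mJ i : measurable (J i) by rewrite /J; case: ifP => // _; exact: measurable_itv.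
have sub : `[0, 1]%classic `<=` \bigcup_i J i.
  move=> t /=; rewrite in_itv/= => t01.
  have [i _ Ui] : (\bigcup_i U i) (t *: p + (1 - t) *: q) by apply/AU/pqA; exists t.
  have Tit : T i t by [].
  exists i => //; rewrite /J ifF; last by apply/negbTE/set0P; exists t.
  by rewrite /= in_itv/= (ge_inf (Tlb i) Tit) (ub_le_sup (Tub i) Tit).
have h1 : (lebesgue_measure (`[0%R, 1%R]%classic : set R) <= \sum_(0 <= i <oo) lebesgue_measure (J i))%E.
  by apply: measure_sigma_subadditive => //; exact: measurable_itv.
rewrite lebesgue_measure_itv/= lte_fin ltr01 sube0 in h1.
have -> : (L%:E = L%:E * 1)%E by rewrite mule1.
rewrite -lee_pdivlMl//; apply: le_trans h1 _.
rewrite -nneseriesZl; last by move=> *; exact: gauge_ge0.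
apply: lee_nneseries => // i _.
rewrite /J; case: ifPn => [_|/set0P[t Tt]].
  by rewrite measure0 mule_ge0// ?gauge_ge0// lee_fin invr_ge0 ltW.
have [d [Ud0 d0 _]] := Tdiff i t t Tt Tt.
rewrite (gaugeE _ (ex_intro _ _ Tt.2) Ud0) powRr1// -EFinM.
rewrite lebesgue_measure_itv/= lte_fin; case: ifP => _; last by rewrite lee_fin mulr_ge0// invr_ge0 ltW.
rewrite -EFinB lee_fin lerBlDr; apply: ge_sup; first by exists t.
move=> t1 T1; rewrite -lerBlDl; apply: lb_le_inf; first by exists t.
move=> t2 T2; rewrite lerBlDr -lerBlDl.
by have [d' [+ _]] := Tdiff i t1 t2 T1 T2; rewrite Ud0 => -[<-]; rewrite mulrC.
Qed.

Lemma lebesgue_measure_segment (a b : R) : a <= b ->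
  lebesgue_measure (`[a, b]%classic : set R) = (b - a)%:E.
Proof.
rewrite lebesgue_measure_itv/= lte_fin le_eqVlt => /predU1P[->|->]; last by rewrite -EFinB.
by rewrite ltxx subrr.
Qed.

Lemma lebesgue2_box (a b c d : R) : a <= b -> c <= d ->
  (lebesgue_measure \x lebesgue_measure)%E (`[a, b]%classic `*` `[c, d]%classic) =
  ((b - a) * (d - c))%:E.
Proof.
move=> ab cd; rewrite -[RHS]/((b - a)%:E * (d - c)%:E)%E -!lebesgue_measure_segment//.
by apply: product_measure1E; exact: measurable_itv.
Qed.

(** A set of diameter [d] lies in a square of side [2 d], hence the factor 4. *)
Lemma unnormalized2_ge A (S : set (R * R)) : measurable S -> S `<=` A ->
  ((lebesgue_measure \x lebesgue_measure)%E S <= 4%:E * H 2 A)%E.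
Proof.
move=> mS SA.
apply: (@le_trans _ _ (4%:E * hausdorff_delta 2 1 A)%E); last first.
  by rewrite lee_pmul2l// hausdorff_delta_le_unnormalized.
rewrite -lee_pdivrMl//; apply: hausdorff_delta_ge => U AU Ud.
rewrite lee_pdivrMl// -nneseriesZl; last by move=> *; exact: gauge_ge0.
have box i : exists2 J : set (R * R), measurable J /\ U i `<=` J &
    ((lebesgue_measure \x lebesgue_measure)%E J <= 4%:E * gauge 2 (U i))%E.
  have [Ui0|/set0P[x Ux]] := eqVneq (U i) set0.
    exists set0; first by rewrite Ui0; split => //; exact: measurable0.
    by rewrite measure0 mule_ge0// ?lee_fin// gauge_ge0.
  have [d [Ue d0 _ eU]] := diam_finite Ux (Ud i).
  exists (`[x.1 - d, x.1 + d]%classic `*` `[x.2 - d, x.2 + d]%classic).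
    split; first by apply: measurableX; exact: measurable_itv.
    move=> y Uy; have := eU y x Uy Ux => h.
    have := le_trans (norm1_le_euclid _) h; have := le_trans (norm2_le_euclid _) h.
    by rewrite /= !in_itv/= !ler_norml => /andP[? ?] /andP[? ?]; split; apply/andP; split; lra.
  rewrite lebesgue2_box; [|lra..].
  by rewrite (gaugeE _ (ex_intro _ _ Ux) Ue) powR_mulrn// -EFinM lee_fin; lra.
have [J hJ] := choice (fun i => (let: ex_intro2 J a b := box i in ex_intro _ J (conj a b))).
have mJ i : measurable (J i) by have [[]] := hJ i.
have sub : S `<=` \bigcup_i J i.
  by move=> x /SA/AU[i _ Ux]; exists i => //; have [[_ h] _] := hJ i; exact: h.
apply: le_trans (@measure_sigma_subadditive _ R _ (lebesgue_measure \x lebesgue_measure)%E _ J mJ mS sub) _.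
by apply: lee_nneseries => // i _; have [] := hJ i.
Qed.

End Hausdorff2.

(** * Perimeters of convex sets *)

Section Perimeter.
Context {R : realType}.
Implicit Types (A B K Omega : set (R * R)) (x y z o p q u v : R * R) (s t c d r M : R).
Local Notation H := unnormalized_hausdorff.

Lemma compact_max_point K (f : R * R -> R) : compact K -> K !=set0 -> continuous f ->
  exists2 x, K x & forall y, K y -> f y <= f x.
Proof.
move=> cK K0 cf; have [x + h] := compact_EVT_max K0 cK (continuous_subspaceT cf).
by rewrite inE => Kx; exists x => // y Ky; apply: h; rewrite inE.
Qed.

Lemma dot_euclid x : dot x x = euclid x ^+ 2.
Proof. by rewrite sqr_euclid /dot !expr2. Qed.

(** The hypotheses add up to [|p - q|^2 <= dot (x - y) (p - q)], and Cauchy-Schwarz concludes. For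
    [p], [q] the projections of [x], [y] on a convex set, this is the contraction property. *)
Lemma euclid_le_dot p q x y : dot (x - p) (q - p) <= 0 -> dot (y - q) (p - q) <= 0 ->
  euclid (p - q) <= euclid (x - y).
Proof.
move=> h1 h2; rewrite leNgt; apply/negP => h.
have h0 : 0 < euclid (p - q) by exact: le_lt_trans (euclid_ge0 _) h.
have : euclid (x - y) * euclid (p - q) < euclid (p - q) ^+ 2 by rewrite expr2 ltr_pM2r.
rewrite ltNge => /negP; apply; apply: le_trans (dot_le (x - y) (p - q)).
rewrite -dot_euclid; move: h1 h2; rewrite /dot /=; lra.
Qed.

Lemma nearest_point K x : compact K -> K !=set0 -> cvx K ->
  exists2 p, K p & forall z, K z -> dot (x - p) (z - p) <= 0.
Proof.
move=> cK K0 vK; have [p Kp hp] : exists2 p, K p & forall y, K y -> - euclid (x - y) <= - euclid (x - p).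
  apply: (compact_max_point (f := fun y => - euclid (x - y))) => //.
  apply: (@lipschitz_continuous _ _ 1) => y z; rewrite -opprD normrN mul1r.
  apply: le_trans (ler_dist_euclid _ _) _.
  by rewrite (_ : x - y - (x - z) = - (y - z)) ?euclidN//; congr pair; rewrite /=; ring.
exists p => // z Kz; rewrite leNgt; apply/negP => d0.
pose a := dot (x - p) (z - p); pose b := euclid (z - p) ^+ 2.
have b0 : 0 <= b by exact: sqr_ge0.
(* Moving from [p] a fraction [t] of the way to [z] changes the squared distance to [x] by
   [t (t b - 2 a)]. *)
have [t [t0 t1 tb]] : exists t, [/\ 0 < t, t <= 1 & t * b < 2 * a].
  rewrite -/a in d0; have ab : 0 < a + b by rewrite ltr_wpDr.
  exists (a / (a + b)); split; first by rewrite divr_gt0.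
    by rewrite ler_pdivrMr// mul1r lerDl.
  by rewrite mulrAC ltr_pdivrMr//; nra.
have := hp _ (vK _ _ t Kz Kp (ltW t0) t1).
rewrite lerN2 le_euclid ?euclid_ge0// sqr_euclid leNgt => /negP; apply.
move: tb; rewrite /b sqr_euclid /a /dot /= /GRing.scale /=.
set X := x.1; set Y := x.2; set P := p.1; set Q := p.2; set U := z.1; set V := z.2 => tb.
rewrite -subr_lt0.
have -> : (X - (t * U + (1 - t) * P)) ^+ 2 + (Y - (t * V + (1 - t) * Q)) ^+ 2 -
  ((X - P) ^+ 2 + (Y - Q) ^+ 2) =
  t * (t * ((U - P) ^+ 2 + (V - Q) ^+ 2) - 2 * ((X - P) * (U - P) + (Y - Q) * (V - Q))) by ring.
by rewrite pmulr_rlt0// subr_lt0.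
Qed.

(** The exit parameter is the supremum of those at which the ray is in [Omega]: closedness keeps
    that point in the set, and an interior point would allow a larger parameter. *)
Lemma exit_point Omega p (d : R * R) : compact Omega -> Omega p -> d != 0 ->
  exists2 t : R, 0 <= t & boundary Omega (p + t *: d).
Proof.
move=> cO Op d0; have cl := compact_closed2 cO.
have [M M0 hM] := compact_bounded2 cO.
have e0 : 0 < euclid d by exact: euclid_gt0.
pose T := [set t : R | 0 <= t /\ Omega (p + t *: d)].
have T0 : T 0 by split; rewrite // scale0r addr0.
have Tub : has_ubound T.
  exists ((2 * M) / euclid d) => t [t0 Ot]; rewrite ler_pdivlMr//.
  rewrite -(ger0_norm t0) -euclidZ (_ : t *: d = (p + t *: d) - p); last by rewrite addrAC subrr add0r.
  by apply: le_trans (euclidD _ _) _; rewrite euclidN mulr_natl mulr2n lerD// hM.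
have s0 : 0 <= sup T by exact: ub_le_sup T0.
exists (sup T) => //; apply/boundary_closed => //; split.
  apply: cl; apply/closureE => r r0.
  have [t [t0 Ot] ht] := sup_adherent (divr_gt0 r0 e0) (conj (ex_intro _ 0 T0) Tub).
  exists (p + t *: d) => //.
  rewrite (_ : _ - _ = (t - sup T) *: d); last by rewrite scalerBl opprD addrACA subrr add0r.
  rewrite euclidZ -ltr_pdivlMr// distrC ger0_norm ?subr_ge0 ?ub_le_sup//.
  by rewrite ltrBlDl -ltrBlDr.
move=> /interiorE[r r0 hr].
have : T (sup T + r / 2 / euclid d).
  split; first by rewrite addr_ge0// !divr_ge0// ltW.
  apply: hr; rewrite (_ : _ - _ = (r / 2 / euclid d) *: d); last first.
    by congr pair; rewrite /= /GRing.scale /=; ring.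
  rewrite euclidZ ger0_norm ?divr_ge0 ?divr_ge0 ?(ltW r0) ?(ltW e0)// divfK ?gt_eqF//.
  by rewrite ltr_pdivrMr// ltr_pMr// ltr1n.
move/(ub_le_sup Tub); rewrite gerDl leNgt => /negP; apply.
by rewrite !divr_gt0.
Qed.

(** The projection [P] on [K] is a contraction, so it is enough that [P] maps [boundary Omega] onto
    a set containing [boundary K]. A boundary point [y] of [K] is a limit of points [y'] outside
    [K]. The whole ray from [P y'] through [y'] projects to [P y'] and meets [boundary Omega]; so
    [P y'] is in the image, and [y] is too because the image is closed. *)
Lemma perimeter_mono K Omega : compact K -> cvx K -> K !=set0 -> compact Omega ->
  K `<=` Omega -> (H 1 (boundary K) <= H 1 (boundary Omega))%E.
Proof.
move=> cK vK K0 cO KO.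
have [P hP] := choice (fun x => let: ex_intro2 p a b := nearest_point x cK K0 vK in
  ex_intro (fun p => K p /\ forall z, K z -> dot (x - p) (z - p) <= 0) p (conj a b)).
have lip x y : euclid (P x - P y) <= euclid (x - y).
  have [Kx hx] := hP x; have [Ky hy] := hP y.
  by apply: euclid_le_dot; [exact: hx|exact: hy].
have uniq x p : K p -> (forall z, K z -> dot (x - p) (z - p) <= 0) -> P x = p.
  move=> Kp hp; have [Kx hx] := hP x; apply/eqP; rewrite -subr_eq0; apply/eqP/euclid_eq0/le_anti.
  by rewrite euclid_ge0 andbT -(euclid0 (R := R)) -[X in _ <= euclid X](subrr x); apply: euclid_le_dot; [exact: hx|exact: hp].
have fixK x : K x -> P x = x.
  by move=> Kx; apply: uniq => // z Kz; rewrite subrr /dot/= !mul0r addr0.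
have lip1 x y : euclid (P x - P y) <= 1 * euclid (x - y) by rewrite mul1r.
have cP : closed (P @` boundary Omega).
  apply: compact_closed2; apply: continuous_compact; last exact: compact_boundary.
  by apply: continuous_subspaceT; apply: lipschitz_continuous2 lip1.
apply: (@le_trans _ _ (H 1 (P @` boundary Omega))); last first.
  have := @unnormalized_lipschitz _ 1 1 P (boundary Omega) ler01 ltr01 lip1.
  by rewrite powR1 mul1e.
apply: le_unnormalized => y /(boundary_closed _ (compact_closed2 cK))[Ky niK].
apply: cP; apply/closureE => r r0.
have [y' nKy' yy'] : exists2 y', ~ K y' & euclid (y' - y) < r.
  apply: contrapT => h; apply: niK; apply/interiorE; exists r => // z zy.
  by apply: contrapT => nKz; apply: h; exists z.
have [Kp hp] := hP y'.
have d0 : y' - P y' != 0.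
  by apply/eqP => /subr0_eq h; apply: nKy'; rewrite h.
have [t t0 bz] := exit_point cO (KO _ Kp) d0.
exists (P y'); last by apply: le_lt_trans yy'; rewrite -{1}(fixK y Ky).
exists (P y' + t *: (y' - P y')) => //; apply: uniq => // z Kz.
rewrite addrAC subrr add0r.
have -> : dot (t *: (y' - P y')) (z - P y') = t * dot (y' - P y') (z - P y').
  by rewrite /dot /= /GRing.scale/=; ring.
by rewrite mulr_ge0_le0// hp.
Qed.

Lemma seg_cvx p q : cvx (seg p q).
Proof.
move=> _ _ t [a /andP[a0 a1] ->] [b /andP[b0 b1] ->] t0 t1.
exists (t * a + (1 - t) * b); first by apply/andP; split; nra.
by congr pair; rewrite /= /GRing.scale /=; ring.
Qed.

Lemma seg_compact p q : compact (seg p q).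
Proof.
pose f (t : R) := t *: p + (1 - t) *: q.
have -> : seg p q = f @` `[0, 1]%classic.
  apply/seteqP; split => x.
    by move=> [t t01 ->]; exists t => //; rewrite /= in_itv.
  by move=> [t]; rewrite /= in_itv/= => t01 <-; exists t.
apply: continuous_compact; last exact: segment_compact.
apply: continuous_subspaceT => t; apply: cvgD.
  by apply: cvgZr_tmp; exact: cvg_id.
by apply: cvgZr_tmp; apply: cvgB; [exact: cvg_cst|exact: cvg_id].
Qed.

Lemma boundary_seg p q : p != q -> boundary (seg p q) = seg p q.
Proof.
move=> pq; have cl := compact_closed2 (@seg_compact p q).
apply/seteqP; split => x; first by move=> /(boundary_closed x cl)[].
move=> sx; apply/boundary_closed => //; split => // /interiorE[r r0 hr].
have e0 : 0 < euclid (p - q) by rewrite euclid_gt0// subr_eq0.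
pose n : R * R := (- (p - q).2, (p - q).1).
have en : euclid n = euclid (p - q) by rewrite /euclid /= sqrrN addrC.
have : seg p q (x + (r / 2 / euclid (p - q)) *: n).
  apply: hr; rewrite addrAC subrr add0r euclidZ en ger0_norm ?divr_ge0 ?divr_ge0 ?(ltW r0) ?(ltW e0)//.
  by rewrite divfK ?gt_eqF// ltr_pdivrMr// ltr_pMr// ltr1n.
(* Two points of the line [pq] differ by a multiple of [p - q], which is orthogonal to [n]. *)
case: sx => a _ -> [b _ eqb].
have : dot ((r / 2 / euclid (p - q)) *: n) n = 0.
  rewrite (_ : _ *: n = b *: p + (1 - b) *: q - (a *: p + (1 - a) *: q)).
    by rewrite /n /dot /= /GRing.scale /=; ring.
  by rewrite -eqb addrAC subrr add0r.
have -> : dot ((r / 2 / euclid (p - q)) *: n) n = (r / 2 / euclid (p - q)) * dot n n.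
  by rewrite /dot /= /GRing.scale /=; ring.
rewrite dot_euclid en => /eqP; rewrite mulf_eq0 sqrf_eq0 !gt_eqF// ?divr_gt0 ?divr_gt0//.
Qed.

(** A segment has no interior, so it is its own boundary, and [perimeter_mono] compares [Omega] with
    this degenerate convex set. *)
Lemma dist_le_perimeter Omega x y : compact Omega -> cvx Omega -> Omega x -> Omega y ->
  ((euclid (x - y))%:E <= H 1 (boundary Omega))%E.
Proof.
move=> cO vO Ox Oy; have [->|xy] := eqVneq x y.
  by rewrite subrr euclid0 unnormalized_ge0.
apply: (@le_trans _ _ (H 1 (boundary (seg x y)))).
  by rewrite boundary_seg//; exact: unnormalized1_seg_ge.
apply: perimeter_mono => //; [exact: seg_compact|exact: seg_cvx| |].
  by exists y, 0; rewrite ?lexx ?ler01// scale0r subr0 scale1r add0r.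
by move=> _ [t /andP[t0 t1] ->]; exact: vO.
Qed.

Definition box r : set (R * R) := [set x | `|x.1| <= r /\ `|x.2| <= r].

Lemma box_compact r : compact (box r).
Proof.
have -> : box r = `[- r, r]%classic `*` `[- r, r]%classic.
  by apply/seteqP; split => x; rewrite /box /= !in_itv/= -!ler_norml.
by apply: compact_setX; exact: segment_compact.
Qed.

Lemma box_cvx r : cvx (box r).
Proof.
move=> x y t [x1 x2] [y1 y2] t0 t1.
by move: x1 x2 y1 y2; rewrite /box /= /GRing.scale /= !ler_norml
  => /andP[? ?] /andP[? ?] /andP[? ?] /andP[? ?]; split; apply/andP; split; nra.
Qed.

Lemma box_interior r x : `|x.1| < r -> `|x.2| < r -> interior (box r) x.
Proof.
move=> h1 h2; apply/interiorE; exists (Num.min (r - `|x.1|) (r - `|x.2|)).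
  by rewrite lt_min !subr_gt0 h1.
move=> y; rewrite lt_min => /andP[y1 y2].
have := le_lt_trans (norm1_le_euclid _) y1; have := le_lt_trans (norm2_le_euclid _) y2.
rewrite /= => k2 k1; split.
  by have := ler_normD (y.1 - x.1) x.1; rewrite subrK; lra.
by have := ler_normD (y.2 - x.2) x.2; rewrite subrK; lra.
Qed.

Lemma box_perimeter r : 0 < r -> (H 1 (boundary (box r)) <= (8 * r)%:E)%E.
Proof.
move=> r0; pose S (a b c d : R) := seg (a, b) (c, d).
apply: (@le_trans _ _ (H 1 ((S r r r (- r) `|` S (- r) r (- r) (- r)) `|`
   (S r r (- r) r `|` S r (- r) (- r) (- r))))).
  apply: le_unnormalized => x /(boundary_closed _ (compact_closed2 (@box_compact r)))[[h1 h2] ni].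
  have tt (a : R) : `|a| <= r -> 0 <= (a / r + 1) / 2 <= 1 /\ a = (a / r + 1) / 2 * r + (1 - (a / r + 1) / 2) * - r.
    rewrite ler_norml => /andP[ar ra]; split; last by field; rewrite gt_eqF.
    have : a / r <= 1 by rewrite ler_pdivrMr ?mul1r.
    have : - 1 <= a / r by rewrite ler_pdivlMr ?mulN1r.
    by move=> *; apply/andP; split; lra.
  have tr (t : R) : t * r + (1 - t) * r = r by ring.
  have tr' (t : R) : t * (- r) + (1 - t) * (- r) = - r by ring.
  have [x1|x1] := ltP `|x.1| r.
    have [x2|x2] := ltP `|x.2| r; first by exfalso; apply: ni; exact: box_interior.
    have {}x2 : `|x.2| = r by apply/le_anti; rewrite h2 x2.
    have [t01 e1] := tt _ h1; right.
    have [p2|n2] := leP 0 x.2; [left|right]; exists ((x.1 / r + 1) / 2) => //.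
      by rewrite (surjective_pairing x); congr pair; rewrite // tr -(ger0_norm p2).
    rewrite (surjective_pairing x); congr pair; rewrite //= tr' -x2 ltr0_norm// opprK//.
  have {}x1 : `|x.1| = r by apply/le_anti; rewrite h1 x1.
  have [t01 e1] := tt _ h2; left.
  have [p2|n2] := leP 0 x.1; [left|right]; exists ((x.2 / r + 1) / 2) => //.
    by rewrite (surjective_pairing x); congr pair; rewrite // tr -(ger0_norm p2).
  rewrite (surjective_pairing x); congr pair; rewrite //= tr' -x1 ltr0_norm// opprK//.
have le2 a b c d : euclid ((a, b) - (c, d)) <= 2 * r -> (H 1 (S a b c d) <= (2 * r)%:E)%E.
  by move=> h; apply: le_trans (unnormalized1_seg_le (@subset_refl _ _)) _; rewrite lee_fin.
have e2 : `|r - - r| = 2 * r by rewrite opprK ger0_norm; lra.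
have -> : (8 * r)%:E = ((2 * r)%:E + (2 * r)%:E + ((2 * r)%:E + (2 * r)%:E))%E.
  by rewrite -!EFinD; congr EFin; ring.
apply: le_trans (unnormalizedU _ _ _) _; apply: leeD;
  apply: le_trans (unnormalizedU _ _ _) _; apply: leeD; apply: le2;
  apply: le_trans (euclid_le_norm12 _) _; rewrite /= ?subrr ?normr0 ?e2 ?addr0 ?add0r//.
Qed.

Lemma perimeter_finite Omega M : compact Omega -> cvx Omega -> Omega !=set0 -> 0 < M ->
  (forall x, Omega x -> euclid x <= M) -> (H 1 (boundary Omega) <= (8 * M)%:E)%E.
Proof.
move=> cO vO O0 M0 hM; apply: le_trans (box_perimeter M0); apply: perimeter_mono => //.
  exact: box_compact.
by move=> x /hM h; split; apply: le_trans h; [exact: norm1_le_euclid|exact: norm2_le_euclid].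
Qed.

Lemma area_finite Omega M : 0 < M ->
  (forall x, Omega x -> euclid x <= M) -> (H 2 Omega <= (16 * M ^+ 2)%:E)%E.
Proof.
move=> M0 hM.
have -> : 16 * M ^+ 2 = 4 * euclid (2 * M, 0) * euclid (0, 2 * M).
  rewrite /euclid /= !expr0n /= addr0 add0r !sqrtr_sqr ger0_norm ?mulr_ge0 ?ltW//; ring.
apply: (@unnormalized2_parallelogram_le _ (- M, - M)) => x /hM h.
have := le_trans (norm1_le_euclid _) h; have := le_trans (norm2_le_euclid _) h.
rewrite !ler_norml => /andP[? ?] /andP[? ?].
exists ((x.1 + M) / (2 * M)), ((x.2 + M) / (2 * M)); split.
- by rewrite divr_ge0 ?ler_pdivrMr//; lra.
- by rewrite divr_ge0 ?ler_pdivrMr//; lra.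
rewrite [LHS]surjective_pairing; congr pair; rewrite /= /GRing.scale /=; field; rewrite gt_eqF//; lra.
Qed.

End Perimeter.

(** * Lebesgue measure and the distance integral *)

Section Measurability.
Context {R : realType}.
Implicit Types (A B U : set (R * R)) (x y z c : R * R) (t r : R).

Local Notation mR := (measurableTypeR R).
Local Notation mR2 := (mR * mR)%type.

(** [U] is the countable union of the rational squares that it contains; the other squares are
    replaced by the empty set. *)
Lemma open_measurable2 U : open U -> measurable (U : set mR2).
Proof.
move=> oU.
pose Q (a b r : rat) : set (R * R) :=
  `](ratr a - ratr r), (ratr a + ratr r)[%classic `*` `](ratr b - ratr r), (ratr b + ratr r)[%classic.
pose F (a b r : rat) := if `[< Q a b r `<=` U >] then Q a b r else set0.
have -> : U = \bigcup_(a : rat) \bigcup_(b : rat) \bigcup_(r : rat) F a b r.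
  apply/seteqP; split => x; last first.
    move=> [a _ [b _ [r _]]]; rewrite /F; case: ifPn => [/asboolP h q|_ []]; exact: h.
  move=> Ux.
  have /nbhs_euclid[e e0 he] : nbhs x U by exact: open_nbhs_nbhs (conj oU Ux).
  (* In a square of half-side [r] containing [x], each coordinate varies by at most [2 r], so the
     distance to [x] is at most [4 r < e]. *)
  have [r /andP[r0 re]] : exists r : rat, 0 < (ratr r : R) < e / 4.
    have [|r] := @rat_in_itvoo R 0 (e / 4); first by rewrite divr_gt0.
    by rewrite in_itv/= => h; exists r.
  have nearq (u : R) : exists q : rat, ratr q - ratr r < u < ratr q + ratr r.
    have [|q] := @rat_in_itvoo R (u - ratr r) (u + ratr r); first by lra.
    by rewrite in_itv/= => /andP[? ?]; exists q; apply/andP; split; lra.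
  have [a /andP[a1 a2]] := nearq x.1; have [b /andP[b1 b2]] := nearq x.2.
  exists a => //; exists b => //; exists r => //.
  rewrite /F ifT; first by split; rewrite /= in_itv/=; apply/andP.
  apply/asboolP => y; rewrite /Q /= !in_itv/= => -[/andP[? ?] /andP[? ?]].
  apply: he; apply: le_lt_trans (euclid_le_norm12 _) _; rewrite /=.
  have h1 : `|y.1 - x.1| <= 2 * ratr r by rewrite ler_norml; apply/andP; split; lra.
  have h2 : `|y.2 - x.2| <= 2 * ratr r by rewrite ler_norml; apply/andP; split; lra.
  lra.
apply: bigcupT_measurable_rat => a; apply: bigcupT_measurable_rat => b.
apply: bigcupT_measurable_rat => r; rewrite /F; case: ifP => // _.
by apply: measurableX; exact: measurable_itv.
Qed.

Lemma closed_measurable2 A : closed A -> measurable (A : set mR2).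
Proof. by move=> cA; rewrite -[X in measurable X](setCK A); apply: measurableC; apply: open_measurable2; exact: closed_openC. Qed.

Lemma continuous_measurable_fun2 (f : R * R -> R) (D : set (R * R)) :
  continuous f -> measurable_fun (D : set mR2) (f : mR2 -> mR).
Proof.
move=> cf; apply: (@measurable_funS _ _ _ _ setT) => //.
apply: (measurability _ (RGenOpens.measurableE R)) => _ [_ [a [b ->] <-]].
by rewrite setTI; apply: open_measurable2; move/continuousP: cf; apply; exact: interval_open.
Qed.

Definition sim t c x : R * R := t *: x + c.

Lemma measurable_sim t c : measurable_fun setT (sim t c : mR2 -> mR2).
Proof.
apply: measurable_fun_pair; apply: continuous_measurable_fun2;
  apply: (@lipschitz_continuous _ _ `|t|) => x y; rewrite /= /GRing.scale /=.
  rewrite (_ : _ - _ = t * (x - y).1); last by rewrite /=; ring.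
  by rewrite normrM ler_wpM2l// norm1_le_euclid.
rewrite (_ : _ - _ = t * (x - y).2); last by rewrite /=; ring.
by rewrite normrM ler_wpM2l// norm2_le_euclid.
Qed.

Local Notation pushforward_measure :=
  measure_function_pushforward__canonical__measure_function_Measure.

(** The pushforward under the affine map, multiplied by [t], agrees with Lebesgue measure on
    half-open intervals, and these determine it. *)
Lemma lebesgue_measure_affine (t c : R) (A : set R) : 0 < t -> measurable A ->
  lebesgue_measure A = (t%:E * lebesgue_measure ((fun u : R => (t * u + c)%R) @^-1` A))%E.
Proof.
move=> t0 mA; pose phi (x : measurableTypeR R) : measurableTypeR R := t * x + c.
have mphi : measurable_fun setT phi.
  apply: continuous_measurable_fun => x; apply: cvgD; last exact: cvg_cst.
  by apply: cvgM; [exact: cvg_cst|exact: cvg_id].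
have t0' : 0 <= t by exact: ltW.
pose m' := mscale (NngNum t0') (pushforward_measure lebesgue_measure mphi).
apply: (@lebesgue_measure_unique R m') => //.
move=> _ /ocitvP[->|[[a b] /= ab ->]]; first by rewrite !measure0.
rewrite /m' /= /mscale /= /pushforward.
have -> : phi @^-1` `]a, b] = `](a - c) / t, (b - c) / t]%classic.
  apply/seteqP; split => x; rewrite /phi /= !in_itv/= ltr_pdivrMr// ler_pdivlMr//.
    by move=> /andP[? ?]; apply/andP; split; lra.
  by move=> /andP[? ?]; apply/andP; split; lra.
rewrite !lebesgue_measure_itv/= !lte_fin ab ltr_pM2r ?invr_gt0// ltrD2r ab.
rewrite -!EFinB -EFinM; congr EFin; field; rewrite gt_eqF//.
Qed.

Local Notation leb2 := (lebesgue_measure \x lebesgue_measure)%E.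

Lemma lebesgue2_sim t c A : 0 < t -> measurable (A : set mR2) ->
  leb2 A = ((t ^+ 2)%:E * leb2 (sim t c @^-1` A))%E.
Proof.
move=> t0 mA; have t0' : 0 <= t ^+ 2 by exact: sqr_ge0.
pose m' := mscale (NngNum t0') (pushforward_measure leb2 (measurable_sim t c)).
rewrite -[RHS]/(m' A).
apply: (@product_measure_unique _ _ _ _ R lebesgue_measure lebesgue_measure m') => // X Y mX mY.
rewrite /m' /= /mscale /= /pushforward.
have -> : sim t c @^-1` (X `*` Y) = ((fun u : R => (t * u + c.1)%R) @^-1` X) `*` ((fun u : R => (t * u + c.2)%R) @^-1` Y) by [].
have maff (a : R) (Z : set R) : measurable Z -> measurable ((fun u : R => (t * u + a)%R) @^-1` Z).
  move=> mZ; rewrite -[X in measurable X]setTI.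
  suff : measurable_fun setT (fun x : R => t * x + a) by apply.
  apply: continuous_measurable_fun => x; apply: cvgD; last exact: cvg_cst.
  by apply: cvgM; [exact: cvg_cst|exact: cvg_id].
transitivity ((t ^+ 2)%:E * (lebesgue_measure ((fun u : R => (t * u + c.1)%R) @^-1` X) *
   lebesgue_measure ((fun u : R => (t * u + c.2)%R) @^-1` Y)))%E.
  by congr (_ * _)%E; apply: product_measure1E; exact: maff.
rewrite [in RHS](lebesgue_measure_affine c.1 t0 mX) [in RHS](lebesgue_measure_affine c.2 t0 mY).
by rewrite expr2 EFinM muleACA.
Qed.

Lemma integral_sim t c (D : set (R * R)) (f : R * R -> \bar R) : 0 < t -> measurable (D : set mR2) ->
  measurable_fun (D : set mR2) f -> (forall x, 0 <= f x)%E ->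
  (\int[leb2]_(x in D) f x = (t ^+ 2)%:E * \int[leb2]_(x in sim t c @^-1` D) f (sim t c x))%E.
Proof.
move=> t0 mD mf f0; have t0' : 0 <= t ^+ 2 by exact: sqr_ge0.
rewrite (@eq_measure_integral _ _ _ _ (mscale (NngNum t0') (pushforward_measure leb2 (measurable_sim t c)))); last first.
  by move=> A mA _; exact: lebesgue2_sim.
have h := ge0_integral_mscale (pushforward_measure leb2 (measurable_sim t c)) mD (NngNum t0') mf (fun x _ => f0 x).
apply: etrans h _.
have k := ge0_integral_pushforward (measurable_sim t c) leb2 mD mf (fun x _ => f0 x).
rewrite [X in (_ * X)%E = _]k.
have -> : (NngNum t0')%:num = t ^+ 2 by [].
exact: erefl.
Qed.

End Measurability.

(** * The distance integral under inclusion and scaling *)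

Section DistanceIntegral.
Context {R : realType}.
Implicit Types (A B K Omega : set (R * R)) (x y z c : R * R) (t r s p M : R).
Local Notation leb2 := (@lebesgue_measure R \x @lebesgue_measure R)%E.
Local Notation mR := (measurableTypeR R).
Local Notation mR2 := (mR * mR)%type.
Local Notation H := unnormalized_hausdorff.

Definition dist_integral p Omega : \bar R :=
  (\int[leb2]_(x in Omega) (dist x (boundary Omega) `^ p)%:E)%E.

Lemma dist_set_lb x A : has_lbound [set euclid (x - y) | y in A].
Proof. by exists 0 => _ [y _ <-]; exact: euclid_ge0. Qed.

Lemma dist_ge0 x A : 0 <= dist x A.
Proof.
have [->|/set0P[y Ay]] := eqVneq A set0; first by rewrite /dist image_set0 inf0.
by apply: lb_le_inf; [exists (euclid (x - y)), y|move=> _ [z _ <-]; exact: euclid_ge0].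
Qed.

Lemma dist_le x y A : A y -> dist x A <= euclid (x - y).
Proof. by move=> Ay; apply: ge_inf; [exact: dist_set_lb|exists y]. Qed.

Lemma dist_ge x A r : A !=set0 -> (forall y, A y -> r <= euclid (x - y)) -> r <= dist x A.
Proof.
move=> [y Ay] h; apply: lb_le_inf; first by exists (euclid (x - y)), y.
by move=> _ [z Az <-]; exact: h.
Qed.

Lemma dist_lipschitz x y A : A !=set0 -> `|dist x A - dist y A| <= euclid (x - y).
Proof.
move=> A0.
have key u v : dist u A - euclid (u - v) <= dist v A.
  apply: dist_ge => // z Az; rewrite lerBlDr.
  by apply: le_trans (dist_le u Az) _; rewrite [X in _ <= X]addrC; exact: euclidB_trans.
rewrite ler_norml; have := key x y; have := key y x; rewrite (euclidBC y x).
by move=> *; apply/andP; split; lra.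
Qed.

Lemma nonzero_vector : ((1, 0) : R * R) != 0.
Proof. by apply/eqP => -[/eqP]; rewrite oner_eq0. Qed.

Lemma boundary_nonempty Omega : compact Omega -> Omega !=set0 -> boundary Omega !=set0.
Proof.
by move=> cO [x Ox]; have [t _ bt] := exit_point cO Ox nonzero_vector; eexists; exact: bt.
Qed.

Lemma dist_boundary_ge Omega x r : compact Omega -> Omega !=set0 ->
  (forall y, euclid (y - x) < r -> Omega y) -> r <= dist x (boundary Omega).
Proof.
move=> cO O0 h; apply: dist_ge; first exact: boundary_nonempty.
move=> y /(boundary_closed y (compact_closed2 cO))[Oy ni]; rewrite leNgt; apply/negP => xy.
apply: ni; apply/interiorE; exists (r - euclid (x - y)); first by rewrite subr_gt0.
move=> z zy; apply: h; apply: le_lt_trans (euclidB_trans y z x) _.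
by rewrite (euclidBC y x) -ltrBrDr.
Qed.

(** If [y] were outside, convexity would make the ray from [x] through [y] leave [Omega] no later
    than [y], at a boundary point closer than the distance to the boundary. *)
Lemma dist_boundary_in Omega x y : compact Omega -> cvx Omega -> Omega x ->
  euclid (y - x) < dist x (boundary Omega) -> Omega y.
Proof.
move=> cO vO Ox xy; apply: contrapT => nOy.
have d0 : y - x != 0 by apply/eqP => /subr0_eq h; apply: nOy; rewrite h.
have [t t0 bt] := exit_point cO Ox d0.
have [Ot _] := (boundary_closed _ (compact_closed2 cO)).1 bt.
have t1 : t <= 1.
  rewrite leNgt; apply/negP => t1; apply: nOy.
  have t0' : t != 0 by rewrite gt_eqF// (lt_trans ltr01).
  rewrite (_ : y = t^-1 *: (x + t *: (y - x)) + (1 - t^-1) *: x).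
    by apply: vO => //; rewrite ?invr_ge0// invf_le1 ?(ltW t1)// (lt_trans ltr01).
  by rewrite [LHS]surjective_pairing; congr pair; rewrite /= /GRing.scale /=; field.
have := dist_le x bt; rewrite opprD addrA subrr add0r euclidN euclidZ ger0_norm// leNgt => /negP; apply.
by apply: le_lt_trans xy; rewrite ler_piMl// euclid_ge0.
Qed.

Lemma dist_boundary_mono K Omega x : compact K -> cvx K -> K x -> compact Omega ->
  K `<=` Omega -> dist x (boundary K) <= dist x (boundary Omega).
Proof.
move=> cK vK Kx cO KO; apply: dist_boundary_ge => //; first by exists x; exact: KO.
by move=> y yx; apply: KO; exact: dist_boundary_in yx.
Qed.

Lemma measurable_compact2 A : compact A -> measurable (A : set mR2).
Proof. by move=> /compact_closed2; exact: closed_measurable2. Qed.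

Lemma measurable_dist_powR p A (D : set (R * R)) : A !=set0 ->
  measurable_fun (D : set mR2) (fun x : mR2 => (dist x A `^ p)%:E).
Proof.
move=> A0; apply/measurable_EFinP.
apply: (@measurableT_comp _ _ _ _ _ _ (fun u : mR => u `^ p)); first exact: measurable_powR.
apply: continuous_measurable_fun2; apply: (@lipschitz_continuous _ _ 1) => x y.
by rewrite mul1r; exact: dist_lipschitz.
Qed.

Lemma dist_integral_ge0 p Omega : (0 <= dist_integral p Omega)%E.
Proof. by apply: integral_ge0 => x _; rewrite lee_fin powR_ge0. Qed.

Lemma dist_integral_mono p K Omega : 0 <= p -> compact K -> cvx K -> K !=set0 ->
  compact Omega -> K `<=` Omega -> (dist_integral p K <= dist_integral p Omega)%E.
Proof.
move=> p0 cK vK K0 cO KO.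
have bK := boundary_nonempty cK K0.
have bO : boundary Omega !=set0.
  by apply: boundary_nonempty => //; case: K0 => x Kx; exists x; exact: KO.
apply: (@le_trans _ _ (\int[leb2]_(x in K) (dist x (boundary Omega) `^ p)%:E)%E).
  apply: ge0_le_integral.
  - exact: measurable_compact2.
  - by move=> x _; rewrite lee_fin powR_ge0.
  - exact: measurable_dist_powR.
  - exact: measurable_dist_powR.
  - by move=> x Kx; rewrite lee_fin ge0_ler_powR ?nnegrE ?dist_ge0// dist_boundary_mono.
apply: ge0_subset_integral => //.
- exact: measurable_compact2.
- exact: measurable_compact2.
- exact: measurable_dist_powR.
- by move=> x _; rewrite lee_fin powR_ge0.
Qed.

Lemma simK t c x : t != 0 -> sim t^-1 (- (t^-1 *: c)) (sim t c x) = x.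
Proof. by move=> t0; rewrite /sim scalerDr scalerA mulVf// scale1r addrK. Qed.

Lemma simVK t c x : t != 0 -> sim t c (sim t^-1 (- (t^-1 *: c)) x) = x.
Proof. by move=> t0; rewrite /sim scalerDr scalerA mulfV// scale1r scalerN scalerA mulfV// scale1r subrK. Qed.

Lemma euclid_sim t c x y : euclid (sim t c x - sim t c y) = `|t| * euclid (x - y).
Proof. by rewrite /sim opprD addrACA subrr addr0 -scalerBr euclidZ. Qed.

Lemma sim_preimage t c A : t != 0 -> sim t c @^-1` (sim t c @` A) = A.
Proof.
move=> t0; apply/seteqP; split => [x /= [y Ay]|x Ax]; last by exists x.
by move/(congr1 (sim t^-1 (- (t^-1 *: c)))); rewrite !simK// => <-.
Qed.

Lemma sim_continuous t c : continuous (sim t c : R * R -> R * R).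
Proof. by apply: (@lipschitz_continuous2 _ _ `|t|) => x y; rewrite euclid_sim. Qed.

Lemma sim_compact t c A : compact A -> compact (sim t c @` A).
Proof. by move=> cA; apply: continuous_compact => //; apply: continuous_subspaceT; exact: sim_continuous. Qed.

Lemma sim_cvx t c A : cvx A -> cvx (sim t c @` A).
Proof.
move=> vA _ _ s [x Ax <-] [y Ay <-] s0 s1; exists (s *: x + (1 - s) *: y); first exact: vA.
by congr pair; rewrite /= /GRing.scale /=; ring.
Qed.

Lemma sim_interior t c A x : 0 < t -> interior A x -> interior (sim t c @` A) (sim t c x).
Proof.
move=> t0 /interiorE[r r0 hr]; apply/interiorE; exists (t * r); first exact: mulr_gt0.
move=> y yx; rewrite -(simVK c y (lt0r_neq0 t0)); apply: imageP; apply: hr.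
rewrite -(ltr_pM2l t0) -[X in X * _](gtr0_norm t0) -(euclid_sim t c) simVK// lt0r_neq0//.
Qed.

Lemma sim_image_inv t c A : t != 0 -> sim t^-1 (- (t^-1 *: c)) @` (sim t c @` A) = A.
Proof.
move=> t0; apply/seteqP; split => z; first by move=> [_ [y Ay <-] <-]; rewrite simK.
by move=> Az; exists (sim t c z); [exists z|rewrite simK].
Qed.

Lemma sim_boundary t c A : 0 < t -> compact A ->
  boundary (sim t c @` A) = sim t c @` boundary A.
Proof.
move=> t0 cA; have cl := compact_closed2 cA.
have cl' := compact_closed2 (@sim_compact t c _ cA).
have tn0 := lt0r_neq0 t0.
apply/seteqP; split => x.
  move=> /(boundary_closed _ cl')[[y Ay <-] ni]; exists y => //; apply/boundary_closed => //.
  by split => // iA; apply: ni; exact: sim_interior.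
move=> [y /(boundary_closed _ cl)[Ay ni] <-]; apply/boundary_closed => //; split; first by exists y.
move=> h; apply: ni.
have := @sim_interior t^-1 (- (t^-1 *: c)) _ _ _ h; rewrite simK// invr_gt0 => /(_ t0).
by rewrite sim_image_inv.
Qed.

Lemma dist_sim t c x A : 0 < t -> A !=set0 -> dist (sim t c x) (sim t c @` A) = t * dist x A.
Proof.
move=> t0 A0; apply/le_anti/andP; split.
  rewrite -ler_pdivrMl//; apply: dist_ge => // y Ay; rewrite ler_pdivrMl//.
  rewrite -[X in X * _](gtr0_norm t0) -(euclid_sim t c); apply: dist_le; exact: imageP.
apply: dist_ge; first by case: A0 => y Ay; exists (sim t c y), y.
by move=> _ [y Ay <-]; rewrite euclid_sim gtr0_norm// ler_pM2l// dist_le.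
Qed.

(** The exponent is [p] from the distance plus 2 from the area. *)
Lemma dist_integral_sim p t c Omega : 0 < t -> compact Omega -> Omega !=set0 ->
  (dist_integral p (sim t c @` Omega) = (t `^ (p + 2))%:E * dist_integral p Omega)%E.
Proof.
move=> t0 cO O0; rewrite /dist_integral sim_boundary//.
have bO := boundary_nonempty cO O0.
have bO' : sim t c @` boundary Omega !=set0 by case: bO => y By; exists (sim t c y), y.
have h := @integral_sim R t c (sim t c @` Omega) (fun x => (dist x (sim t c @` boundary Omega) `^ p)%:E) t0.
rewrite h; last 3 first.
- by apply: measurable_compact2; exact: sim_compact.
- exact: measurable_dist_powR.
- by move=> x; rewrite lee_fin powR_ge0.
rewrite (sim_preimage _ _ (lt0r_neq0 t0)).
have e x : (dist (sim t c x) (sim t c @` boundary Omega) `^ p)%:E =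
    ((t `^ p)%:E * (dist x (boundary Omega) `^ p)%:E)%E.
  by rewrite (dist_sim c x t0 bO) (powRM p (ltW t0) (dist_ge0 _ _)) EFinM.
have mf := @measurable_dist_powR p _ Omega bO.
have f0 (x : mR2) : Omega x -> (0 <= (dist x (boundary Omega) `^ p)%:E)%E.
  by move=> _; rewrite lee_fin powR_ge0.
have k1 := @ge0_integralZl_EFin _ mR2 R leb2 Omega (measurable_compact2 cO) _ f0 mf (t `^ p) (powR_ge0 t p).
have k2 : (\int[leb2]_(x in Omega) (dist (sim t c x) (sim t c @` boundary Omega) `^ p)%:E =
    \int[leb2]_(x in Omega) ((t `^ p)%:E * (dist x (boundary Omega) `^ p)%:E))%E.
  by congr (integral _ _ _); apply/funext; exact: e.
rewrite [X in (_ * X)%E = _]k2 [X in (_ * X)%E = _]k1.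
rewrite muleA; congr (_ * _)%E; rewrite -EFinM -(powR_mulrn _ (ltW t0)) -powRD ?(lt0r_neq0 t0) ?implybT//.
by rewrite addrC.
Qed.

Lemma unnormalized_sim s t c A : 0 <= s -> 0 < t ->
  (H s (sim t c @` A) = (t `^ s)%:E * H s A)%E.
Proof.
move=> s0 t0; apply/le_anti/andP; split.
  by apply: unnormalized_lipschitz => // x y; rewrite euclid_sim gtr0_norm.
have tV0 : 0 < t^-1 by rewrite invr_gt0.
rewrite -lee_pdivlMl ?powR_gt0//.
have -> : (t `^ s)^-1 = t^-1 `^ s.
  apply: (mulfI (x := t `^ s)); first by rewrite gt_eqF// powR_gt0.
  by rewrite mulfV ?gt_eqF ?powR_gt0// -powRM ?(ltW t0) ?(ltW tV0)// mulfV ?gt_eqF// powR1.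
rewrite -{1}(sim_image_inv c A (lt0r_neq0 t0)).
by apply: unnormalized_lipschitz => // x y; rewrite euclid_sim gtr0_norm.
Qed.

Lemma dist_integral_finite p Omega M : 0 <= p -> compact Omega -> cvx Omega -> Omega !=set0 ->
  0 < M -> (forall x, Omega x -> euclid x <= M) -> (dist_integral p Omega < +oo)%E.
Proof.
move=> p0 cO vO O0 M0 hM; have bO := boundary_nonempty cO O0.
have dM x : Omega x -> dist x (boundary Omega) <= 2 * M.
  move=> Ox; case: bO => y bO; apply: le_trans (dist_le x bO) _.
  apply: le_trans (euclidD _ _) _; rewrite euclidN mulr_natl mulr2n lerD ?hM//.
  by case: ((boundary_closed y (compact_closed2 cO)).1 bO).
apply: (@le_lt_trans _ _ (\int[leb2]_(x in Omega) cst ((2 * M) `^ p)%:E x)%E).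
  apply: ge0_le_integral.
  - exact: measurable_compact2.
  - by move=> x _; rewrite lee_fin powR_ge0.
  - exact: measurable_dist_powR.
  - exact: measurable_cst.
  - by move=> x Ox; rewrite lee_fin ge0_ler_powR ?nnegrE ?dist_ge0 ?dM ?mulr_ge0// ltW.
rewrite integral_cst; last exact: measurable_compact2.
apply: (@le_lt_trans _ _ (((2 * M) `^ p)%:E * (4%:E * H 2 Omega))%E).
  by rewrite lee_pmul2l ?lte_fin ?powR_gt0 ?mulr_gt0//; apply: unnormalized2_ge => //; exact: measurable_compact2.
apply: (@le_lt_trans _ _ (((2 * M) `^ p)%:E * (4%:E * (16 * M ^+ 2)%:E))%E).
  by rewrite !lee_pmul2l ?lte_fin ?powR_gt0 ?mulr_gt0//; exact: area_finite.
by rewrite -!EFinM ltry.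
Qed.

End DistanceIntegral.

(** * Convex bodies *)

Section Bodies.
Context {R : realType}.
Implicit Types (A B K Omega : set (R * R)) (x y z c : R * R) (t r s p M lambda : R).
Local Notation H := unnormalized_hausdorff.

Lemma normr_det_le x y : `|det x y| <= euclid x * euclid y.
Proof.
have h1 := dot_le x (y.2, - y.1); have h2 := dot_le x (- y.2, y.1).
have e1 : euclid (y.2, - y.1) = euclid y by rewrite /euclid /= sqrrN addrC.
have e2 : euclid (- y.2, y.1) = euclid y by rewrite /euclid /= sqrrN addrC.
rewrite e1 /dot /= in h1; rewrite e2 /dot /= in h2.
by rewrite /det ler_norml; apply/andP; split; lra.
Qed.

Lemma cvx3 Omega x y z (a b c : R) : cvx Omega -> Omega x -> Omega y -> Omega z ->
  0 <= a -> 0 <= b -> 0 <= c -> a + b + c = 1 -> Omega (a *: x + b *: y + c *: z).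
Proof.
move=> vO Ox Oy Oz a0 b0 c0 abc.
have [c1|c1] := eqVneq c 1.
  have -> : a = 0 by lra.
  have -> : b = 0 by lra.
  by rewrite c1 !scale0r !add0r scale1r.
have d0 : 1 - c != 0 by rewrite subr_eq0 eq_sym.
have d1 : 0 < 1 - c by rewrite lt_neqAle eq_sym d0 /=; lra.
have -> : a *: x + b *: y + c *: z =
  (1 - c) *: ((a / (1 - c)) *: x + (1 - a / (1 - c)) *: y) + (1 - (1 - c)) *: z.
  have -> : b = 1 - a - c by lra.
  by congr pair; rewrite /= /GRing.scale /=; field.
have hv : Omega ((a / (1 - c)) *: x + (1 - a / (1 - c)) *: y).
  by apply: vO => //; rewrite ?divr_ge0 ?ler_pdivrMr//; lra.
by apply: vO => //; lra.
Qed.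

(** At the centroid all barycentric coordinates are 1/3. The radius is such that [w] changes two of
    them by at most 1/6 each, hence the third by at most 1/3. *)
Lemma triangle_ball Omega x y z L : cvx Omega -> Omega x -> Omega y -> Omega z ->
  0 < L -> euclid (y - x) <= L -> euclid (z - x) <= L -> det (y - x) (z - x) != 0 ->
  forall w, euclid w <= `|det (y - x) (z - x)| / (6 * L) ->
    Omega (3^-1 *: (x + y + z) + w).
Proof.
move=> vO Ox Oy Oz L0 yL zL; set D := det _ _ => D0 w wD.
have D0' : 0 < `|D| by rewrite normr_gt0.
have bound u v : euclid u <= `|D| / (6 * L) -> euclid v <= L -> `|det u v / D| <= 6^-1 /\ `|det v u / D| <= 6^-1.
  move=> hu hv; have h : euclid u * euclid v <= `|D| / (6 * L) * L.
    by apply: ler_pM => //; exact: euclid_ge0.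
  rewrite (_ : `|D| / (6 * L) * L = 6^-1 * `|D|) in h; last by field; rewrite gt_eqF.
  rewrite !normrM normfV !ler_pdivrMr//; split; apply: le_trans (normr_det_le _ _) _ => //.
  by rewrite mulrC.
have [+ _] := bound _ _ wD zL; have [_ +] := bound _ _ wD yL.
rewrite !ler_norml => /andP[h1 h2] /andP[h3 h4].
set P := det w (z - x) / D in h3 h4; set Q := det (y - x) w / D in h1 h2.
have -> : 3^-1 *: (x + y + z) + w =
  (3^-1 - P - Q) *: x + (3^-1 + P) *: y + (3^-1 + Q) *: z.
  move: D0; rewrite /P /Q /D /det /= => D0.
  by congr pair; rewrite /= /GRing.scale /=; field.
apply: cvx3 => //; lra.
Qed.

(** Nonempty interior stands for dimension 2; [admissibleP] shows that both give the same class. *)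
Definition body Omega := [/\ compact Omega, cvx Omega & interior Omega !=set0].

Lemma body_ball Omega : body Omega -> exists2 c, Omega c &
  exists2 r, 0 < r & forall y, euclid (y - c) < r -> Omega y.
Proof.
move=> [_ _ [c /interiorE[r r0 h]]]; exists c; last by exists r.
by apply: h; rewrite subrr euclid0.
Qed.

Lemma body_two Omega : body Omega -> exists x y, [/\ Omega x, Omega y & x != y].
Proof.
move=> /body_ball[c Oc [r r0 h]]; exists c, (c + (r / 2, 0)); split => //.
  apply: h; rewrite addrAC subrr add0r /euclid /= expr0n addr0 sqrtr_sqr gtr0_norm ?divr_gt0//.
  by rewrite ltr_pdivrMr// ltr_pMr// ltr1n.
apply/eqP => /(congr1 fst) /= /eqP; rewrite -subr_eq0 opprD addrA subrr add0r oppr_eq0.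
by rewrite gt_eqF// divr_gt0.
Qed.

(** Take [y] farthest from [x], at distance [L], and [z] farthest from the line [xy], at height
    [|D| / L]. The triangle contains a disk of radius [rho = |D| / (6 L)], and [Omega] lies in a
    rectangle with sides [2 L] and [2 |D| / L]. The parallelogram bound for it is
    [16 |D| = 96 rho L], and [L] is at most the perimeter. *)
Lemma inradius Omega : compact Omega -> cvx Omega -> Omega !=set0 ->
  exists c rho, [/\ 0 <= rho, forall w, euclid w <= rho -> Omega (c + w) &
    (H 2 Omega <= (96 * rho)%:E * H 1 (boundary Omega))%E].
Proof.
move=> cO vO [x Ox]; have O0 : Omega !=set0 by exists x.
have [y Oy ymax] : exists2 y, Omega y & forall z, Omega z -> euclid (z - x) <= euclid (y - x).
  apply: (compact_max_point (f := fun y => euclid (y - x))) => //.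
  apply: (@lipschitz_continuous _ _ 1) => u v; apply: le_trans (ler_dist_euclid _ _) _.
  by rewrite opprB addrA subrK mul1r.
set L := euclid (y - x) in ymax; have LP := dist_le_perimeter cO vO Oy Ox.
have [z Oz zmax] : exists2 z, Omega z & forall w, Omega w -> `|det (y - x) (w - x)| <= `|det (y - x) (z - x)|.
  apply: (compact_max_point (f := fun w => `|det (y - x) (w - x)|)) => //.
  apply: (@lipschitz_continuous _ _ L) => u v; apply: le_trans (ler_dist_dist _ _) _.
  rewrite (_ : det (y - x) (u - x) - det (y - x) (v - x) = det (y - x) (u - v)); last by rewrite /det/=; ring.
  exact: normr_det_le.
set D := det (y - x) (z - x) in zmax.
have [L0|L0] := eqVneq L 0.
  exists x, 0; split => // [w w0|].
    have -> : w = 0 by apply: euclid_eq0; apply/le_anti; rewrite w0 euclid_ge0.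
    by rewrite addr0.
  rewrite mulr0 mul0e.
  apply: (@le_trans _ _ (4 * euclid (0 : R * R) * euclid (0 : R * R))%:E); last by rewrite euclid0 !mulr0.
  apply: (@unnormalized2_parallelogram_le _ x) => w Ow; exists 0, 0.
  rewrite !lexx ler01; split => //; rewrite !scaler0 !addr0; apply/subr0_eq/euclid_eq0/le_anti.
  by rewrite euclid_ge0 andbT -L0 ymax.
have Lp : 0 < L by rewrite lt_neqAle eq_sym L0 euclid_ge0.
pose rho := `|D| / (6 * L).
have rho0 : 0 <= rho by rewrite divr_ge0// mulr_ge0// ltW.
have area : (H 2 Omega <= (96 * rho)%:E * H 1 (boundary Omega))%E.
  apply: (@le_trans _ _ ((96 * rho)%:E * L%:E)%E); last by apply: lee_wpmul2l; rewrite // lee_fin mulr_ge0.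
  pose u := (y - x); pose h := `|D| / L.
  pose n : R * R := (- u.2, u.1).
  have en : euclid n = L by rewrite /L -/u /euclid /= sqrrN addrC.
  have LL : L * L = u.1 ^+ 2 + u.2 ^+ 2 by rewrite -expr2 sqr_euclid.
  have LL0 : 0 < L * L by rewrite mulr_gt0.
  have -> : ((96 * rho)%:E * L%:E)%E = (4 * euclid (2 *: u) * euclid ((2 * `|D| / (L * L)) *: n))%:E.
    have e1 : `|2 * `|D| / (L * L)| = 2 * `|D| / (L * L).
      by rewrite ger0_norm// divr_ge0 ?mulr_ge0// ltW.
    rewrite -EFinM !euclidZ en -/L e1 (ger0_norm (ler0n _ 2)).
    by rewrite /rho; congr EFin; field.
  apply: (@unnormalized2_parallelogram_le _ (x - u - (`|D| / (L * L)) *: n)) => w Ow.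
  have wD := zmax _ Ow; have wL := ymax _ Ow.
  pose a := dot (w - x) u / (L * L); pose b := det u (w - x) / (L * L).
  have ha : -1 <= a <= 1.
    rewrite ler_pdivrMr// ler_pdivlMr// mul1r mulN1r.
    have := dot_le (w - x) u; have := dot_le (w - x) (- u); rewrite euclidN -/L.
    have : euclid (w - x) * L <= L * L by rewrite ler_wpM2r// ltW.
    by rewrite /dot /=; move=> *; apply/andP; split; lra.
  have hb : - (`|D| / (L * L)) <= b <= `|D| / (L * L).
    by rewrite -ler_norml normrM normfV (gtr0_norm LL0) ler_pM2r ?invr_gt0.
  have wE : w = x + a *: u + b *: n.
    rewrite [LHS]surjective_pairing /a /b /dot /det /n /=; congr pair;
      rewrite /= /GRing.scale /= LL /u /=; field; by rewrite -LL gt_eqF.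
  (* Here the rectangle degenerates to a segment, and the coordinate used below would divide by
     0. *)
  have [D0|D0] := eqVneq D 0.
    exists ((a + 1) / 2), 0; rewrite lexx ler01; split => //; first by lra.
    have b0 : b = 0 by move: hb; rewrite D0 normr0 mul0r oppr0 => /andP[? ?]; apply/le_anti/andP.
    rewrite {1}wE b0 D0 normr0 !mul0r !mulr0 !mul0r !scale0r subr0 !addr0.
    by congr pair; rewrite /= /GRing.scale /=; field.
  have D0' : 0 < `|D| / (L * L) by rewrite divr_gt0// normr_gt0.
  exists ((a + 1) / 2), ((b / (`|D| / (L * L)) + 1) / 2); split; first lra.
    have : b / (`|D| / (L * L)) <= 1 by rewrite ler_pdivrMr// mul1r; lra.
    have : -1 <= b / (`|D| / (L * L)) by rewrite ler_pdivlMr// mulN1r; lra.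
    by move=> *; lra.
  have Dn0 : `|D| != 0 by rewrite normr_eq0.
  rewrite {1}wE; move: L0 Dn0; clearbody a b; move: `|D| => E L0 E0.
  by congr pair; rewrite /= /GRing.scale /=; field; rewrite L0 E0.
have [D0|D0] := eqVneq D 0.
  exists x, rho; split => // w; rewrite /rho D0 normr0 mul0r => w0.
  have -> : w = 0 by apply: euclid_eq0; apply/le_anti; rewrite w0 euclid_ge0.
  by rewrite addr0.
exists (3^-1 *: (x + y + z)), rho; split => // w hw.
by apply: (triangle_ball vO Ox Oy Oz Lp (lexx _) (ymax _ Oz) D0).
Qed.

Lemma body_area_gt0 Omega : body Omega -> (0 < H 2 Omega)%E.
Proof.
move=> /body_ball[c Oc [r r0 h]].
pose B := `[c.1 - r / 4, c.1 + r / 4]%classic `*` `[c.2 - r / 4, c.2 + r / 4]%classic.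
have := @unnormalized2_ge R Omega B (measurableX (measurable_itv _) (measurable_itv _)).
rewrite /B lebesgue2_box; [|lra..] => hB.
have {}hB : (((r / 2) ^+ 2)%:E <= 4%:E * H 2 Omega)%E.
  rewrite (_ : (r / 2) ^+ 2 = (c.1 + r / 4 - (c.1 - r / 4)) * (c.2 + r / 4 - (c.2 - r / 4))); last by field.
  apply: hB => y /=; rewrite !in_itv/= => -[/andP[? ?] /andP[? ?]].
  apply: h; apply: le_lt_trans (euclid_le_norm12 _) _ => /=.
  have : `|y.1 - c.1| <= r / 4 by rewrite ler_norml; apply/andP; split; lra.
  have : `|y.2 - c.2| <= r / 4 by rewrite ler_norml; apply/andP; split; lra.
  lra.
rewrite lt_neqAle unnormalized_ge0 andbT; apply/eqP => H0; move: hB; rewrite -H0 mule0 lee_fin.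
by rewrite leNgt exprn_gt0// divr_gt0.
Qed.

Lemma body_bounded Omega : body Omega -> exists2 M, 0 < M & forall x, Omega x -> euclid x <= M.
Proof. by move=> [cO _ _]; exact: compact_bounded2. Qed.

Lemma body_nonempty Omega : body Omega -> Omega !=set0.
Proof. by move=> /body_ball[c Oc _]; exists c. Qed.

Lemma body_dim Omega : body Omega -> hausdorff_dim Omega = 2%:E.
Proof.
move=> bO; have [M M0 hM] := body_bounded bO.
have Hoo : (H 2 Omega < +oo)%E by apply: le_lt_trans (area_finite M0 hM) _; rewrite ltry.
apply/le_anti/andP; split.
  apply/lee_addgt0Pr => e e0; rewrite -EFinD; apply: ereal_inf_lbound; exists (2 + e) => //.
  by split; [lra|apply: (@unnormalized_exponent0 _ 2) => //; lra].
apply: le_ereal_inf_tmp => _ [s [s0 Hs0] <-]; rewrite lee_fin leNgt; apply/negP => s2.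
have := body_area_gt0 bO; rewrite (@unnormalized_exponent0 _ s 2) ?ltxx//.
by rewrite Hs0 ltry.
Qed.

(** If the interior is empty, no three points of [Omega] span a triangle. Then [Omega] lies on a
    segment, has finite length, and its dimension is at most 3/2, an arbitrary exponent between 1
    and 2. *)
Lemma dim2_body Omega : compact Omega -> cvx Omega -> hausdorff_dim Omega = 2%:E -> body Omega.
Proof.
move=> cO vO dO; split => //; apply: contrapT => i0.
suff Hoo : (H 1 Omega < +oo)%E.
  have : (hausdorff_dim Omega <= (3 / 2)%:E)%E.
    apply: ereal_inf_lbound; exists (3 / 2) => //; split; first lra.
    by apply: (@unnormalized_exponent0 _ 1) => //; lra.
  rewrite dO lee_fin; lra.
have [->|/set0P[x Ox]] := eqVneq Omega set0.
  apply: (@le_lt_trans _ _ (euclid ((0 : R * R) - 0))%:E); last by rewrite ltry.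
  exact: unnormalized1_seg_le.
have [M M0 hM] := compact_bounded2 cO.
have [h|] := pselect (forall y, Omega y -> y = x).
  apply: (@le_lt_trans _ _ (euclid (x - x))%:E); last by rewrite ltry.
  apply: unnormalized1_seg_le => y /h ->; exists 0; first by rewrite lexx ler01.
  by rewrite scale0r subr0 scale1r add0r.
move=> /existsNP[y /not_implyP[Oy yx]].
have d0 : 0 < euclid (y - x) by rewrite euclid_gt0// subr_eq0; exact/eqP.
have [h|] := pselect (forall z, Omega z -> det (y - x) (z - x) = 0); last first.
  move=> /existsNP[z /not_implyP[Oz /eqP D0]]; exfalso; apply: i0.
  exists (3^-1 *: (x + y + z)); apply/interiorE.
  have L0 : 0 < 2 * M by rewrite mulr_gt0.
  have hL u v : Omega u -> Omega v -> euclid (u - v) <= 2 * M.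
    by move=> Ou Ov; apply: le_trans (euclidD _ _) _; rewrite euclidN mulr_natl mulr2n lerD ?hM.
  have tb := triangle_ball vO Ox Oy Oz L0 (hL _ _ Oy Ox) (hL _ _ Oz Ox) D0.
  exists (`|det (y - x) (z - x)| / (6 * (2 * M))).
    by rewrite divr_gt0 ?normr_gt0// mulr_gt0.
  by move=> w hw; rewrite -(subrK (3^-1 *: (x + y + z)) w) addrC; apply: tb; exact: ltW.
(* Large enough that [x - K (y - x)] and [x + K (y - x)] enclose all of [Omega] on the line. *)
pose K := 2 * M / euclid (y - x).
have K0 : 0 < K by rewrite divr_gt0// mulr_gt0.
apply: (@le_lt_trans _ _ (euclid (x + K *: (y - x) - (x - K *: (y - x))))%:E); last by rewrite ltry.
apply: unnormalized1_seg_le => z Oz.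
pose a := dot (z - x) (y - x) / euclid (y - x) ^+ 2.
have sq := sqr_euclid (y - x).
have zE : z = x + a *: (y - x).
  have := h _ Oz; rewrite /det /= => D0.
  have q0 : (y - x).1 ^+ 2 + (y - x).2 ^+ 2 != 0 by rewrite -sq gt_eqF// exprn_gt0.
  rewrite [LHS]surjective_pairing /a sq /dot; congr pair; rewrite /= /GRing.scale /=;
    apply/eqP; rewrite -subr_eq0; apply/eqP; move: q0 => /= q0;
    set q := (_ + _) in q0 *.
    rewrite (_ : _ - _ = (- (y.2 - x.2) * ((y.1 - x.1) * (z.2 - x.2) - (y.2 - x.2) * (z.1 - x.1))) / q).
      by rewrite D0 mulr0 mul0r.
    by rewrite /q; field.
  rewrite (_ : _ - _ = ((y.1 - x.1) * ((y.1 - x.1) * (z.2 - x.2) - (y.2 - x.2) * (z.1 - x.1))) / q).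
    by rewrite D0 mulr0 mul0r.
  by rewrite /q; field.
have aK : `|a| <= K.
  rewrite /K ler_pdivlMr// -euclidZ (_ : a *: (y - x) = z - x); last by rewrite {1}zE addrAC subrr add0r.
  by apply: le_trans (euclidD _ _) _; rewrite euclidN mulr_natl mulr2n lerD ?hM.
move: aK; rewrite ler_norml => /andP[a1 a2].
exists ((a / K + 1) / 2).
  have : a / K <= 1 by rewrite ler_pdivrMr// mul1r.
  have : -1 <= a / K by rewrite ler_pdivlMr// mulN1r.
  by move=> *; lra.
rewrite {1}zE; move: K0 => /lt0r_neq0; clearbody a K => K0.
by congr pair; rewrite /= /GRing.scale /=; field.
Qed.

Lemma admissibleP Omega : admissible Omega <-> body Omega.
Proof.
split=> [[cO vO dO]|bO]; first by apply: dim2_body => //; exact/convex_setP.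
by case: (bO) => cO vO _; split => //; [exact/convex_setP|exact: body_dim].
Qed.

Definition perim Omega : R := fine (H 1 (boundary Omega)).
Definition area Omega : R := fine (H 2 Omega).
Definition dint p Omega : R := fine (dist_integral p Omega).

Lemma perimE Omega : body Omega -> H 1 (boundary Omega) = (perim Omega)%:E.
Proof.
move=> bO; have [M M0 hM] := body_bounded bO; case: (bO) => cO vO _.
rewrite /perim fineK// fin_numElt (lt_le_trans _ (unnormalized_ge0 _ _))//=.
by apply: le_lt_trans (perimeter_finite cO vO (body_nonempty bO) M0 hM) _; rewrite ltry.
Qed.

Lemma areaE Omega : body Omega -> H 2 Omega = (area Omega)%:E.
Proof.
move=> bO; have [M M0 hM] := body_bounded bO.
rewrite /area fineK// fin_numElt (lt_le_trans _ (unnormalized_ge0 _ _))//=.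
by apply: le_lt_trans (area_finite M0 hM) _; rewrite ltry.
Qed.

Lemma dintE p Omega : 0 <= p -> body Omega -> dist_integral p Omega = (dint p Omega)%:E.
Proof.
move=> p0 bO; have [M M0 hM] := body_bounded bO; case: (bO) => cO vO _.
rewrite /dint fineK// fin_numElt (lt_le_trans _ (dist_integral_ge0 _ _))//=.
exact: dist_integral_finite (body_nonempty bO) M0 hM.
Qed.

Lemma perim_gt0 Omega : body Omega -> 0 < perim Omega.
Proof.
move=> bO; have [x [y [Ox Oy xy]]] := body_two bO; case: (bO) => cO vO _.
have := dist_le_perimeter cO vO Ox Oy; rewrite perimE// lee_fin; apply: lt_le_trans.
by rewrite euclid_gt0// subr_eq0.
Qed.

Lemma area_gt0 Omega : body Omega -> 0 < area Omega.
Proof. by move=> bO; rewrite -lte_fin -areaE//; exact: body_area_gt0. Qed.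

Lemma dint_ge0 p Omega : 0 <= dint p Omega.
Proof. by rewrite fine_ge0// dist_integral_ge0. Qed.

(** Equal to [pi / 4], the factor from the unnormalized to the normalized area; the one for length
    is 1. *)
Definition kappa : R := unit_ball_volume 2 / 2 ^+ 2.

Lemma kappa_gt0 : 0 < kappa.
Proof. by rewrite /kappa /= divr_gt0// ?mulr_gt0 ?divr_gt0 ?mulr_gt0 ?pi_gt0. Qed.

Definition renergy p lambda Omega : R :=
  dint p Omega + lambda * (perim Omega / (kappa * area Omega)).

Lemma ratioE Omega : body Omega ->
  perimeter_area_ratio Omega = (perim Omega / (kappa * area Omega))%:E.
Proof.
move=> bO; rewrite /perimeter_area_ratio /hausdorff_measure -/kappa.
rewrite expr1 divff ?mul1e ?pnatr_eq0// perimE// areaE// -EFinM inver ifF ?EFinM//.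
by rewrite gt_eqF// mulr_gt0 ?kappa_gt0 ?area_gt0.
Qed.

Lemma energyE p lambda Omega : 0 <= p -> body Omega ->
  energy p lambda Omega = (renergy p lambda Omega)%:E.
Proof.
move=> p0 bO; rewrite /energy -/(dist_integral p Omega) dintE// ratioE//.
Qed.

End Bodies.

(* Unification would otherwise unfold Lebesgue and Hausdorff measures. *)
Opaque dist_integral dint kappa perim area.

(** * Scaling identities *)

Section Scaling.
Context {R : realType}.
Implicit Types (A B K Omega : set (R * R)) (x y z c : R * R) (t r s p M lambda : R).

Lemma body_sim t c Omega : 0 < t -> body Omega -> body (sim t c @` Omega).
Proof.
move=> t0 [cO vO [x ix]]; split; [exact: sim_compact|exact: sim_cvx|].
by exists (sim t c x); exact: sim_interior.
Qed.

Lemma perim_sim t c Omega : 0 < t -> body Omega -> perim (sim t c @` Omega) = t * perim Omega.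
Proof.
move=> t0 bO; have [cO _ _] := bO; apply: EFin_inj; rewrite -perimE; last exact: body_sim.
by rewrite sim_boundary// unnormalized_sim// powRr1 ?(ltW t0)// EFinM perimE.
Qed.

Lemma area_sim t c Omega : 0 < t -> body Omega -> area (sim t c @` Omega) = t ^+ 2 * area Omega.
Proof.
move=> t0 bO; have [cO _ _] := bO; apply: EFin_inj; rewrite -areaE; last exact: body_sim.
by rewrite unnormalized_sim// powR_mulrn ?(ltW t0)// EFinM areaE.
Qed.

Lemma dint_sim p t c Omega : 0 <= p -> 0 < t -> body Omega ->
  dint p (sim t c @` Omega) = t `^ (p + 2) * dint p Omega.
Proof.
move=> p0 t0 bO; have [cO _ _] := bO; apply: EFin_inj; rewrite -dintE//; last exact: body_sim.
by rewrite (dist_integral_sim _ _ t0 cO (body_nonempty bO)) dintE.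
Qed.

Lemma perim_mono K Omega : body K -> body Omega -> K `<=` Omega -> perim K <= perim Omega.
Proof.
move=> bK bO KO; rewrite -lee_fin -!perimE//; case: (bK) => cK vK _; case: (bO) => cO _ _.
by apply: perimeter_mono => //; exact: body_nonempty.
Qed.

Lemma area_mono K Omega : body K -> body Omega -> K `<=` Omega -> area K <= area Omega.
Proof. by move=> bK bO KO; rewrite -lee_fin -!areaE//; exact: le_unnormalized. Qed.

Lemma dint_mono p K Omega : 0 <= p -> body K -> body Omega -> K `<=` Omega ->
  dint p K <= dint p Omega.
Proof.
move=> p0 bK bO KO; case: (bK) => cK vK _; case: (bO) => cO _ _.
have := dist_integral_mono p0 cK vK (body_nonempty bK) cO KO.
by rewrite (dintE p0 bK) (dintE p0 bO) lee_fin.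
Qed.

Lemma renergy_sim p lambda t c Omega : 0 <= p -> 0 < t -> body Omega ->
  renergy p lambda (sim t c @` Omega) =
  t `^ (p + 2) * dint p Omega + lambda * (perim Omega / (kappa * area Omega)) * t^-1.
Proof.
move=> p0 t0 bO; rewrite /renergy dint_sim// perim_sim// area_sim//.
have k0 := @kappa_gt0 R; have a0 := area_gt0 bO.
by congr (_ + _); field; rewrite !gt_eqF.
Qed.

Lemma minimizerP p lambda Omega : 0 <= p -> minimizer p lambda Omega <->
  body Omega /\ forall K, body K -> renergy p lambda Omega <= renergy p lambda K.
Proof.
move=> p0; split => [[/admissibleP bO h]|[bO h]].
  by split => // K bK; rewrite -lee_fin -!energyE//; apply: h; exact/admissibleP.
split; first exact/admissibleP.
by move=> K /admissibleP bK; rewrite !energyE// lee_fin h.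
Qed.

(** The right side is minimal over [t > 0] at [t = 1], so its derivative [q a - b] vanishes
    there. *)
Lemma scaling_identity (a b q : R) :
  (forall t, 0 < t -> a + b <= t `^ q * a + b * t^-1) -> q * a = b.
Proof.
move=> h.
have one0 : (1 : R) \in `]0, +oo[ by rewrite in_itv/= ltr01.
have d1 : is_derive (1 : R) 1 (fun t : R => t `^ q) q.
  apply: DeriveDef; first exact: derivable_powR.
  by rewrite -derive1E powR_derive1// powR1 mulr1.
have d2 : is_derive (1 : R) 1 (fun t : R => t^-1) (- 1).
  have := @is_deriveV R id 1 1 1 (oner_neq0 _) (is_derive_id _ _).
  by rewrite expr1n invr1 scaleN1r.
have d3 := is_deriveD (is_deriveZ a d1) (is_deriveZ b d2).
have d4 : is_derive (1 : R) 1 (a \*: (fun t : R => t `^ q) + b \*: (fun t : R => t^-1)) 0.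
  apply: (@derive1_at_min R _ 2^-1 2); first lra.
  - move=> t; rewrite in_itv/= => /andP[t1 _].
    have t0 : 0 < t by apply: lt_trans t1; rewrite invr_gt0.
    apply: derivableD; apply: derivableZ.
      by apply: derivable_powR; rewrite in_itv/= t0.
    by apply: derivableV; rewrite ?gt_eqF//; exact: derivable_id.
  - by rewrite in_itv/=; apply/andP; split; lra.
  - move=> t; rewrite in_itv/= => /andP[t1 _].
    have t0 : 0 < t by apply: lt_trans t1; rewrite invr_gt0.
    rewrite /GRing.add /= /GRing.scale /=; have := h t t0.
    by rewrite powR1 invr1 !mulr1 (mulrC a).
have := @derive_val _ _ _ _ _ _ _ d3; rewrite (@derive_val _ _ _ _ _ _ _ d4) /GRing.scale /=; lra.
Qed.

Lemma minimizer_scaling p lambda Omega : 0 <= p -> minimizer p lambda Omega ->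
  (p + 2) * dint p Omega = lambda * (perim Omega / (kappa * area Omega)).
Proof.
move=> p0 /(minimizerP _ _ p0)[bO h]; apply: scaling_identity => t t0.
by have := h _ (body_sim 0 t0 bO); rewrite renergy_sim.
Qed.

(** With [r] the ratio, the scaling identity turns the energy into [lambda r / (p + 2) + lambda r =
    lambda r (p + 3) / (p + 2)]. *)
Lemma minimizer_ratio p lambda Omega : 1 <= p -> 0 < lambda -> minimizer p lambda Omega ->
  perimeter_area_ratio Omega = (((p + 2) / (lambda * (p + 3)))%:E *
          ereal_inf [set energy p lambda Omega' | Omega' in admissible])%E.
Proof.
move=> p1 l0 mO; have p0 : 0 <= p by lra.
have -> : ereal_inf [set energy p lambda Omega' | Omega' in admissible] = energy p lambda Omega.
  apply/le_anti/andP; split.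
    by apply: ereal_inf_lbound; exists Omega => //; case: mO.
  by apply: le_ereal_inf_tmp => _ [K aK <-]; case: mO => _; exact.
have := minimizer_scaling p0 mO.
have [bO _] := (minimizerP _ _ p0).1 mO.
rewrite energyE// ratioE// /renergy -EFinM; set r := perim _ / _ => e; congr EFin.
have -> : dint p Omega = lambda * r / (p + 2) by rewrite -e mulrAC divff ?mul1r// gt_eqF//; lra.
field; rewrite !gt_eqF//; lra.
Qed.

Lemma minimizer_sim p lambda c Omega : 0 <= p -> minimizer p lambda Omega ->
  minimizer p lambda (sim 1 c @` Omega).
Proof.
move=> p0 /(minimizerP _ _ p0)[bO h]; apply/minimizerP => //; split; first exact: body_sim.
by move=> K bK; rewrite renergy_sim// powR1 mul1r invr1 mulr1; exact: h.
Qed.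

(** A convex subset has a smaller distance integral, so minimality prevents its ratio from being
    smaller; the comparison of ratios is then cleared of denominators. *)
Lemma minimizer_cheeger p lambda Omega K : 1 <= p -> 0 < lambda -> minimizer p lambda Omega ->
  body K -> K `<=` Omega -> perim Omega * area K <= perim K * area Omega.
Proof.
move=> p1 l0 mO bK KO; have p0 : 0 <= p by lra.
have [bO h] := (minimizerP _ _ p0).1 mO.
have {h} : lambda * (perim Omega / (kappa * area Omega)) <= lambda * (perim K / (kappa * area K)).
  have := h _ bK; have := dint_mono p0 bK bO KO; rewrite /renergy.
  by move: (dint p K) (dint p Omega) (_ * (perim K / _)) (_ * (perim Omega / _)) => *; lra.
have k0 := @kappa_gt0 R; have a0 := area_gt0 bO; have a1 := area_gt0 bK.
rewrite ler_pM2l//; move: (perim K) (perim Omega) => P P' h.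
have -> : P' * area K = P' / (kappa * area Omega) * (kappa * area Omega * area K).
  by field; rewrite !gt_eqF.
have -> : P * area Omega = P / (kappa * area K) * (kappa * area Omega * area K).
  by field; rewrite !gt_eqF.
by apply: (ler_wpM2r _ h); apply: ltW; apply: mulr_gt0 => //; apply: mulr_gt0.
Qed.

End Scaling.

(** * Existence of minimizers *)

Section BoundedDiameter.
Context {R : realType}.
Implicit Types (A B K Omega : set (R * R)) (x y z c w : R * R) (t r s p M lambda : R).
Local Notation leb2 := (@lebesgue_measure R \x @lebesgue_measure R)%E.
Local Notation mR := (measurableTypeR R).
Local Notation mR2 := (mR * mR)%type.

Definition square c s : set (R * R) :=
  `[c.1 - s, c.1 + s]%classic `*` `[c.2 - s, c.2 + s]%classic.

Lemma squareP c s x : square c s x <-> `|x - c| <= s.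
Proof.
rewrite /square /= !in_itv/= prod_normE ge_max !ler_norml /=.
split => [[/andP[? ?] /andP[? ?]]|/andP[/andP[? ?] /andP[? ?]]].
  by apply/andP; split; apply/andP; split; lra.
by split; apply/andP; split; lra.
Qed.

Lemma squares_measure (n : nat) (c : 'I_n -> R * R) s : 0 <= s ->
  (forall i j, i != j -> 2 * s < `|c i - c j|) ->
  measurable (\big[setU/set0]_(i < n) square (c i) s : set mR2) /\
  (leb2 (\big[setU/set0]_(i < n) square (c i) s) = (n%:R * (4 * s ^+ 2))%:E)%E.
Proof.
move=> s0 hc; have mS (i : 'I_n) : measurable (square (c i) s : set mR2).
  by apply: measurableX; exact: measurable_itv.
split; first by apply: bigsetU_measurable => i _; exact: mS.
have tr : trivIset setT (fun i => square (c i) s).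
  apply/trivIsetP => i j _ _ ij; apply/seteqP; split => // x [/squareP xi /squareP xj].
  have := hc i j ij; rewrite ltNge => /negP; apply.
  apply: le_trans (ler_distD x _ _) _; rewrite (distrC (c i)).
  by rewrite mulr_natl mulr2n lerD.
have e (i : 'I_n) : leb2 (square (c i) s) = (4 * s ^+ 2)%:E.
  by rewrite /square lebesgue2_box; [congr EFin; ring|lra..].
have h := @measure_bigsetU_ord _ R mR2 leb2 n xpredT (fun i => square (c i) s) mS tr.
apply: etrans h _; transitivity (\sum_(i < n) (4 * s ^+ 2)%:E)%E.
  by apply: eq_bigr => i _; exact: e.
by rewrite sumEFin sumr_const card_ord; congr EFin; rewrite [RHS]mulr_natl. 
Qed.

Lemma euclid_square c s x : square c s x -> euclid (x - c) <= 2 * s.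
Proof.
by move=> /squareP h; apply: le_trans (euclid_le_norm _) _; rewrite ler_pM2l.
Qed.

(** Around [t z], the convex hull of [z] and the disk of radius [r] contains a disk of radius
    [(1 - t) r >= r / 2]. *)
Lemma half_segment_ball Omega r z t w : cvx Omega -> (forall x, euclid x <= r -> Omega x) ->
  Omega z -> 0 <= t -> t <= 2^-1 -> euclid w <= r / 2 -> Omega (t *: z + w).
Proof.
move=> vO hr Oz t0 t1 wr; have t2 : 0 < 1 - t by lra.
have -> : w = (1 - t) *: ((1 - t)^-1 *: w) by rewrite scalerA mulfV ?scale1r// gt_eqF.
apply: vO => //; last lra; apply: hr; rewrite euclidZ gtr0_norm ?invr_gt0// ler_pdivrMl//.
have r0 : 0 <= r by have := euclid_ge0 w; lra.
apply: le_trans wr _; have : 0 <= (2^-1 - t) * r by rewrite mulr_ge0//; lra.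
lra.
Qed.

Lemma natr_dist_ge1 (i j : nat) : i != j -> 1 <= `|i%:R - j%:R : R|.
Proof.
wlog ij : i j / (i < j)%N => [hw ij|_].
  have [h|h|h] := ltngtP i j; [exact: hw|rewrite distrC; apply: hw => //|by rewrite h eqxx in ij].
  by rewrite eq_sym.
by rewrite distrC -natrB ?(ltnW ij)// normr_nat ler1n subn_gt0.
Qed.

(** The first half of the segment from 0 to [z] has room for [N] disjoint squares of half-side
    [r / 8], with centers more than [r / 4] apart. A point of a square is within [r / 4] of its
    center, around which [Omega] contains a disk of radius [r / 2]; so the distance to the boundary
    is at least [r / 4] on the squares. *)
Lemma dist_integral_squares p Omega r z (N : nat) : 0 <= p -> body Omega -> 0 < r ->
  (forall x, euclid x <= r -> Omega x) -> Omega z -> N%:R * (r / 2) < `|z| ->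
  (((r / 4) `^ p * (N%:R * (4 * (r / 8) ^+ 2)))%:E <= dist_integral p Omega)%E.
Proof.
move=> p0 bO r0 hr Oz Nz; have [cO vO _] := bO; have O0 := body_nonempty bO.
have bdO := boundary_nonempty cO O0.
have s0 : 0 <= r / 8 by rewrite divr_ge0// ltW.
pose tt (i : 'I_N) : R := i%:R / N%:R / 2.
have tt0 i : 0 <= tt i by rewrite !divr_ge0.
have N0 (i : 'I_N) : 0 < N%:R :> R by rewrite ltr0n (leq_ltn_trans _ (ltn_ord i)).
have tt1 i : tt i <= 2^-1.
  by rewrite /tt ler_pdivrMr// mulVf// ler_pdivrMr ?(N0 i)// mul1r ler_nat ltnW.
pose c (i : 'I_N) := tt i *: z.
have hc i j : i != j -> 2 * (r / 8) < `|c i - c j|.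
  move=> ij; rewrite /c -scalerBl normrZ.
  have hN : 1 / N%:R / 2 <= `|tt i - tt j|.
    rewrite /tt -!mulrBl !normrM !normfV !(@ger0_norm _ _%:R)// !ler_wpM2r ?invr_ge0//.
    exact: natr_dist_ge1.
  apply: (@lt_le_trans _ _ (1 / N%:R / 2 * `|z|)); last by rewrite ler_wpM2r.
  have := N0 i => N0'; rewrite -(ltr_pM2l N0').
  rewrite (_ : N%:R * (1 / N%:R / 2 * `|z|) = `|z| / 2); last by field; rewrite gt_eqF.
  by move: Nz; clear; lra.
have [mU eU] := squares_measure s0 hc.
set U := \big[setU/set0]_(i < N) square (c i) (r / 8) in mU eU.
have Uball x : U x -> forall y, euclid (y - x) < r / 4 -> Omega y.
  rewrite /U -bigcup_seq => -[i _ /euclid_square xi] y yx.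
  rewrite -(subrK (c i) y) addrC; apply: (half_segment_ball vO hr Oz (tt0 i) (tt1 i)).
  by apply: le_trans (euclidB_trans x _ _) _; move: xi yx; clear; lra.
have Usub : U `<=` Omega.
  by move=> x Ux; apply: (Uball x Ux); rewrite subrr euclid0 divr_gt0.
apply: (@le_trans _ _ (\int[leb2]_(x in U) (dist x (boundary Omega) `^ p)%:E)%E).
  apply: (@le_trans _ _ (\int[leb2]_(x in U) cst ((r / 4) `^ p)%:E x)%E).
    have h := @integral_cst _ mR2 R leb2 U mU ((r / 4) `^ p)%:E.
    by rewrite EFinM -eU; rewrite le_eqVlt; apply/orP; left; apply/eqP; apply: esym; exact: h.
  apply: ge0_le_integral.
  - exact: mU.
  - by move=> x _; rewrite lee_fin powR_ge0.
  - exact: measurable_cst.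
  - exact: measurable_dist_powR.
  - move=> x Ux; rewrite lee_fin ge0_ler_powR ?nnegrE ?dist_ge0//; first by rewrite divr_ge0// ltW.
    by apply: dist_boundary_ge => //; exact: Uball.
apply: ge0_subset_integral.
- exact: mU.
- exact: measurable_compact2.
- exact: measurable_dist_powR.
- by move=> x _; rewrite lee_fin powR_ge0.
- exact: Usub.
Qed.

(** [k] is the contribution of one square to the integral, and a body that reaches too far has room
    for more than [|C| / k] squares. [M] depends on [p], [r] and [C] alone. *)
Lemma dint_bounded p r C : 0 <= p -> 0 < r -> exists2 M, 0 < M & forall Omega,
  body Omega -> (forall x, euclid x <= r -> Omega x) -> dint p Omega <= C ->
  forall z, Omega z -> euclid z <= M.
Proof.
move=> p0 r0; pose k := (r / 4) `^ p * (4 * (r / 8) ^+ 2).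
have k0 : 0 < k by rewrite mulr_gt0 ?powR_gt0 ?mulr_gt0 ?exprn_gt0 ?divr_gt0.
have Ck : 0 <= `|C| / k by rewrite divr_ge0// ltW.
pose N := (Num.truncn (`|C| / k)).+1.
have hN : `|C| < N%:R * k.
  by rewrite -ltr_pdivrMr//; have /andP[] := truncn_itv Ck.
exists (2 * (N%:R * (r / 2))); first by rewrite !mulr_gt0// divr_gt0.
move=> Omega bO hr dC z Oz; apply: le_trans (euclid_le_norm _) _; rewrite ler_pM2l// leNgt.
apply/negP => zN; have := dist_integral_squares p0 bO r0 hr Oz zN.
rewrite (dintE p0 bO) lee_fin => h.
have : N%:R * k <= C by apply: le_trans dC; apply: le_trans h; rewrite /k mulrCA.
by rewrite leNgt => /negP; apply; apply: le_lt_trans hN; exact: ler_norm.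
Qed.

End BoundedDiameter.

(** * Limits of sets along an ultrafilter and lower semicontinuity *)

Section Existence.
Context {R : realType}.
Implicit Types (A B K Omega : set (R * R)) (x y z c w : R * R) (t r s p M e lambda : R).

Lemma ultra_limit (F : set_system nat) K (u : nat -> R * R) : UltraFilter F -> compact K ->
  F [set n | K (u n)] -> exists2 q, K q & forall e, 0 < e -> F [set n | euclid (u n - q) < e].
Proof.
move=> FU cK FK; have [q [Kq cq]] := cK (u @ F) _ FK.
exists q => // e e0.
have [//|Fe] := in_ultra_setVsetC [set n | euclid (u n - q) < e] FU.
have nq : nbhs q [set z | euclid (z - q) < e] by apply/nbhs_euclid; exists e.
have Fc : (u @ F) [set z | ~ euclid (z - q) < e] by exact: Fe.
by have [z [zc zq]] := cq _ _ Fc nq.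
Qed.

(** For uniformly bounded sets, the Hausdorff limit along [F]; an ultrafilter provides it at once,
    where the Blaschke selection theorem extracts a subsequence. *)
Definition ultra_set (F : set_system nat) (O : nat -> set (R * R)) : set (R * R) :=
  [set x | forall e, 0 < e -> F [set n | exists2 y, O n y & euclid (x - y) < e]].

Section UltraSet.
Variables (F : set_system nat) (O : nat -> set (R * R)) (r M : R).
Hypotheses (FU : UltraFilter F) (r0 : 0 < r) (M0 : 0 < M) (Ov : forall n, cvx (O n)).
Hypotheses (Or : forall n x, euclid x <= r -> O n x) (OM : forall n x, O n x -> euclid x <= M).
Local Notation L := (ultra_set F O).

Lemma ultra_set_ball x : euclid x <= r -> L x.
Proof.
move=> xr e e0; apply: filterS filterT => n _; exists x; first exact: Or.
by rewrite subrr euclid0.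
Qed.

Lemma ultra_set_bounded x : L x -> euclid x <= M + 1.
Proof.
move=> /(_ 1 ltr01) /filter_ex[n [y /OM yM xy]].
by have := euclidD (x - y) y; rewrite subrK; lra.
Qed.

Lemma ultra_set_closed : closed L.
Proof.
apply: closedE => x hx e e0; have [x' Lx' xx'] := hx _ (divr_gt0 e0 (ltr0n _ 2)).
apply: filterS (Lx' _ (divr_gt0 e0 (ltr0n _ 2))) => n [y Oy x'y]; exists y => //.
apply: le_lt_trans (euclidB_trans x' _ _) _; rewrite (euclidBC x x'); lra.
Qed.

Lemma ultra_set_compact : compact L.
Proof. exact: bounded_closed_compact2 ultra_set_bounded ultra_set_closed. Qed.

Lemma ultra_set_cvx : cvx L.
Proof.
move=> x y t Lx Ly t0 t1 e e0.
apply: filterS (filterI (Lx e e0) (Ly e e0)) => n [[x' Ox xx'] [y' Oy yy']].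
exists (t *: x' + (1 - t) *: y'); first exact: Ov.
rewrite (_ : _ - _ = t *: (x - x') + (1 - t) *: (y - y')); last first.
  by congr pair; rewrite /= /GRing.scale /=; ring.
apply: le_lt_trans (euclidD _ _) _; rewrite !euclidZ !ger0_norm ?subr_ge0//.
move: xx' yy'; move: (euclid (x - x')) (euclid (y - y')) => a b ae be.
have [ab|ba] := leP a b; [apply: le_lt_trans be|apply: le_lt_trans ae]; nra.
Qed.

Lemma ultra_set_body : body L.
Proof.
split; [exact: ultra_set_compact|exact: ultra_set_cvx|].
exists 0; apply/interiorE; exists r => // y; rewrite subr0 => /ltW; exact: ultra_set_ball.
Qed.

(** The definition approximates each point separately; uniformity comes from compactness, since
    badly approximated points [u n] converge along [F] to some [q] in the limit set, and [q] itself
    is well approximated. *)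
Lemma ultra_set_sub_near e : 0 < e -> F [set n | forall x, L x -> exists2 y, O n y & euclid (x - y) < e].
Proof.
move=> e0; have [//|Fe] := in_ultra_setVsetC [set n | forall x, L x -> exists2 y, O n y & euclid (x - y) < e] FU.
(* The implication makes the choice total: [u n] is arbitrary at the indices where the property
   holds. *)
have ex n : exists x, (~ forall x, L x -> exists2 y, O n y & euclid (x - y) < e) ->
    L x /\ forall y, O n y -> e <= euclid (x - y).
  have [h|h] := pselect (forall x, L x -> exists2 y, O n y & euclid (x - y) < e).
    by exists 0 => /(_ h).
  have /existsNP[x /not_implyP[Lx hx]] := h; exists x => _; split => // y Oy.
  by rewrite leNgt; apply/negP => xy; apply: hx; exists y.
have [u hu] := choice ex.
have FL : F [set n | L (u n)] by apply: filterS Fe => n /hu[].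
have [q Lq hq] := ultra_limit FU ultra_set_compact FL.
have e20 := divr_gt0 e0 (ltr0n _ 2).
have [n [[/hu[_ h] uq] [y Oy qy]]] := filter_ex (filterI (filterI Fe (hq _ e20)) (Lq _ e20)).
have := h _ Oy; have := euclidB_trans q (u n) y; rewrite /= in uq; lra.
Qed.

(** Points of [O n] far from the limit set would converge along [F], and their limit is in that set
    by definition. *)
Lemma sub_ultra_set_near e : 0 < e -> F [set n | forall y, O n y -> exists2 x, L x & euclid (y - x) < e].
Proof.
move=> e0; have [//|Fe] := in_ultra_setVsetC [set n | forall y, O n y -> exists2 x, L x & euclid (y - x) < e] FU.
have ex n : exists y, (~ forall y, O n y -> exists2 x, L x & euclid (y - x) < e) ->
    O n y /\ forall x, L x -> e <= euclid (y - x).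
  have [h|h] := pselect (forall y, O n y -> exists2 x, L x & euclid (y - x) < e).
    by exists 0 => /(_ h).
  have /existsNP[x /not_implyP[Lx hx]] := h; exists x => _; split => // y Oy.
  by rewrite leNgt; apply/negP => xy; apply: hx; exists y.
have [u hu] := choice ex.
have FB : F [set n | box M (u n)].
  apply: filterS Fe => n /hu[/OM h _]; split; apply: le_trans h.
    exact: norm1_le_euclid.
  exact: norm2_le_euclid.
have [q _ hq] := ultra_limit FU (@box_compact R M) FB.
have Lq : L q.
  move=> d d0; apply: filterS (filterI Fe (hq _ d0)) => n [/hu[Ou _] uq].
  by exists (u n) => //; rewrite euclidBC.
have [n [/hu[_ h] uq]] := filter_ex (filterI Fe (hq _ e0)).
have := h _ Lq; rewrite /= in uq; lra.
Qed.

End UltraSet.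

(** [A] lies in [B] plus a disk of radius [e r], hence in [B + e B], which is [(1 + e) B] by
    convexity. *)
Lemma sub_dilation A B r e : 0 < r -> 0 < e -> cvx B -> (forall x, euclid x <= r -> B x) ->
  (forall x, A x -> exists2 y, B y & euclid (x - y) < e * r) -> A `<=` sim (1 + e) 0 @` B.
Proof.
move=> r0 e0 vB hr h x Ax; have [y By xy] := h x Ax.
have e1 : 1 + e != 0 by rewrite gt_eqF// addr_gt0.
have e1' : 0 < 1 + e by rewrite addr_gt0.
exists ((1 + e)^-1 *: y + (1 - (1 + e)^-1) *: (e^-1 *: (x - y))); last first.
  have en0 : e != 0 by rewrite gt_eqF.
  by rewrite [RHS]surjective_pairing /sim; congr pair; rewrite /= /GRing.scale /=; field; rewrite ?e1 ?en0.
apply: vB => //.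
- apply: hr; rewrite euclidZ gtr0_norm ?invr_gt0// ler_pdivrMl// ltW//.
- by rewrite invr_ge0 ltW.
- by rewrite invf_le1// lerDl ltW.
Qed.

Lemma renergy_ge0 p lambda Omega : 0 < lambda -> body Omega -> 0 <= renergy p lambda Omega.
Proof.
move=> l0 bO; apply: addr_ge0; first exact: dint_ge0.
apply: mulr_ge0; first exact: ltW.
apply: divr_ge0; first exact/ltW/perim_gt0.
by apply/ltW/mulr_gt0; [exact: kappa_gt0|exact: area_gt0].
Qed.

(** The integral costs a factor [t^(p + 2)], the ratio [t] for the perimeter and [t^2] for the area;
    as [t > 1], both are at most [t^(p + 3)]. *)
Lemma renergy_dilation p lambda t K Omega : 1 <= p -> 0 < lambda -> 1 < t -> body K -> body Omega ->
  Omega `<=` sim t 0 @` K -> K `<=` sim t 0 @` Omega ->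
  renergy p lambda Omega <= t `^ (p + 3) * renergy p lambda K.
Proof.
move=> p1 l0 t1 bK bO OK KO; have p0 : 0 <= p by lra.
have t0 : 0 < t by lra.
have := dint_mono p0 bO (body_sim 0 t0 bK) OK; rewrite dint_sim// => hI.
have := perim_mono bO (body_sim 0 t0 bK) OK; rewrite perim_sim// => hP.
have := area_mono bK (body_sim 0 t0 bO) KO; rewrite area_sim// => hA.
have k0 := @kappa_gt0 R; have a0 := area_gt0 bO; have a1 := area_gt0 bK.
have P0 := perim_gt0 bO; have P1 := perim_gt0 bK.
have D0 := dint_ge0 p K.
rewrite /renergy; move: hI hP hA P0 P1 a0 a1 D0.
move: (dint p Omega) (dint p K) (perim Omega) (perim K) (area Omega) (area K).
move=> D D' P P' a a' hI hP hA P0 P1 a0 a1 D0.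
have t1' : 1 <= t by exact: ltW.
rewrite mulrDr; apply: lerD.
  by apply: le_trans hI _; rewrite ler_wpM2r// ler_powR//; lra.
rewrite [leRHS]mulrCA ler_pM2l//.
have r0 : 0 <= P' / (kappa * a') by apply: divr_ge0; [exact: ltW|apply/ltW/mulr_gt0].
apply: (@le_trans _ _ (t ^+ 3 * (P' / (kappa * a')))); last first.
  by apply: ler_wpM2r => //; rewrite -powR_mulrn ?(ltW t0)// ler_powR//; lra.
apply: (@le_trans _ _ ((t * P') / (kappa * (t ^- 2 * a')))).
  have h : 0 < t ^- 2 * a' by rewrite mulr_gt0// invr_gt0 exprn_gt0.
  apply: ler_pM; [exact: ltW|by rewrite invr_ge0; apply/ltW/mulr_gt0|exact: hP|].
  rewrite lef_pV2 ?posrE; [|exact: mulr_gt0..].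
  by rewrite ler_pM2l// mulrC ler_pdivrMr ?exprn_gt0// mulrC.
by rewrite le_eqVlt; apply/orP; left; apply/eqP; field; rewrite !gt_eqF.
Qed.

(** The energy bounds the ratio, [lambda P <= C kappa A], and [inradius] gives [A <= 96 rho P]; so
    [rho >= lambda / (96 kappa C)]. The center of this disk is moved to the origin. *)
Lemma recentered p lambda C Omega : 1 <= p -> 0 < lambda -> 0 < C -> body Omega ->
  renergy p lambda Omega <= C -> exists K, [/\ body K,
    forall x, euclid x <= lambda / (96 * kappa * C) -> K x &
    renergy p lambda K = renergy p lambda Omega].
Proof.
move=> p1 l0 C0 bO hC; have p0 : 0 <= p by lra.
have k0 := @kappa_gt0 R; have a0 := area_gt0 bO; have P0 := perim_gt0 bO.
case: (bO) => cO vO _; have [c [rho [rho0 hc hA]]] := inradius cO vO (body_nonempty bO).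
rewrite (areaE bO) (perimE bO) -EFinM lee_fin in hA.
have ka0 : 0 < kappa * area Omega by exact: mulr_gt0.
have kC0 : 0 < 96 * kappa * C by apply: mulr_gt0 => //; exact: mulr_gt0.
exists (sim 1 (- c) @` Omega); split; first exact: body_sim.
  move=> x hx; exists (c + x); last by rewrite /sim scale1r addrAC subrr add0r.
  apply: hc; apply: le_trans hx _; rewrite ler_pdivrMr//.
  have : lambda * (perim Omega / (kappa * area Omega)) <= C.
    by apply: le_trans hC; rewrite lerDr dint_ge0.
  rewrite mulrA ler_pdivrMr// => h.
  rewrite -(ler_pM2r P0); apply: le_trans h _.
  rewrite [leRHS](_ : _ = C * (kappa * (96 * rho * perim Omega))); last by ring.
  by rewrite !ler_pM2l.
by rewrite renergy_sim// powR1 mul1r invr1 mulr1.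
Qed.

Lemma minimizer_exists p lambda : 1 <= p -> 0 < lambda -> exists Omega, minimizer p lambda Omega.
Proof.
move=> p1 l0; have p0 : 0 <= p by lra.
have k0 := @kappa_gt0 R.
pose S := [set renergy p lambda Om | Om in @body R].
have S0 : S !=set0.
  exists (renergy p lambda (box 1)), (box 1) => //; split; [exact: box_compact|exact: box_cvx|].
  by exists 0; apply: box_interior; rewrite normr0.
have Slb : lbound S 0 by move=> _ [Om bOm <-]; exact: renergy_ge0.
have hS : has_inf S by split => //; exists 0.
pose m := inf S; have m0 : 0 <= m by exact: lb_le_inf.
(* One radius for the whole sequence, whose energies are all at most [m + 1]. *)
pose r := lambda / (96 * kappa * (m + 1)).
have r0 : 0 < r.
  by apply: divr_gt0 => //; apply: mulr_gt0; [exact: mulr_gt0|exact: ltr_wpDl].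
have ex n : exists Om, [/\ body Om, forall x, euclid x <= r -> Om x &
    renergy p lambda Om <= m + n.+1%:R^-1].
  have n0 : 0 < n.+1%:R^-1 :> R by rewrite invr_gt0.
  have [_ [Om bOm <-] hOm] := inf_adherent n0 hS.
  have m1 : 0 < m + 1 by rewrite ltr_wpDl.
  have hm : renergy p lambda Om <= m + 1.
    by apply: le_trans (ltW hOm) _; rewrite lerD2l invf_le1// ler1n.
  have [K [bK hK eK]] := recentered p1 l0 m1 bOm hm.
  by exists K; split => //; rewrite eK ltW.
have [W hW] := choice ex.
have bO n : body (W n) by case: (hW n).
have vO n : cvx (W n) by case: (bO n).
have rO n x : euclid x <= r -> W n x by case: (hW n) => _ + _; exact.
have eO n : renergy p lambda (W n) <= m + n.+1%:R^-1 by case: (hW n).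
have [M M0 hM] := @dint_bounded R p r (m + 1) p0 r0.
have OM n x : W n x -> euclid x <= M.
  apply: hM => //; first exact: rO.
  have := eO n; rewrite /renergy => h.
  have n1 : n.+1%:R^-1 <= 1 :> R by rewrite invf_le1// ler1n.
  have : 0 <= lambda * (perim (W n) / (kappa * area (W n))).
    apply: mulr_ge0; first exact: ltW.
    apply: divr_ge0; first exact/ltW/perim_gt0.
    by apply/ltW/mulr_gt0 => //; exact: area_gt0.
  move: h n1; move: (dint p (W n)) (lambda * (_ / _)) (n.+1%:R^-1 : R) => *; lra.
have [F [FU Foo]] := ultraFilterLemma (@eventually_filter).
pose L := ultra_set F W.
have bL : body L by exact: (ultra_set_body FU r0 vO rO OM).
exists L; apply/minimizerP => //; split => // K bK.
apply: (@le_trans _ _ m); last by apply: ge_inf; [exists 0|exists K].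
rewrite leNgt; apply/negP => Em.
have E0 := renergy_ge0 p l0 bL.
(* If [L] had energy above [m], some set of energy below the midpoint [m'] would be nested with [L]
   up to a dilation [t] with [t^(p + 3) m'] below the energy of [L], against [renergy_dilation]. *)
pose m' := (m + renergy p lambda L) / 2.
have mm' : m < m' by rewrite /m'; lra.
have m'E : m' < renergy p lambda L by rewrite /m'; lra.
have m'0 : 0 < m' by exact: le_lt_trans mm'.
pose q := renergy p lambda L / m'.
have q1 : 1 < q by rewrite ltr_pdivlMr// mul1r.
have q0 : 0 < q by lra.
(* [p + 4] instead of [p + 3] leaves one factor [t] to spare. *)
pose t := q `^ ((p + 4)^-1).
have t1 : 1 < t.
  by have := @gt0_ltr_powR R ((p + 4)^-1) _ 1 q; rewrite powR1; apply; rewrite ?nnegrE ?invr_gt0; lra.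
have t0 : 0 < t by lra.
have tq : t `^ (p + 3) < q.
  have e4 : t `^ (p + 3) * t `^ 1 = q.
    rewrite -powRD; last by apply/implyP => _; rewrite gt_eqF.
    rewrite (_ : p + 3 + 1 = p + 4); last by ring.
    by rewrite -powRrM mulVf ?powRr1 ?(ltW q0)// gt_eqF//; lra.
  by rewrite -e4 powRr1 ?(ltW t0)// ltr_pMr ?powR_gt0.
pose e := t - 1; have e0 : 0 < e by rewrite /e; lra.
have te : t = 1 + e by rewrite /e; lra.
have er0 : 0 < e * r by rewrite mulr_gt0.
have Fm : F [set n | n.+1%:R^-1 < m' - m].
  by apply: Foo; apply: near_infty_natSinv_lt (PosNum _); rewrite subr_gt0.
have [n [[h1 h2] h3]] := filter_ex (filterI (filterI (ultra_set_sub_near FU OM er0)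
  (sub_ultra_set_near FU OM er0)) Fm).
have := @renergy_dilation p lambda t (W n) L p1 l0 t1 (bO n) bL.
rewrite te => /(_ (sub_dilation r0 e0 (vO n) (rO n) h1)).
have vL : cvx L by case: bL.
move=> /(_ (sub_dilation r0 e0 vL (@ultra_set_ball F W r FU rO) h2)); rewrite -te => h.
have h4 : renergy p lambda (W n) < m' by apply: le_lt_trans (eO n) _; rewrite -ltrBrDl.
have : t `^ (p + 3) * renergy p lambda (W n) <= t `^ (p + 3) * m' by rewrite ler_wpM2l ?powR_ge0// ltW.
have : t `^ (p + 3) * m' < q * m' by rewrite ltr_pM2r.
rewrite /q divfK ?gt_eqF//; move: h; clear; lra.
Qed.

End Existence.
(** * The Minkowski gauge *)

Section Gauge.
Context {R : realType}.
Implicit Types (x y z : R * R) (t s a b : R).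

Definition minkowski (Omega : set (R * R)) x : R := inf [set t | 0 < t /\ Omega (t^-1 *: x)].

Variables (Omega : set (R * R)) (r M : R).
Hypotheses (cO : compact Omega) (vO : cvx Omega) (r0 : 0 < r) (M0 : 0 < M).
Hypotheses (Or : forall x, euclid x <= r -> Omega x) (OM : forall x, Omega x -> euclid x <= M).
Local Notation j := (minkowski Omega).
Local Notation S x := [set t | 0 < t /\ Omega (t^-1 *: x)].

Let Slb x : has_lbound (S x).
Proof. by exists 0 => t [/ltW]. Qed.

Let Or0 : Omega 0.
Proof. by apply: Or; rewrite euclid0 ltW. Qed.

Let S_ball x t : 0 < t -> euclid x <= r * t -> S x t.
Proof.
move=> t0 h; split => //; apply: Or; rewrite euclidZ gtr0_norm ?invr_gt0//.
by rewrite ler_pdivrMl// mulrC.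
Qed.

Let S0 x : S x !=set0.
Proof.
exists (euclid x / r + 1); apply: S_ball; first by rewrite ltr_wpDl// divr_ge0 ?euclid_ge0// ltW.
by rewrite mulrDr mulrC divfK ?gt_eqF// mulr1 lerDl ltW.
Qed.

Lemma minkowski_le x t : 0 < t -> Omega (t^-1 *: x) -> j x <= t.
Proof. by move=> t0 h; apply: ge_inf; [exact: Slb|split]. Qed.

Lemma minkowski_ge0 x : 0 <= j x.
Proof. by apply: lb_le_inf; [exact: S0|move=> t [/ltW]]. Qed.

Lemma minkowski_lt x t : j x < t -> Omega (t^-1 *: x).
Proof.
move=> h; have [s [s0 Os] st] := inf_lt (S0 x) h.
have t0 : 0 < t by exact: lt_trans st.
rewrite (_ : t^-1 *: x = (s / t) *: (s^-1 *: x) + (1 - s / t) *: 0).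
  apply: vO => //; first by rewrite divr_ge0// ltW.
  by rewrite ler_pdivrMr// mul1r ltW.
by congr pair; rewrite /= /GRing.scale /=; field; rewrite !gt_eqF.
Qed.

Lemma minkowski_in x t : 0 < t -> j x <= t -> Omega (t^-1 *: x).
Proof.
move=> t0 xt; apply: (compact_closed2 cO); apply/closureE => e e0.
(* [Omega] contains [x / (t + d)], which is within [(d / t) M < e] of [x / t]. *)
pose d := e * t / (2 * (e + M)).
have eM : 0 < 2 * (e + M) by rewrite mulr_gt0// addr_gt0.
have d0 : 0 < d by rewrite divr_gt0// mulr_gt0.
have td : 0 < t + d by rewrite addr_gt0.
have Od : Omega ((t + d)^-1 *: x) by apply: minkowski_lt; rewrite (le_lt_trans xt)// ltrDl.
exists ((t + d)^-1 *: x) => //.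
rewrite (_ : _ - _ = (- (d / t)) *: ((t + d)^-1 *: x)); last first.
  by congr pair; rewrite /= /GRing.scale /=; field; rewrite !gt_eqF.
have dt0 : 0 < d / t by exact: divr_gt0.
rewrite euclidZ normrN gtr0_norm//.
apply: (@le_lt_trans _ _ (d / t * M)); first by apply: ler_wpM2l; [apply: divr_ge0; exact: ltW|exact: OM].
rewrite (_ : d / t * M = e * (M / (2 * (e + M)))); last first.
  by rewrite /d; field; rewrite !gt_eqF// ltr_wpDl// ltW.
rewrite gtr_pMr// ltr_pdivrMr// mul1r; lra.
Qed.

Lemma minkowski_le1 x : j x <= 1 <-> Omega x.
Proof.
have -> : Omega x = Omega (1^-1 *: x) by rewrite invr1 scale1r.
by split; [exact: minkowski_in|exact: minkowski_le].
Qed.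

Lemma minkowskiD x y : j (x + y) <= j x + j y.
Proof.
apply/ler_addgt0Pr => e e0; have e20 := divr_gt0 e0 (ltr0n R 2).
pose s := j x + e / 2; pose t := j y + e / 2.
have s0 : 0 < s by rewrite ltr_wpDl// minkowski_ge0.
have t0 : 0 < t by rewrite ltr_wpDl// minkowski_ge0.
have st : 0 < s + t by rewrite addr_gt0.
rewrite (_ : j x + j y + e = s + t); last by rewrite /s /t; lra.
apply: minkowski_le => //.
rewrite (_ : _ *: _ = (s / (s + t)) *: (s^-1 *: x) + (1 - s / (s + t)) *: (t^-1 *: y)).
  apply: vO; [apply: minkowski_lt|apply: minkowski_lt| |].
  - by rewrite ltrDl.
  - by rewrite ltrDl.
  - by rewrite divr_ge0// ltW.
  - by rewrite ler_pdivrMr// mul1r lerDl ltW.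
by clearbody s t; congr pair; rewrite /= /GRing.scale /=; field; rewrite !gt_eqF.
Qed.

Lemma minkowskiZ t x : 0 < t -> j (t *: x) = t * j x.
Proof.
suff key u y : 0 < u -> j (u *: y) <= u * j y.
  move=> t0; apply/le_anti; rewrite key//=; have tV : 0 < t^-1 by rewrite invr_gt0.
  have := key _ (t *: x) tV; rewrite scalerA mulVf ?gt_eqF// scale1r.
  by rewrite ler_pdivlMl.
move=> u0; apply/ler_addgt0Pr => e e0; have eu := divr_gt0 e0 u0.
have h : 0 < j y + e / u by rewrite ltr_wpDl// minkowski_ge0.
rewrite (_ : u * j y + e = u * (j y + e / u)); last by field; rewrite gt_eqF.
apply: minkowski_le; first exact: mulr_gt0.
rewrite scalerA invfM mulrAC mulVf ?gt_eqF// mul1r; apply: minkowski_lt; rewrite ltrDl//.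
Qed.

Lemma minkowski_le_euclid x : j x <= euclid x / r.
Proof.
apply/ler_addgt0Pr => e e0.
have h : 0 < euclid x / r + e by rewrite ltr_wpDl// divr_ge0 ?euclid_ge0// ltW.
apply: minkowski_le => //; apply: (S_ball h _).2.
by rewrite mulrDr mulrC divfK ?gt_eqF// lerDl mulr_ge0// ltW.
Qed.

Lemma euclid_le_minkowski x : euclid x <= M * j x.
Proof.
apply/ler_addgt0Pr => e e0; have eM := divr_gt0 e0 M0.
have h : 0 < j x + e / M by rewrite ltr_wpDl// minkowski_ge0.
have := OM (@minkowski_lt x (j x + e / M) _); rewrite ltrDl => /(_ eM).
rewrite euclidZ gtr0_norm ?invr_gt0// ler_pdivrMl// => /le_trans; apply.
by rewrite le_eqVlt; apply/orP; left; apply/eqP; field; rewrite gt_eqF.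
Qed.

Lemma minkowski_lipschitz x y : `|j x - j y| <= euclid (x - y) / r.
Proof.
have key u v : j u - j v <= euclid (u - v) / r.
  rewrite lerBlDr addrC; apply: le_trans (_ : j (v + (u - v)) <= _); first by rewrite addrCA subrr addr0.
  by apply: le_trans (minkowskiD _ _) _; rewrite lerD2l minkowski_le_euclid.
rewrite ler_norml key andbT; have := key y x; rewrite (euclidBC y x); lra.
Qed.

Lemma minkowski_interior x : j x < 1 -> interior Omega x.
Proof.
move=> h; apply/interiorE; exists ((1 - j x) * r); first by rewrite mulr_gt0// subr_gt0.
move=> y yx; apply/minkowski_le1.
have := minkowski_lipschitz y x; rewrite ler_norml => /andP[_ h2].
have : euclid (y - x) / r < 1 - j x by rewrite ltr_pdivrMr.
lra.
Qed.

(** An interior point of gauge 1 could be stretched to [(1 + u) x] inside [Omega], where the gauge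
    exceeds 1. *)
Lemma boundary_minkowski x : boundary Omega x <-> j x = 1.
Proof.
have cl := compact_closed2 cO; split => [/(boundary_closed x cl)[Ox ni]|jx].
  apply/le_anti; rewrite (minkowski_le1 x).2//= leNgt; apply/negP => h; apply: ni.
  exact: minkowski_interior.
apply/boundary_closed => //; split; first by apply/minkowski_le1; rewrite jx.
move=> /interiorE[e e0 he].
have x0 : 0 < euclid x.
  rewrite lt_neqAle euclid_ge0 andbT eq_sym; apply/eqP => x0.
  by have := minkowski_le_euclid x; rewrite x0 mul0r jx ler10.
pose u := e / (2 * euclid x); have u0 : 0 < u by rewrite divr_gt0// mulr_gt0.
have /minkowski_le1 : Omega ((1 + u) *: x).
  apply: he; rewrite scalerDl scale1r addrAC subrr add0r euclidZ gtr0_norm//.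
  rewrite /u (_ : e / (2 * euclid x) * euclid x = e / 2); last by field; rewrite gt_eqF.
  lra.
by rewrite minkowskiZ ?addr_gt0// jx mulr1 gerDl leNgt u0.
Qed.

(* Otherwise [p], or [q], would be a convex combination of the other point,
   [z] and [0] with a positive weight on [0]. *)
Lemma minkowski_cone p q z a b : j p = 1 -> j q = 1 -> j z <= 1 ->
  z = a *: p + b *: q -> 1 < a + b -> 0 <= a /\ 0 <= b.
Proof.
have key p' q' z' a' b' : j p' = 1 -> j q' = 1 -> j z' <= 1 ->
    z' = a' *: p' + b' *: q' -> 1 < a' + b' -> 0 <= b'.
  move=> jp jq jz ez ab; rewrite leNgt; apply/negP => b0.
  have a0 : 0 < a' by lra.
  have nb0 : 0 < - b' by lra.
  have : j (a' *: p') <= j z' + j ((- b') *: q').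
    apply: le_trans (minkowskiD _ _); rewrite ez.
    by rewrite (_ : _ + _ + _ = a' *: p')//; congr pair; rewrite /= /GRing.scale /=; ring.
  rewrite !minkowskiZ// jp jq; lra.
move=> jp jq jz ez ab; split; last exact: (key p q z a b).
by apply: (key q p z b a) => //; [rewrite addrC|rewrite addrC].
Qed.

(** For [b < 0] the point [p] lies between [z] and [q], so a gauge below 1 at [z] would force one
    below 1 at [p]. A line that stays in [Omega] beyond two boundary points thus runs along the
    boundary. *)
Lemma minkowski_line p q z a b : j p = 1 -> j q = 1 -> j z <= 1 ->
  z = a *: p + b *: q -> a + b = 1 -> b < 0 -> j z = 1.
Proof.
move=> jp jq jz ez ab b0; apply/le_anti; rewrite jz /=.
have a0 : 0 < a by lra.
have nb0 : 0 < - b by lra.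
have : j (a *: p) <= j z + j ((- b) *: q).
  apply: le_trans (minkowskiD _ _); rewrite ez.
  by rewrite (_ : _ + _ + _ = a *: p)//; congr pair; rewrite /= /GRing.scale /=; ring.
rewrite !minkowskiZ// jp jq; lra.
Qed.

End Gauge.
(** * Cutting off caps *)

Section HalfPlanes.
Context {R : realType}.
Implicit Types (A B K Omega : set (R * R)) (p q u v w x y z : R * R) (a b c d e t : R).
Local Notation H := unnormalized_hausdorff.

Definition halfplane v : set (R * R) := [set z | det z v <= 1].

(* The linear form [det _ (chord p q)] takes the value 1 on the line [pq]. *)
Definition chord p q : R * R := (det p q)^-1 *: (q - p).

Lemma det_linearl a b x y v : det (a *: x + b *: y) v = a * det x v + b * det y v.
Proof. by rewrite /det /= /GRing.scale /=; ring. Qed.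

Lemma det_subl w z v : det w v - det z v = det (w - z) v.
Proof. by rewrite /det /=; ring. Qed.

Lemma det_chordl p q : det p q != 0 -> det p (chord p q) = 1.
Proof. by rewrite /chord /det /= /GRing.scale /= => h; field. Qed.

Lemma det_chordr p q : det p q != 0 -> det q (chord p q) = 1.
Proof. by rewrite /chord /det /= /GRing.scale /= => h; field. Qed.

Lemma chord_coordinates p q z : det p q != 0 -> exists a b,
  z = a *: p + b *: q /\ a + b = det z (chord p q).
Proof.
move=> h; exists (det z q / det p q), (det p z / det p q).
rewrite /chord /det /= /GRing.scale /= in h *; split; last by field.
by rewrite [LHS]surjective_pairing; congr pair; rewrite /= /GRing.scale /=; field.
Qed.

Lemma halfplane_closed v : closed (halfplane v).
Proof.
have cv : continuous (fun z : R * R => det z v).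
  apply: (@lipschitz_continuous _ _ (euclid v)) => x y.
  by rewrite det_subl mulrC; exact: normr_det_le.
have -> : halfplane v = (fun z => det z v) @^-1` [set t | t <= 1] by [].
by apply: closed_comp => [x _|]; [exact: cv|exact: closed_le].
Qed.

Lemma halfplane_cvx v : cvx (halfplane v).
Proof. by move=> x y t; rewrite /halfplane /= det_linearl; nra. Qed.

Lemma cvxI A B : cvx A -> cvx B -> cvx (A `&` B).
Proof. by move=> vA vB x y t [Ax Bx] [Ay By] t0 t1; split; [exact: vA|exact: vB]. Qed.

Lemma compact_halfplane A v : compact A -> compact (A `&` halfplane v).
Proof.
move=> cA; apply: (@subclosed_compact _ _ A) => //.
by apply: closedI; [exact: (compact_closed2 cA)|exact: halfplane_closed].
Qed.

(** Stretching [q] away from the origin leaves the half-plane at once, since the linear form is 1 at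
    [q]. *)
Lemma boundary_halfplane K q v : compact K -> K `<=` halfplane v -> K q -> det q v = 1 ->
  boundary K q.
Proof.
move=> cK Kv Kq qv; apply/boundary_closed; first exact: compact_closed2.
split => // /interiorE[e e0 he].
pose t := e / (2 * (euclid q + 1)).
have q0 : 0 < euclid q + 1 by rewrite ltr_wpDl// euclid_ge0.
have t0 : 0 < t by rewrite divr_gt0// mulr_gt0.
have /Kv : K ((1 + t) *: q + 0 *: q).
  apply: he; rewrite scale0r addr0 scalerDl scale1r addrAC subrr add0r euclidZ gtr0_norm//.
  apply: (@le_lt_trans _ _ (t * (euclid q + 1))); first by rewrite ler_pM2l// lerDl.
  rewrite /t (_ : _ * _ = e / 2); last by field; rewrite gt_eqF.
  lra.
by rewrite /halfplane /= det_linearl qv mul0r addr0 mulr1 gerDl leNgt t0.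
Qed.

(** A linear form is Lipschitz, so a gap between its values keeps the sets apart. *)
Lemma separated_by v A B c d : 0 < d -> (forall x, A x -> det x v <= c) ->
  (forall y, B y -> c + d <= det y v) ->
  exists2 e, 0 < e & forall x y, A x -> B y -> e <= euclid (x - y).
Proof.
move=> d0 hA hB; have v0 : 0 < euclid v + 1 by rewrite ltr_wpDl// euclid_ge0.
exists (d / (euclid v + 1)); first exact: divr_gt0.
move=> x y Ax By; rewrite ler_pdivrMr// euclidBC.
have h : d <= det (y - x) v by rewrite -det_subl; have := hA _ Ax; have := hB _ By; lra.
apply: le_trans h _; apply: le_trans (ler_norm _) _; apply: le_trans (normr_det_le _ _) _.
by rewrite ler_wpM2l ?euclid_ge0// lerDl.
Qed.

(** Trimmed at both ends so that two sides of a triangle, despite a common vertex, are at positive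
    distance. *)
Definition inner_seg e p q : set (R * R) :=
  [set x | exists2 t, e <= t <= 1 - e & x = t *: p + (1 - t) *: q].

Lemma inner_seg_length p q e : 0 < e -> e < 2^-1 ->
  (((1 - 2 * e) * euclid (p - q))%:E <=
   H 1 (inner_seg e p q))%E.
Proof.
move=> e0 e1.
have -> : (1 - 2 * e) * euclid (p - q) =
   euclid (((1 - e) *: p + e *: q) - (e *: p + (1 - e) *: q)).
  rewrite -(@gtr0_norm _ (1 - 2 * e)); last by lra.
  by rewrite -euclidZ; congr euclid; congr pair; rewrite /= /GRing.scale /=; ring.
apply: unnormalized1_seg_ge => _ [t /andP[t0 t1] ->].
exists (t * (1 - e) + (1 - t) * e); first by apply/andP; split; nra.
by congr pair; rewrite /= /GRing.scale /=; ring.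
Qed.

(** The limit [e -> 0] by contradiction: for an excess [g], the choice [e = g / (4 (s + g))] loses
    at most [g / 2]. *)
Lemma shrink_limit a s c : 0 <= s ->
  (forall e, 0 < e -> e < 2^-1 -> a + (1 - 2 * e) * s <= c) -> a + s <= c.
Proof.
move=> s0 h; rewrite leNgt; apply/negP => ac.
pose g := a + s - c; have g0 : 0 < g by rewrite /g; lra.
have d0 : 0 < 4 * (s + g) by lra.
have := h (g / (4 * (s + g))) _ _; rewrite divr_gt0// ltr_pdivrMr// => /(_ isT).
have -> : (g < 2^-1 * (4 * (s + g))) by lra.
move/(_ isT).
have -> : (1 - 2 * (g / (4 * (s + g)))) * s = s - g / 2 * (s / (s + g)) by field; rewrite gt_eqF//; lra.
have : s / (s + g) <= 1 by rewrite ler_pdivrMr; lra.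
have : g / 2 * (s / (s + g)) <= g / 2 * 1.
  by rewrite ler_wpM2l//; [lra|rewrite ler_pdivrMr; lra].
by rewrite /g in g0 *; lra.
Qed.

Lemma comb_le (e t c : R) : e <= t -> c <= 1 -> t * c + (1 - t) * 1 <= 1 - e * (1 - c).
Proof. nra. Qed.

Lemma comb_ge (e t c : R) : e <= t -> 1 <= c -> 1 + e * (c - 1) <= t * c + (1 - t) * 1.
Proof. nra. Qed.

Lemma comb_flip (t c : R) : t * 1 + (1 - t) * c = (1 - t) * c + (1 - (1 - t)) * 1.
Proof. ring. Qed.

(** For a triangle with base [w = |p + q|] and height [k], the determinant is [w k] up to sign;
    divided by [w^2] this reads [w^2 + 4 k^2 <= (|p| + |q|)^2]. *)
Lemma two_sides_ge p q :
  euclid (p + q) ^+ 4 + 4 * det p (p + q) ^+ 2 <= euclid (p + q) ^+ 2 * (euclid p + euclid q) ^+ 2.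
Proof.
set s := p + q; pose k := det p s.
(* Reflect one side: both have the same height over the direction of [s]. *)
pose P : R * R := (dot p s, k); pose Q : R * R := (dot q s, k).
have eP : euclid P = euclid s * euclid p.
  apply/eqP; rewrite -(@eqrXn2 _ 2) ?mulr_ge0 ?euclid_ge0//; apply/eqP.
  by rewrite exprMn !sqr_euclid /P /k /dot /det /=; ring.
have eQ : euclid Q = euclid s * euclid q.
  apply/eqP; rewrite -(@eqrXn2 _ 2) ?mulr_ge0 ?euclid_ge0//; apply/eqP.
  by rewrite exprMn !sqr_euclid /Q /k /s /dot /det /=; ring.
have h := euclidD P Q; rewrite eP eQ -mulrDr in h.
rewrite -exprMn; apply: le_trans (_ : euclid (P + Q) ^+ 2 <= _); last first.
  by rewrite ler_sqr ?nnegrE ?mulr_ge0 ?addr_ge0 ?euclid_ge0.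
rewrite (_ : 4 = 2 * 2)%N// exprM !sqr_euclid /P /Q /k /s /dot /det /=.
by rewrite le_eqVlt; apply/orP; left; apply/eqP; ring.
Qed.

End HalfPlanes.

(** * Comparison of a body with the body minus a cap *)

Section Cut.
Context {R : realType}.
Implicit Types (x y z : R * R) (t s a b : R).
Variables (Omega : set (R * R)) (r M : R).
Hypotheses (cO : compact Omega) (vO : cvx Omega) (r0 : 0 < r) (M0 : 0 < M).
Hypotheses (Or : forall x, euclid x <= r -> Omega x) (OM : forall x, Omega x -> euclid x <= M).
Hypothesis cheeger : forall K, body K -> K `<=` Omega -> perim Omega * area K <= perim K * area Omega.
Local Notation j := (minkowski Omega).
Local Notation H := unnormalized_hausdorff.

Let bO : body Omega.
Proof.
split => //; exists 0; apply/interiorE; exists r => // y; rewrite subr0 => /ltW; exact: Or.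
Qed.

Let jO x : j x <= 1 <-> Omega x := minkowski_le1 cO vO r0 M0 Or OM x.
Let jbd x : boundary Omega x <-> j x = 1 := boundary_minkowski cO vO r0 M0 Or OM x.

(** [X] and [Y] are the ends of the chord and [Z] is a point of the cap farthest from it; the linear
    form [ell] is 1 on the chord line. *)
Variables (X Y Z : R * R).
Hypotheses (jX : j X = 1) (jY : j Y = 1) (OZ : Omega Z).
Local Notation ell z := (det z (chord X Y)).
Hypotheses (D0 : 0 < det X Y) (Zmax : forall z, Omega z -> ell z <= ell Z) (Z1 : 1 < ell Z).

Let OX : Omega X. Proof. by apply/jO; rewrite jX. Qed.
Let OY : Omega Y. Proof. by apply/jO; rewrite jY. Qed.
Let Dn0 : det X Y != 0. Proof. by rewrite gt_eqF. Qed.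
Let ellX : ell X = 1. Proof. exact: det_chordl. Qed.
Let ellY : ell Y = 1. Proof. exact: det_chordr. Qed.

(** Otherwise [Z] could be stretched inside [Omega], which increases [ell]. *)
Let jZ : j Z = 1.
Proof.
apply/le_anti; rewrite (jO Z).2//= leNgt; apply/negP => jZ1.
have jZ0 : 0 <= j Z := minkowski_ge0 r0 Or Z.
pose t := (1 + j Z) / 2; have t0 : 0 < t by rewrite /t; lra.
have Ot : Omega (t^-1 *: Z) by apply: (minkowski_lt vO r0 Or); rewrite /t; lra.
have := Zmax Ot; rewrite -[t^-1 *: Z]addr0 -(scale0r Z) det_linearl mul0r addr0 leNgt => /negP; apply.
by rewrite ltr_pMl ?(lt_trans ltr01)// invf_gt1// /t; lra.
Qed.

Let coordZ : exists a b, [/\ Z = a *: X + b *: Y, 0 < a, 0 < b & a + b = ell Z].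
Proof.
have [a [b [eZ ab]]] := chord_coordinates Z Dn0.
have jZ1 : j Z <= 1 by rewrite jZ.
have ab1 : 1 < a + b by rewrite ab.
have [a0 b0] := minkowski_cone vO r0 Or jX jY jZ1 eZ ab1.
exists a, b; split => //; rewrite lt_neqAle ?a0 ?b0 andbT; apply/eqP => h.
  have b1 : 0 < b by lra.
  by move: jZ1; rewrite eZ -h scale0r add0r (minkowskiZ vO r0 Or)// jY; lra.
have a1 : 0 < a by lra.
by move: jZ1; rewrite eZ -h scale0r addr0 (minkowskiZ vO r0 Or)// jX; lra.
Qed.

Let detXZ : 0 < det X Z.
Proof.
have [a [b [-> a0 b0 _]]] := coordZ.
rewrite (_ : det _ _ = b * det X Y); last by rewrite /det /= /GRing.scale /=; ring.
exact: mulr_gt0.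
Qed.

Let detZY : 0 < det Z Y.
Proof.
have [a [b [-> a0 b0 _]]] := coordZ.
rewrite (_ : det _ _ = a * det X Y); last by rewrite /det /= /GRing.scale /=; ring.
exact: mulr_gt0.
Qed.

(** A point of [Omega] beyond the line [pq] has nonnegative coordinates of sum above 1 in [p] and
    [q]; as [ell] is at least 1 at both, it exceeds 1 at that point. *)
Let below_chord p q z : j p = 1 -> j q = 1 -> det p q != 0 -> 1 <= ell p -> 1 <= ell q ->
  Omega z -> ell z <= 1 -> det z (chord p q) <= 1.
Proof.
move=> jp jq pq ep eq Oz ez; rewrite leNgt; apply/negP => h.
have [a [b [ezab ab]]] := chord_coordinates z pq.
have jz : j z <= 1 by exact/jO.
have ab1 : 1 < a + b by rewrite ab.
have [a0 b0] := minkowski_cone vO r0 Or jp jq jz ezab ab1.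
by move: ez; rewrite ezab det_linearl; nra.
Qed.

Let v1 := chord X Z.
Let v2 := chord Z Y.
Let B := boundary Omega `&` halfplane (chord X Y).
(** [Omega1] lacks the whole cap, while [Omega2] keeps the triangle [XZY] of it. *)
Let Omega1 := Omega `&` halfplane (chord X Y).
Let Omega2 := (Omega `&` halfplane v1) `&` halfplane v2.

Let below1 z : Omega z -> ell z <= 1 -> det z v1 <= 1.
Proof. by apply: below_chord => //; rewrite ?ellX ?gt_eqF// ltW. Qed.

Let below2 z : Omega z -> ell z <= 1 -> det z v2 <= 1.
Proof. by apply: below_chord => //; rewrite ?ellY ?gt_eqF// ltW. Qed.

Let cO2 : compact Omega2.
Proof. by apply: compact_halfplane; exact: compact_halfplane. Qed.

Let vO2 : cvx Omega2.
Proof. by apply: cvxI; [apply: cvxI => //|]; exact: halfplane_cvx. Qed.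

Let body1 : body Omega1.
Proof.
split; [exact: compact_halfplane|by apply: cvxI => //; exact: halfplane_cvx|].
pose e := Num.min r (euclid (chord X Y) + 1)^-1.
have c0 : 0 < euclid (chord X Y) + 1 by rewrite ltr_wpDl// euclid_ge0.
exists 0; apply/interiorE; exists e; first by rewrite lt_min r0 invr_gt0.
move=> y; rewrite subr0 lt_min => /andP[y1 y2]; split; first exact/Or/ltW.
rewrite /halfplane /=; apply: le_trans (ler_norm _) _; apply: le_trans (normr_det_le _ _) _.
apply: (@le_trans _ _ ((euclid (chord X Y) + 1)^-1 * (euclid (chord X Y) + 1))).
  by apply: ler_pM; rewrite ?euclid_ge0// ?ltW// ltrDl.
by rewrite mulVf ?gt_eqF.
Qed.

Let HB : (H 1 B <= H 1 (boundary Omega))%E.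
Proof. by apply: le_unnormalized => x []. Qed.

Let HBfin : H 1 B = (fine (H 1 B))%:E.
Proof.
rewrite fineK// fin_numElt (lt_le_trans _ (unnormalized_ge0 _ _))//=.
by apply: le_lt_trans HB _; rewrite perimE// ltry.
Qed.

(** Strictly below the chord line, boundary points of [Omega1] are boundary points of [Omega]. On
    the line they lie between [X] and [Y] or, beyond these, in [boundary Omega] by
    [minkowski_line]. *)
Let perim_cut : perim Omega1 <= fine (H 1 B) + euclid (Y - X).
Proof.
rewrite -lee_fin -(perimE body1) EFinD -HBfin.
apply: le_trans (_ : (H 1 (B `|` seg Y X) <= _)%E); last first.
  by apply: le_trans (unnormalizedU _ _ _) _; apply: leeD => //; exact: unnormalized1_seg_le.
apply: le_unnormalized => z; have cO1 : compact Omega1 by case: body1.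
move=> /(boundary_closed _ (compact_closed2 cO1))[[Oz ez] ni].
have jz : j z <= 1 by exact/jO.
have [lt1|ge1] := ltP (ell z) 1.
  left; split => //; apply/boundary_closed; first exact: compact_closed2.
  split => // /interiorE[e e0 he]; apply: ni; apply/interiorE.
  pose c := euclid (chord X Y) + 1.
  have c0 : 0 < c by rewrite ltr_wpDl// euclid_ge0.
  exists (Num.min e ((1 - ell z) / c)); first by rewrite lt_min e0 divr_gt0// subr_gt0.
  move=> y; rewrite lt_min => /andP[y1 y2]; split; first exact: he.
  rewrite ltr_pdivlMr// in y2; rewrite /halfplane /=.
  suff h : det (y - z) (chord X Y) <= 1 - ell z by have := det_subl y z (chord X Y); lra.
  apply: le_trans (ler_norm _) _; apply: le_trans (normr_det_le _ _) _.
  by apply: le_trans (ltW y2); rewrite ler_wpM2l ?euclid_ge0// lerDl.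
have ez1 : ell z = 1 by apply/le_anti; rewrite ez ge1.
have [a [b [ezab ab]]] := chord_coordinates z Dn0; rewrite ez1 in ab.
have [a0|a0] := ltP a 0.
  left; split => //; apply/jbd; apply: (minkowski_line vO r0 Or (a := b) jY jX jz _ _ a0).
    by rewrite addrC.
  by rewrite addrC.
have [b0|b0] := ltP b 0.
  by left; split => //; apply/jbd; exact: (minkowski_line vO r0 Or jX jY jz ezab ab b0).
right; exists b; first by apply/andP; split; lra.
by rewrite ezab addrC (_ : a = 1 - b)//; lra.
Qed.

(** [Omega2] is a convex subset of [Omega] whose boundary contains [B] and both sides [XZ], [ZY].
    Additivity asks for gaps, so the sides are trimmed by [e], which tends to 0. *)
Let perim_hull : fine (H 1 B) + (euclid (X - Z) + euclid (Z - Y)) <= perim Omega.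
Proof.
apply: shrink_limit => [|e e0 e1]; first by rewrite addr_ge0// euclid_ge0.
pose S1 := inner_seg e X Z.
pose S2 := inner_seg e Z Y.
have hS1 : ((((1 - 2 * e) * euclid (X - Z))%:E <= H 1 S1)%E) by exact: inner_seg_length.
have hS2 : ((((1 - 2 * e) * euclid (Z - Y))%:E <= H 1 S2)%E) by exact: inner_seg_length.
have XZn0 : det X Z != 0 by rewrite gt_eqF.
have ZYn0 : det Z Y != 0 by rewrite gt_eqF.
have v1X : det X v1 = 1 by exact: det_chordl.
have v1Z : det Z v1 = 1 by exact: det_chordr.
have v2Z : det Z v2 = 1 by exact: det_chordl.
have v2Y : det Y v2 = 1 by exact: det_chordr.
(* Strict because [Y] is not on the line [XZ]; this will separate the two trimmed sides. *)
have v1Y : det Y v1 < 1.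
  have [a [b [eY ab]]] := chord_coordinates Y XZn0; rewrite -/v1 in ab.
  have Yle : det Y v1 <= 1 by apply: below1 => //; rewrite ellY.
  rewrite lt_neqAle Yle andbT; apply/eqP => h; rewrite h in ab.
  have := ellY; rewrite {1}eY det_linearl ellX => h2.
  have b0 : b * (ell Z - 1) = 0 by lra.
  move/eqP: b0; rewrite mulf_eq0 subr_eq0 (gt_eqF Z1) orbF => /eqP b0.
  move: Dn0; rewrite eY b0 scale0r addr0 (_ : det _ _ = 0) ?eqxx//.
  by rewrite /det /= /GRing.scale /=; ring.
have v2X : det X v2 <= 1 by apply: below2 => //; rewrite ellX.
have sub : B `|` (S1 `|` S2) `<=` boundary Omega2.
  move=> z [[/(boundary_closed z (compact_closed2 cO))[Oz ni] ez]|].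
    apply/boundary_closed; first exact: compact_closed2.
    split; first by split; [split => //; exact: below1|exact: below2].
    by move=> /interiorE[d d0 hd]; apply: ni; apply/interiorE; exists d => // y /hd[[]].
  move=> [[t /andP[t0 t1] ->]|[t /andP[t0 t1] ->]].
    apply: (@boundary_halfplane _ _ _ v1) => //; first by move=> w [[]].
      split; [split|]; rewrite /halfplane /= ?det_linearl ?v1X ?v1Z ?v2Z.
      - by apply: vO => //; lra.
      - lra.
      - by have := comb_le (ltW (lt_le_trans e0 t0)) v2X; rewrite mul0r subr0.
    by rewrite det_linearl v1X v1Z; lra.
  apply: (@boundary_halfplane _ _ _ v2) => //; first by move=> w [].
    split; [split|]; rewrite /halfplane /= ?det_linearl ?v1Z ?v2Z ?v2Y.
    - by apply: vO => //; lra.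
    - have t2 : 0 <= 1 - t by lra.
      by rewrite comb_flip; have := comb_le t2 (ltW v1Y); rewrite mul0r subr0.
    - lra.
  by rewrite det_linearl v2Z v2Y; lra.
have m2 : (H 1 (B `|` (S1 `|` S2)) <= (perim Omega)%:E)%E.
  rewrite -(perimE bO); apply: le_trans (le_unnormalized 1 sub) _.
  apply: perimeter_mono => //; last by move=> w [[]].
  exists X; split; [split => //|]; rewrite /halfplane /= ?v1X//.
have gap : 0 < e * (ell Z - 1) by rewrite mulr_gt0// subr_gt0.
(* [ell] is at most 1 on [B] and at least [1 + e (ell Z - 1)] on the trimmed sides. *)
have [d1 d10 sep1] : exists2 d, 0 < d & forall x y, B x -> (S1 `|` S2) y -> d <= euclid (x - y).
  apply: (@separated_by _ (chord X Y) _ _ 1 (e * (ell Z - 1))) => //; first by move=> x [].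
  move=> y [|] [t /andP[t0 t1] ->]; rewrite det_linearl ?ellX ?ellY.
    by rewrite comb_flip; apply: comb_ge; [lra|exact: ltW].
  by apply: comb_ge => //; exact: ltW.
have gap2 : 0 < e * (1 - det Y v1) by rewrite mulr_gt0// subr_gt0.
have [d2 d20 sep2] : exists2 d, 0 < d & forall x y, S2 x -> S1 y -> d <= euclid (x - y).
  apply: (@separated_by _ v1 _ _ (1 - e * (1 - det Y v1)) (e * (1 - det Y v1))) => //.
    by move=> y [t /andP[t0 t1] ->]; rewrite det_linearl v1Z comb_flip; apply: comb_le; [lra|exact: ltW].
  by move=> y [t /andP[t0 t1] ->]; rewrite det_linearl v1X v1Z; lra.
have h1 := unnormalized_separated 1 d10 sep1.
have h2 : (H 1 S1 + H 1 S2 <= H 1 (S1 `|` S2))%E.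
  by rewrite addeC setUC; exact: unnormalized_separated d20 sep2.
have h3 := le_trans (leeD (lexx _) h2) (le_trans h1 m2).
rewrite -lee_fin mulrDr !EFinD -HBfin; apply: le_trans h3.
by apply: leeD => //; exact: leeD.
Qed.

(** A point [a X + b Y] of the cap equals [X + (a + b - 1) X + b (Y - X)], with [a + b - 1] between
    0 and [ell Z - 1] and [b] between 0 and [ell Z]: the cap lies in a parallelogram. *)
Let area_cut : area Omega <= area Omega1 +
  4 * ((ell Z - 1) * euclid X) * (ell Z * euclid (Y - X)).
Proof.
rewrite -lee_fin -(areaE bO) EFinD -(areaE body1).
pose cap := [set z | Omega z /\ 1 < ell z].
apply: le_trans (_ : (H 2 (Omega1 `|` cap) <= _)%E).
  by apply: le_unnormalized => z Oz; have [|] := ltP 1 (ell z); [right|left].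
apply: le_trans (unnormalizedU _ _ _) _; apply: leeD => //.
have e0 : 0 < ell Z - 1 by rewrite subr_gt0.
have eZ0 : 0 < ell Z by exact: lt_trans Z1.
have -> : 4 * ((ell Z - 1) * euclid X) * (ell Z * euclid (Y - X)) =
  4 * euclid ((ell Z - 1) *: X) * euclid (ell Z *: (Y - X)).
  by rewrite !euclidZ !gtr0_norm.
apply: (@unnormalized2_parallelogram_le _ X) => z [Oz z1].
have [a [b [ezab ab]]] := chord_coordinates z Dn0.
have jz : j z <= 1 by exact/jO.
have ab1 : 1 < a + b by rewrite ab.
have [a0 b0] := minkowski_cone vO r0 Or jX jY jz ezab ab1.
have zZ := Zmax Oz; rewrite -ab in zZ.
exists ((a + b - 1) / (ell Z - 1)), (b / ell Z); split.
- by rewrite divr_ge0 ?ler_pdivrMr//; lra.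
- by rewrite divr_ge0 ?ler_pdivrMr//; lra.
rewrite ezab; move: (gt_eqF e0) (gt_eqF eZ0) => /negbT h1 /negbT h2; move: (ell Z) h1 h2 => l h1 h2.
by congr pair; rewrite /= /GRing.scale /=; field; rewrite h1 h2.
Qed.

(** By the Cheeger property, the saved length is at most [perim Omega / area Omega] times the lost
    area. The length of [B], common to [perim_cut] and [perim_hull], cancels. *)
Lemma cut_inequality :
  euclid (Z - X) + euclid (Y - Z) - euclid (Y - X) <=
  perim Omega / area Omega * (4 * ((ell Z - 1) * euclid X) * (ell Z * euclid (Y - X))).
Proof.
have O1 : Omega1 `<=` Omega by move=> z [].
have ch := cheeger body1 O1; have P0 := perim_gt0 bO; have A0 := area_gt0 bO.
have ac := area_cut; rewrite (euclidBC Z X) (euclidBC Y Z).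
set C := 4 * _ * _ in ac *.
rewrite mulrAC ler_pdivlMr//.
move: perim_cut perim_hull ac ch P0 A0.
move: (perim Omega1) (perim Omega) (area Omega1) (area Omega) (fine _) C.
move: (euclid (X - Z)) (euclid (Z - Y)) (euclid (Y - X)).
move=> s1 s2 s3 P1 P A1 A' h C h1 h2 h3 h4 P0 A0.
have h5 : P1 * A' <= (P - (s1 + s2 - s3)) * A' by rewrite ler_pM2r//; lra.
have h6 : P * A' <= P * (A1 + C) by rewrite ler_pM2l.
have h7 := le_trans h4 h5; lra.
Qed.

End Cut.
(** * Regularity of the boundary *)

Section SecondDifferences.
Context {R : realType}.
Implicit Types (F g : R -> R) (x y s t u v w C : R).

Lemma midpoint_convex_chord F : continuous F ->
  (forall x s, 0 <= F (x + s) + F (x - s) - 2 * F x) ->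
  forall u v w, u < v -> v < w -> F v * (w - u) <= F u * (w - v) + F w * (v - u).
Proof.
move=> cF hF u v w uv vw; rewrite leNgt; apply/negP => h.
have uw : 0 < w - u by lra.
pose c := (F w - F u) / (w - u).
have cE : c * (w - u) = F w - F u by rewrite /c divfK// gt_eqF.
have k0 : 0 < (v - u) * (w - v) by rewrite mulr_gt0 ?subr_gt0.
have d0 : 0 < F v - F u - c * (v - u).
  rewrite -(pmulr_lgt0 _ uw); have -> : (F v - F u - c * (v - u)) * (w - u) =
    (F v - F u) * (w - u) - (c * (w - u)) * (v - u) by ring.
  by rewrite cE; lra.
(* At [v] the parabola takes away half of the excess of [F] over the chord, so [phi v] stays
   positive. *)
pose e := (F v - F u - c * (v - u)) / (2 * ((v - u) * (w - v))).
have e0 : 0 < e by rewrite divr_gt0// mulr_gt0.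
have eE : e * ((v - u) * (w - v)) = (F v - F u - c * (v - u)) / 2.
  by rewrite /e; move: (lt0r_neq0 k0); move: ((v - u) * (w - v)) => k kn0; field.
(* The added parabola makes [phi] strictly midpoint convex, hence without
   interior maximum. *)
pose phi t := F t - F u - c * (t - u) + e * ((t - u) * (t - w)).
have cphi : continuous phi.
  move=> t; apply: cvgD; last first.
    apply: cvgM; first exact: cvg_cst.
    by apply: cvgM; apply: cvgB => //; exact: cvg_cst.
  apply: cvgB; first by apply: cvgB; [exact: cF|exact: cvg_cst].
  by apply: cvgM; [exact: cvg_cst|apply: cvgB => //; exact: cvg_cst].
have [m + hm] := EVT_max (ltW (lt_trans uv vw)) (continuous_subspaceT cphi).
rewrite in_itv/= => /andP[um mw].
have phiv : 0 < phi v.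
  have -> : phi v = (F v - F u - c * (v - u)) - e * ((v - u) * (w - v)) by rewrite /phi; ring.
  by rewrite eE; lra.
have phim : 0 < phi m.
  by apply: lt_le_trans phiv _; apply: hm; rewrite in_itv/= !ltW.
have um' : u < m.
  rewrite lt_neqAle um andbT; apply/eqP => um'; move: phim.
  by rewrite -um' /phi !subrr mulr0 mul0r mulr0; lra.
have mw' : m < w.
  rewrite lt_neqAle mw andbT; apply/eqP => mw'; move: phim.
  by rewrite mw' /phi subrr !mulr0 cE; lra.
pose s := Num.min (m - u) (w - m).
have s0 : 0 < s by rewrite lt_min !subr_gt0 um'.
have s1 : s <= m - u by rewrite ge_min lexx.
have s2 : s <= w - m by rewrite ge_min lexx orbT.
have h1 : phi (m + s) <= phi m by apply: hm; rewrite in_itv/=; apply/andP; split; lra.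
have h2 : phi (m - s) <= phi m by apply: hm; rewrite in_itv/=; apply/andP; split; lra.
have : phi (m + s) + phi (m - s) - 2 * phi m =
  (F (m + s) + F (m - s) - 2 * F m) + 2 * (e * s ^+ 2) by rewrite /phi; ring.
have := hF m s; have : 0 < e * s ^+ 2 by rewrite mulr_gt0// exprn_gt0.
lra.
Qed.

(** Chords on the left of [x] have slopes at most those on the right, so the supremum of the left
    slopes supports [F] on both sides. *)
Lemma midpoint_convex_support F : continuous F ->
  (forall x s, 0 <= F (x + s) + F (x - s) - 2 * F x) ->
  forall x, exists a, forall y, F x + a * (y - x) <= F y.
Proof.
move=> cF hF x; have ch := midpoint_convex_chord cF hF.
pose S := [set (F x - F y) / (x - y) | y in [set y | y < x]].
have Sub z : x < z -> ubound S ((F z - F x) / (z - x)).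
  move=> xz _ [y /= yx <-]; rewrite ler_pdivrMr ?subr_gt0// mulrAC ler_pdivlMr ?subr_gt0//.
  by have := ch y x z yx xz; lra.
have S0 : S !=set0 by exists ((F x - F (x - 1)) / (x - (x - 1))), (x - 1) => //=; lra.
have Sb : has_ubound S by exists ((F (x + 1) - F x) / (x + 1 - x)); apply: Sub; lra.
exists (sup S) => y; have [yx|xy|->] := ltgtP y x.
- have : (F x - F y) / (x - y) <= sup S by apply: ub_le_sup => //; exists y.
  rewrite ler_pdivrMr ?subr_gt0//; lra.
- have : sup S <= (F y - F x) / (y - x) by apply: ge_sup => //; exact: Sub.
  rewrite ler_pdivlMr ?subr_gt0//; lra.
- by rewrite subrr mulr0 addr0.
Qed.

(** Adding [C t^2 / 2] makes both [g] and [- g] convex. Their supporting lines at [x] enclose [g]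
    between two parabolas that meet at [x]; this forces equal slopes there, and the common slope is
    [G x]. *)
Lemma second_difference_derivative g C : 0 < C -> continuous g ->
  (forall x s, `|g (x + s) + g (x - s) - 2 * g x| <= C * s ^+ 2) ->
  exists G : R -> R, forall x y, `|g y - g x - G x * (y - x)| <= C * (y - x) ^+ 2.
Proof.
move=> C0 cg hg.
suff : forall x, exists a, forall y, `|g y - g x - a * (y - x)| <= C * (y - x) ^+ 2.
  by move=> /choice[G hG]; exists G.
move=> x.
have cq : continuous (fun t => C / 2 * (t * t)).
  by move=> t; apply: cvgM; [exact: cvg_cst|apply: cvgM].
have h1 z s : 0 <= (g (z + s) + C / 2 * ((z + s) * (z + s))) +
   (g (z - s) + C / 2 * ((z - s) * (z - s))) - 2 * (g z + C / 2 * (z * z)).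
  have := hg z s; rewrite ler_norml => /andP[+ _]; lra.
have h2 z s : 0 <= (- g (z + s) + C / 2 * ((z + s) * (z + s))) +
   (- g (z - s) + C / 2 * ((z - s) * (z - s))) - 2 * (- g z + C / 2 * (z * z)).
  have := hg z s; rewrite ler_norml => /andP[_]; lra.
have c1 : continuous (fun t => g t + C / 2 * (t * t)) by move=> t; apply: cvgD; [exact: cg|exact: cq].
have c2 : continuous (fun t => - g t + C / 2 * (t * t)).
  by move=> t; apply: cvgD; [apply: cvgN; exact: cg|exact: cq].
have [a ha] := midpoint_convex_support c1 h1 x.
have [b hb] := midpoint_convex_support c2 h2 x.
have key h : (a - C * x) * h - (C * x - b) * h <= C * h ^+ 2.
  have := ha (x + h); have := hb (x + h); rewrite (_ : x + h - x = h); [lra|ring].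
have ab : a - C * x = C * x - b.
  apply/eqP; rewrite -subr_eq0; apply/eqP; set d := _ - _.
  have {}key h : d * h <= C * h ^+ 2 by have := key h; rewrite /d; lra.
  (* At this [h] the inequality reads [d^2 / (2 C) <= d^2 / (4 C)], which forces [d = 0]. *)
  have := key (d / (2 * C)).
  have -> : d * (d / (2 * C)) = d ^+ 2 * (2 * C)^-1 by ring.
  have -> : C * (d / (2 * C)) ^+ 2 = d ^+ 2 * (2 * C)^-1 / 2 by field; rewrite gt_eqF.
  move=> h; have : d ^+ 2 * (2 * C)^-1 <= 0 by lra.
  rewrite pmulr_lle0 ?invr_gt0 ?mulr_gt0// => d2.
  by apply/eqP; rewrite -sqrf_eq0; apply/eqP/le_anti; rewrite d2 sqr_ge0.
exists (a - C * x) => y; have := ha y; have := hb y.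
have : 0 <= C * (y - x) ^+ 2 by rewrite mulr_ge0 ?sqr_ge0// ltW.
rewrite ler_norml => h0 hb' ha'; apply/andP; split; first lra.
by rewrite ab; lra.
Qed.

(** The increment of [g] from [x] to the reflected point [2 y - x] is expanded directly and through
    [y]; the errors add up to [4 + 1 + 1 = 6] times [C (y - x)^2]. *)
Lemma quadratic_bound_lipschitz g (G : R -> R) C :
  (forall x y, `|g y - g x - G x * (y - x)| <= C * (y - x) ^+ 2) ->
  forall x y, `|G x - G y| <= 6 * C * `|x - y|.
Proof.
move=> h x y; have [->|xy] := eqVneq x y; first by rewrite !subrr normr0 mulr0.
have d0 : 0 < `|y - x| by rewrite normr_gt0 subr_eq0 eq_sym.
have e2 : 6 * C * `|y - x| * `|y - x| = 6 * C * (y - x) ^+ 2.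
  by rewrite -[in RHS](real_normK (num_real (y - x))); ring.
rewrite (distrC x y) -(ler_pM2r d0) -normrM e2.
have := h x y; have := h y (2 * y - x); have := h x (2 * y - x).
have -> : 2 * y - x - y = y - x by ring.
have -> : 2 * y - x - x = 2 * (y - x) by ring.
rewrite !ler_norml => /andP[? ?] /andP[? ?] /andP[? ?]; apply/andP; split; lra.
Qed.

Lemma quadratic_bound_derive g (G : R -> R) C x :
  (forall x y, `|g y - g x - G x * (y - x)| <= C * (y - x) ^+ 2) ->
  is_derive x 1 g (G x).
Proof.
move=> h; have C0 : 0 <= C.
  by have := h 0 1; rewrite subr0 expr1n !mulr1; move=> k; exact: le_trans (normr_ge0 _) k.
have C1 : 0 < C + 1 by rewrite ltr_wpDl.
have cv : (fun t : R => t^-1 *: (g (t *: 1 + x) - g x)) @ 0^' --> G x.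
  apply/cvgrPdist_lt => e e0; near=> t.
  have t0 : t != 0 by near: t; exact: nbhs_dnbhs_neq.
  have tn0 : 0 < `|t| by rewrite normr_gt0.
  rewrite /GRing.scale /= mulr1 -(ltr_pM2l tn0) -normrM.
  have -> : t * (G x - t^-1 * (g (t + x) - g x)) = - (g (t + x) - g x - G x * (t + x - x)).
    by field.
  rewrite normrN; apply: le_lt_trans (h _ _) _.
  rewrite addrK -real_normK ?num_real// expr2 mulrCA ltr_pM2l//.
  apply: (@le_lt_trans _ _ ((C + 1) * `|t|)); first by rewrite ler_wpM2r// lerDl.
  rewrite -ltr_pdivlMl//; near: t; apply: dnbhs0_lt.
  by rewrite mulr_gt0// invr_gt0.
apply: DeriveDef; first by apply/cvg_ex; exists (G x).
exact: cvg_lim.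
Unshelve. all: by end_near.
Qed.

End SecondDifferences.

(** * Quadratic bound for the height of caps *)

Section CapHeight.
Context {R : realType}.
Implicit Types (x y z : R * R) (t s a b d : R).
Variables (Omega : set (R * R)) (r M : R).
Hypotheses (cO : compact Omega) (vO : cvx Omega) (r0 : 0 < r) (M0 : 0 < M).
Hypotheses (Or : forall x, euclid x <= r -> Omega x) (OM : forall x, Omega x -> euclid x <= M).
Hypothesis cheeger : forall K, body K -> K `<=` Omega -> perim Omega * area K <= perim K * area Omega.
Local Notation j := (minkowski Omega).

(** [det X Y / |Y - X|] is the distance from the origin to the chord line; with [d] below it, [C] is
    uniform over chords. For the maximum [1 + n] of the form on [Omega], the length saved is at most
    [c n w] but, by [two_sides_ge], large in terms of the height; one factor [n] cancels and
    [n = O(w^2)] remains. *)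
Lemma cap_height d : 0 < d -> exists2 C, 0 < C & forall X Y z, j X = 1 -> j Y = 1 ->
  0 < det X Y -> d * euclid (Y - X) <= det X Y -> Omega z ->
  det z (chord X Y) <= 1 + C * euclid (Y - X) ^+ 2.
Proof.
move=> d0.
pose q := `|perim Omega / area Omega|.
(* [m] is an a priori bound for [n], from [d w n <= D n <= 2 M w], and [c n w] bounds the right side
   of [cut_inequality]. *)
pose m := 2 * M / d; pose c := 4 * q * M * (1 + m).
have m0 : 0 < m by rewrite divr_gt0// mulr_gt0.
have q0 : 0 <= q by exact: normr_ge0.
have c0 : 0 <= c by rewrite !mulr_ge0// ?(ltW M0)// addr_ge0// ltW.
have d20 : 0 < 4 * d ^+ 2 by rewrite mulr_gt0// exprn_gt0.
exists ((2 * c + c ^+ 2 * m) / (4 * d ^+ 2) + 1).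
  by rewrite ltr_wpDl// divr_ge0 ?(ltW d20)// addr_ge0// mulr_ge0// ?exprn_ge0// ltW.
move=> X Y z jX jY D0 dD Oz.
have [Z OZ Zmax] : exists2 Z, Omega Z & forall z, Omega z -> det z (chord X Y) <= det Z (chord X Y).
  apply: compact_max_point => //; first by exists z.
  apply: (@lipschitz_continuous _ _ (euclid (chord X Y))) => u v.
  by rewrite det_subl mulrC; exact: normr_det_le.
set w := euclid (Y - X) in dD *; have w0 : 0 <= w by exact: euclid_ge0.
apply: le_trans (Zmax z Oz) _.
have [l1|Z1] := leP (det Z (chord X Y)) 1.
  apply: le_trans l1 _; rewrite lerDl mulr_ge0 ?exprn_ge0//.
  by rewrite addr_ge0// divr_ge0 ?(ltW d20)// addr_ge0// mulr_ge0// ?exprn_ge0// ltW.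
have ci := cut_inequality cO vO r0 M0 Or OM cheeger jX jY OZ D0 Zmax Z1.
have wp : 0 < w.
  rewrite euclid_gt0// subr_eq0; apply/eqP => YX; move: D0.
  by rewrite YX (_ : det X X = 0) ?ltxx// /det; ring.
set D := det X Y in D0 dD.
pose n := det Z (chord X Y) - 1; have n0 : 0 < n by rewrite subr_gt0.
have lZ : det Z (chord X Y) = 1 + n by rewrite /n; ring.
have Dn : det (Z - X) (Y - X) = D * n.
  by rewrite /n /chord /D /det /= /GRing.scale /=; field; rewrite gt_eqF.
have OX : Omega X by apply/(minkowski_le1 cO vO r0 M0 Or OM); rewrite jX.
have hm : n <= m.
  rewrite /m ler_pdivlMr// -(ler_pM2l wp).
  apply: (@le_trans _ _ (D * n)); first by have := ler_wpM2r (ltW n0) dD; lra.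
  rewrite -Dn; apply: le_trans (ler_norm _) _; apply: le_trans (normr_det_le _ _) _.
  rewrite -/w mulrC ler_pM2l//; apply: le_trans (euclidD _ _) _.
  by rewrite euclidN mulr_natl mulr2n lerD// OM.
rewrite -/w lZ (_ : 1 + n - 1 = n) in ci; last by ring.
have hp : euclid (Z - X) + euclid (Y - Z) <= w * (1 + c * n).
  have hX := OM OX; have eX := euclid_ge0 X.
  have : perim Omega / area Omega * (4 * (n * euclid X) * ((1 + n) * w)) <= q * (4 * (n * M) * ((1 + m) * w)).
    apply: (@le_trans _ _ (q * (4 * (n * euclid X) * ((1 + n) * w)))).
      rewrite ler_wpM2r ?ler_norm// !mulr_ge0// ?(ltW n0)// addr_ge0// ltW//.
    rewrite ler_wpM2l//; apply: ler_pM.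
    - by rewrite !mulr_ge0// ltW.
    - by rewrite mulr_ge0// addr_ge0// ltW.
    - by rewrite ler_pM2l// ler_pM2l.
    - by rewrite ler_wpM2r// lerD2l.
  by rewrite /c; move: ci; clear; move: (perim _ / _ * _) => P; lra.
have ts := two_sides_ge (Z - X) (Y - Z).
have e1 : Z - X + (Y - Z) = Y - X by rewrite addrC addrA subrK.
rewrite e1 -/w Dn in ts.
have hp2 : (euclid (Z - X) + euclid (Y - Z)) ^+ 2 <= (w * (1 + c * n)) ^+ 2.
  rewrite ler_sqr ?nnegrE ?addr_ge0 ?euclid_ge0//.
  by rewrite mulr_ge0// addr_ge0// mulr_ge0// ltW.
have k1 : 4 * (D * n) ^+ 2 <= w ^+ 4 * (2 * (c * n) + (c * n) ^+ 2).
  have := ler_wpM2l (sqr_ge0 w) hp2; lra.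
have k2 : 4 * D ^+ 2 * n <= w ^+ 4 * (2 * c + c ^+ 2 * m).
  rewrite -(ler_pM2r n0).
  have -> : 4 * D ^+ 2 * n * n = 4 * (D * n) ^+ 2 by ring.
  apply: le_trans k1 _.
  have -> : w ^+ 4 * (2 * (c * n) + (c * n) ^+ 2) = w ^+ 4 * (2 * c + c ^+ 2 * n) * n by ring.
  by rewrite ler_pM2r// ler_pM2l ?exprn_gt0// lerD2l ler_wpM2l ?exprn_ge0.
have k3 : (d * w) ^+ 2 <= D ^+ 2 by rewrite ler_sqr ?nnegrE ?mulr_ge0// ltW.
have k4 : 4 * d ^+ 2 * n <= w ^+ 2 * (2 * c + c ^+ 2 * m).
  have w20 : 0 < w ^+ 2 by rewrite exprn_gt0.
  rewrite -(ler_pM2l w20).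
  have -> : w ^+ 2 * (4 * d ^+ 2 * n) = 4 * (d * w) ^+ 2 * n by ring.
  have -> : w ^+ 2 * (w ^+ 2 * (2 * c + c ^+ 2 * m)) = w ^+ 4 * (2 * c + c ^+ 2 * m) by ring.
  by apply: le_trans k2; rewrite ler_pM2r// ler_pM2l.
rewrite lZ lerD2l mulrDl mul1r; apply: (@le_trans _ _ (w ^+ 2 * (2 * c + c ^+ 2 * m) / (4 * d ^+ 2))).
  by rewrite ler_pdivlMr// mulrC.
by rewrite [X in X <= _](_ : _ = (2 * c + c ^+ 2 * m) / (4 * d ^+ 2) * w ^+ 2) ?lerDl ?sqr_ge0//; ring.
Qed.

End CapHeight.

(** * Unit vectors by angle and elementary trigonometric bounds *)

Section Directions.
Context {R : realType}.
Implicit Types (t s a b u : R).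

Definition dir t : R * R := (cos t, sin t).

Lemma euclid_dir t : euclid (dir t) = 1.
Proof. by rewrite /euclid /= cos2Dsin2 sqrtr1. Qed.

Lemma dirD t s : dir (t + s) + dir (t - s) = (2 * cos s) *: dir t.
Proof. by congr pair; rewrite /= /GRing.scale /= ?(cosD t s) ?cosB ?(sinD t s) ?sinB; ring. Qed.

Lemma det_dir a b : det (dir a) (dir b) = sin (b - a).
Proof. by rewrite /det /= sinB; ring. Qed.

Lemma sin_MVT t : 0 < t -> exists2 s, 0 < s < t & sin t = cos s * t.
Proof.
move=> t0; have [|s + h] := @MVT R sin cos 0 t t0 (fun x _ => is_derive_sin x).
  by apply: continuous_subspaceT => x; exact: continuous_sin.
by rewrite in_itv /=; exists s => //; move: h; rewrite sin0 !subr0.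
Qed.

Lemma normr_sin_le t : `|sin t| <= `|t|.
Proof.
have key u : 0 < u -> `|sin u| <= `|u|.
  move=> /sin_MVT[s _ ->]; rewrite normrM ler_piMl//; exact: cos_max.
have [t0|t0|->] := ltgtP t 0; [|exact: key|by rewrite sin0].
by have := key (- t); rewrite sinN !normrN oppr_gt0; apply.
Qed.

(** By the half-angle formula, [cos t = 1 - 2 sin^2 (t / 2)]. *)
Lemma cos_ge t : 1 - t ^+ 2 / 2 <= cos t.
Proof.
pose u := t / 2; have tu : t = u + u by rewrite /u; lra.
have h : sin u ^+ 2 <= u ^+ 2.
  by rewrite -(real_normK (num_real (sin _))) -(real_normK (num_real u)) ler_sqr ?nnegrE// normr_sin_le.
rewrite tu cosD; have := cos2Dsin2 u; lra.
Qed.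

Lemma sin_ge t : 0 <= t -> t <= 1 -> t / 2 <= sin t.
Proof.
rewrite le_eqVlt => /predU1P[<- _|t0 t1]; first by rewrite sin0 mul0r.
have [s /andP[s0 st] ->] := sin_MVT t0.
rewrite mulrC ler_pM2r//; apply: le_trans (cos_ge s); nra.
Qed.

(** The square of the left side is [2 - 2 cos (a - b)]. *)
Lemma dir_lipschitz a b : euclid (dir a - dir b) <= `|a - b|.
Proof.
rewrite le_euclid ?normr_ge0// real_normK ?num_real//=.
have := cos_ge (a - b); rewrite cosB.
have := cos2Dsin2 a; have := cos2Dsin2 b.
by move=> h1 h2 h3; nra.
Qed.

Lemma dir_surjective (x : R * R) : euclid x = 1 -> exists t, x = dir t.
Proof.
move=> x1; have := sqr_euclid x; rewrite x1 expr1n => h.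
have hx : -1 <= x.1 <= 1 by rewrite -ler_norml -x1 norm1_le_euclid.
have hx' : x.1 \in `[-1, 1] by rewrite in_itv.
have sq : Num.sqrt (1 - x.1 ^+ 2) = `|x.2|.
  by rewrite (_ : 1 - x.1 ^+ 2 = x.2 ^+ 2) ?sqrtr_sqr//; lra.
have [x2|x2] := leP 0 x.2.
  exists (acos x.1); rewrite [LHS]surjective_pairing /dir acosK// sin_acos// sq ger0_norm//.
exists (- acos x.1); rewrite [LHS]surjective_pairing /dir cosN sinN acosK// sin_acos// sq ltr0_norm// opprK//.
Qed.

Lemma dir_injective a b : 0 <= a < pi *+ 2 -> 0 <= b < pi *+ 2 -> dir a = dir b -> a = b.
Proof.
wlog ab : a b / a < b => [hw ha hb e|/andP[a0 a1] /andP[b0 b1] [ec es]].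
  by have [h|h|//] := ltgtP a b; [exact: hw|apply/esym/hw].
have := cosB b a; rewrite ec es -!expr2 cos2Dsin2.
pose h := (b - a) / 2; have -> : b - a = h + h by rewrite /h; lra.
rewrite cosD => eh; have := cos2Dsin2 h => e1.
have : 0 < sin h.
  apply: sin_gt0_pi; rewrite mulr2n in a1 b1; rewrite /h; apply/andP; split; lra.
move=> /lt0r_neq0; rewrite -sqrf_eq0; have -> : sin h ^+ 2 = 0 by lra.
by rewrite eqxx.
Qed.

End Directions.

Section BoundedLipschitz.
Context {R : realType}.
Implicit Types (f g : R -> R).

(** Boundedness is included to make the class stable under products; one constant serves for both
    bounds. *)
Definition bounded_lipschitz f := exists2 k, 0 <= k &
  forall x y, `|f x| <= k /\ `|f x - f y| <= k * `|x - y|.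

Lemma bounded_lipschitzM f g : bounded_lipschitz f -> bounded_lipschitz g ->
  bounded_lipschitz (fun x => f x * g x).
Proof.
move=> [k k0 hf] [l l0 hg]; exists (2 * (k * l)); first by rewrite !mulr_ge0.
move=> x y; have [fx fxy] := hf x y; have [gx gxy] := hg x y; have [gy _] := hg y x.
split.
  rewrite normrM; apply: le_trans (ler_pM _ _ fx gx) _ => //.
  by rewrite ler_peMl ?mulr_ge0// ler1n.
have -> : f x * g x - f y * g y = f x * (g x - g y) + (f x - f y) * g y by ring.
apply: le_trans (ler_normD _ _) _; rewrite !normrM.
have := ler_pM (normr_ge0 _) (normr_ge0 _) fx gxy.
have := ler_pM (normr_ge0 _) (normr_ge0 _) fxy gy.
lra.
Qed.

Lemma bounded_lipschitzD f g : bounded_lipschitz f -> bounded_lipschitz g ->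
  bounded_lipschitz (fun x => f x + g x).
Proof.
move=> [k k0 hf] [l l0 hg]; exists (k + l); first by rewrite addr_ge0.
move=> x y; have [fx fxy] := hf x y; have [gx gxy] := hg x y.
split; first by apply: le_trans (ler_normD _ _) _; exact: lerD.
rewrite opprD addrACA mulrDl; apply: le_trans (ler_normD _ _) _; exact: lerD.
Qed.

Lemma bounded_lipschitzN f : bounded_lipschitz f -> bounded_lipschitz (fun x => - f x).
Proof.
move=> [k k0 hf]; exists k => // x y; have [fx fxy] := hf x y.
by rewrite -opprD !normrN.
Qed.

Lemma bounded_lipschitz_cos : bounded_lipschitz (@cos R).
Proof.
exists 1 => // x y; split; first exact: cos_max.
by rewrite mul1r; apply: le_trans (dir_lipschitz x y); have := norm1_le_euclid (dir x - dir y).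
Qed.

Lemma bounded_lipschitz_sin : bounded_lipschitz (@sin R).
Proof.
exists 1 => // x y; split; first exact: sin_max.
by rewrite mul1r; apply: le_trans (dir_lipschitz x y); have := norm2_le_euclid (dir x - dir y).
Qed.

Lemma is_derive_pair f g (x df dg : R) : is_derive x 1 f df -> is_derive x 1 g dg ->
  is_derive x 1 (fun t => (f t, g t) : R * R) (df, dg).
Proof.
move=> hf hg.
have cf : (fun t : R => t^-1 *: (f (t *: 1 + x) - f x)) @ 0^' --> df.
  by rewrite -(@derive_val _ _ _ _ _ _ _ hf); exact: (@ex_derive _ _ _ _ _ _ _ hf).
have cg : (fun t : R => t^-1 *: (g (t *: 1 + x) - g x)) @ 0^' --> dg.
  by rewrite -(@derive_val _ _ _ _ _ _ _ hg); exact: (@ex_derive _ _ _ _ _ _ _ hg).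
have c := cvg_pair cf cg.
have h : (fun t : R => t^-1 *: (((f (t *: 1 + x), g (t *: 1 + x)) : R * R) - (f x, g x))) @ 0^' --> ((df, dg) : R * R).
  exact: c.
apply: DeriveDef; first by apply/cvg_ex; exists (df, dg).
exact: cvg_lim.
Qed.

End BoundedLipschitz.

(** * Regularity of the gauge on the circle and polar parameterization *)

Section Polar.
Context {R : realType}.
Implicit Types (x y z : R * R) (t s a b d : R).
Variables (Omega : set (R * R)) (r M : R).
Hypotheses (cO : compact Omega) (vO : cvx Omega) (r0 : 0 < r) (M0 : 0 < M).
Hypotheses (Or : forall x, euclid x <= r -> Omega x) (OM : forall x, Omega x -> euclid x <= M).
Hypothesis cheeger : forall K, body K -> K `<=` Omega -> perim Omega * area K <= perim K * area Omega.
Local Notation j := (minkowski Omega).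
Let g t : R := j (dir t).

Let gM t : M^-1 <= g t.
Proof.
have := euclid_le_minkowski vO r0 M0 Or OM (dir t); rewrite euclid_dir -/(g t) => h.
by rewrite -(ler_pM2l M0) mulfV ?gt_eqF.
Qed.

Let g0 t : 0 < g t.
Proof. by apply: lt_le_trans (gM t); rewrite invr_gt0. Qed.

Let gr t : g t <= r^-1.
Proof. by have := minkowski_le_euclid r0 Or (dir t); rewrite euclid_dir mul1r. Qed.

Let uM t : (g t)^-1 <= M.
Proof. by rewrite -(invrK M) lef_pV2 ?posrE ?invr_gt0// gM. Qed.

Let g_lipschitz s t : `|g s - g t| <= r^-1 * `|s - t|.
Proof.
apply: le_trans (minkowski_lipschitz vO r0 Or _ _) _.
by rewrite mulrC ler_wpM2l ?invr_ge0 ?(ltW r0)// dir_lipschitz.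
Qed.

Let u_lipschitz s t : `|(g s)^-1 - (g t)^-1| <= M ^+ 2 / r * `|s - t|.
Proof.
have -> : (g s)^-1 - (g t)^-1 = (g t - g s) * ((g s)^-1 * (g t)^-1).
  by field; rewrite (lt0r_neq0 (g0 s)) (lt0r_neq0 (g0 t)).
have u0 a : 0 <= (g a)^-1 by rewrite invr_ge0 ltW.
rewrite normrM (ger0_norm (mulr_ge0 (u0 s) (u0 t))).
rewrite distrC expr2 (_ : M * M / r * `|s - t| = r^-1 * `|s - t| * (M * M)); last by ring.
by apply: ler_pM => //; [exact: mulr_ge0|exact: ler_pM].
Qed.

Let point t : R * R := (g t)^-1 *: dir t.

Let j_point t : j (point t) = 1.
Proof.
by rewrite /point (minkowskiZ vO r0 Or) ?invr_gt0// mulVf// gt_eqF.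
Qed.

Let point_lipschitz s t : euclid (point s - point t) <= (M + M ^+ 2 / r) * `|s - t|.
Proof.
have -> : point s - point t = (g s)^-1 *: (dir s - dir t) + ((g s)^-1 - (g t)^-1) *: dir t.
  by rewrite /point; congr pair; rewrite /= /GRing.scale /=; ring.
apply: le_trans (euclidD _ _) _; rewrite !euclidZ euclid_dir mulr1 mulrDl; apply: lerD => //.
apply: ler_pM; rewrite ?euclid_ge0 ?dir_lipschitz// ger0_norm ?uM// invr_ge0 ltW//.
Qed.

(** All follows from [2 cos s dir t = g (t - s) X + g (t + s) Y]: sublinearity of the gauge gives
    the lower bound, and the linear form of the chord, with [cap_height] at [point t], the upper
    one. Replacing [cos s] by 1 costs at most [s^2 / 2]. *)
Lemma second_difference_small : exists2 C, 0 < C & forall t s, 0 < s -> s <= 2^-1 ->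
  `|g (t + s) + g (t - s) - 2 * g t| <= C * s ^+ 2.
Proof.
(* [point] has Lipschitz constant [W / 2], so [|Y - X| <= W s], while
   [det X Y >= r^2 sin (2 s) >= r^2 s]; this is why [d] is [r^2 / W]. The bound [s <= 1/2] brings
   [2 s] into the range of [sin_ge]. *)
pose W := 2 * (M + M ^+ 2 / r).
have W0 : 0 < W by rewrite mulr_gt0// addr_gt0// divr_gt0// exprn_gt0.
have d0 : 0 < r ^+ 2 / W by rewrite divr_gt0// exprn_gt0.
have [C C0 hC] := cap_height cO vO r0 M0 Or OM cheeger d0.
exists (2 * r^-1 * (C * W ^+ 2) + r^-1).
  have rV0 : 0 < r^-1 by rewrite invr_gt0.
  by apply: addr_gt0 => //; apply: mulr_gt0; apply: mulr_gt0 => //; exact: exprn_gt0.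
move=> t s s0 s1; set X := point (t - s); set Y := point (t + s).
have rV0 : 0 < r^-1 by rewrite invr_gt0.
have ss0 : 0 <= s ^+ 2 by exact: sqr_ge0.
have cs := cos_ge s; have c1 := cos_le1 s.
have c0 : 0 < cos s by apply: lt_le_trans cs; nra.
have XY : euclid (Y - X) <= W * s.
  apply: le_trans (point_lipschitz _ _) _.
  rewrite (_ : t + s - (t - s) = 2 * s); last by ring.
  by rewrite gtr0_norm ?mulr_gt0// /W; lra.
have sin2s : s <= sin (2 * s) by have := @sin_ge R (2 * s); lra.
have DE : det X Y = (g (t - s))^-1 * (g (t + s))^-1 * sin (2 * s).
  rewrite (_ : 2 * s = t + s - (t - s)); last by ring.
  by rewrite -det_dir /X /Y /point /det /= /GRing.scale /=; ring.
have rg a : r <= (g a)^-1 by rewrite -(invrK r) lef_pV2 ?posrE// gr.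
have Dr : r ^+ 2 * s <= det X Y.
  rewrite DE expr2; apply: ler_pM => //; [by apply: mulr_ge0; exact: ltW|exact: ltW|].
  by apply: ler_pM => //; exact: ltW.
have D0 : 0 < det X Y by apply: lt_le_trans Dr; rewrite mulr_gt0// exprn_gt0.
have Dd : r ^+ 2 / W * euclid (Y - X) <= det X Y.
  apply: le_trans Dr; rewrite mulrAC ler_pdivrMr//.
  by have := ler_wpM2l (sqr_ge0 r) XY; rewrite (mulrC W) mulrA.
have Op : Omega (point t) by apply/(minkowski_le1 cO vO r0 M0 Or OM); rewrite j_point.
have h := hC X Y (point t) (j_point _) (j_point _) D0 Dd Op.
have e2 : (2 * cos s) * g t * det (point t) (chord X Y) = g (t - s) + g (t + s).
  have -> : (2 * cos s) * g t * det (point t) (chord X Y) = det ((2 * cos s) *: dir t) (chord X Y).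
    rewrite /point; move: (chord X Y) (gt_eqF (g0 t)) => v /negbT gn0.
    by rewrite /det /= /GRing.scale /=; field.
  have eX : dir (t - s) = g (t - s) *: X by rewrite /X /point scalerA mulfV ?scale1r// gt_eqF.
  have eY : dir (t + s) = g (t + s) *: Y by rewrite /Y /point scalerA mulfV ?scale1r// gt_eqF.
  rewrite -dirD eX eY det_linearl det_chordl ?gt_eqF// det_chordr ?gt_eqF//; ring.
have w2 : euclid (Y - X) ^+ 2 <= W ^+ 2 * s ^+ 2.
  by rewrite -exprMn ler_sqr ?nnegrE ?euclid_ge0//; apply: mulr_ge0; exact: ltW.
have h' : det (point t) (chord X Y) <= 1 + C * W ^+ 2 * s ^+ 2.
  by apply: le_trans h _; rewrite lerD2l -mulrA ler_pM2l.
have lower : 2 * cos s * g t <= g (t + s) + g (t - s).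
  have c20 : 0 < 2 * cos s by rewrite mulr_gt0.
  by rewrite -(minkowskiZ vO r0 Or _ c20) -dirD; exact: (minkowskiD vO r0 Or).
have K0 : 0 <= C * W ^+ 2 * s ^+ 2.
  by apply: mulr_ge0 => //; apply: mulr_ge0; [exact: ltW|exact: sqr_ge0].
move: (g0 t) (gr t) lower e2 h'.
move: (g t) (g (t + s)) (g (t - s)) (det (point t) _) => G G1 G2 l G0 Gr lower e2 h'.
have up : G1 + G2 <= 2 * G * (1 + C * W ^+ 2 * s ^+ 2).
  rewrite addrC -e2; apply: (@le_trans _ _ (2 * cos s * G * (1 + C * W ^+ 2 * s ^+ 2))).
    by rewrite ler_pM2l// !mulr_gt0.
  by rewrite ler_wpM2r ?addr_ge0// ler_pM2r//; lra.
have up2 : 2 * G * (C * W ^+ 2 * s ^+ 2) <= 2 * r^-1 * (C * W ^+ 2 * s ^+ 2).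
  by rewrite ler_wpM2r//; lra.
have lo2 : G * s ^+ 2 <= r^-1 * s ^+ 2 by rewrite ler_wpM2r.
have lo3 : G * (1 - s ^+ 2 / 2) <= G * cos s by rewrite ler_pM2l.
have K1 : 0 <= r^-1 * s ^+ 2 by apply: mulr_ge0 => //; exact: ltW.
have K2 : 0 <= 2 * r^-1 * (C * W ^+ 2 * s ^+ 2).
  by apply: mulr_ge0 => //; apply: mulr_ge0 => //; exact: ltW.
rewrite mulrDl ler_norml; apply/andP; split; first by lra.
lra.
Qed.

(** For [s > 1/2] the values of [g] between 0 and [1 / r] suffice, as [4 / r <= 16 s^2 / r];
    negative [s] follow by symmetry. *)
Lemma second_difference : exists2 C, 0 < C & forall t s,
  `|g (t + s) + g (t - s) - 2 * g t| <= C * s ^+ 2.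
Proof.
have [C C0 hC] := second_difference_small; exists (C + 16 / r).
  by rewrite addr_gt0// divr_gt0.
have key t s : 0 < s -> `|g (t + s) + g (t - s) - 2 * g t| <= (C + 16 / r) * s ^+ 2.
  move=> s0; have ss0 : 0 <= s ^+ 2 by exact: sqr_ge0.
  have rV0 : 0 < r^-1 by rewrite invr_gt0.
  have [s1|s1] := leP s 2^-1.
    by apply: le_trans (hC t s s0 s1) _; rewrite ler_wpM2r// lerDl divr_ge0// ltW.
  have q : 1 / 4 <= s ^+ 2 by nra.
  have q2 : 4 * r^-1 <= 16 / r * s ^+ 2 by have := ler_wpM2l (ltW rV0) q; lra.
  have q3 : 0 <= C * s ^+ 2 by rewrite mulr_ge0// ltW.
  have := g0 (t + s); have := g0 (t - s); have := g0 t.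
  have := gr (t + s); have := gr (t - s); have := gr t.
  by move=> *; rewrite mulrDl ler_norml; apply/andP; split; lra.
move=> t s; have [s0|s0|->] := ltgtP s 0.
- by have := key t (- s); rewrite oppr_gt0 sqrrN opprK (addrC (g (t - s))); exact.
- exact: key.
- by rewrite addr0 subr0 expr0n mulr0 (_ : _ - _ = 0) ?normr0//; ring.
Qed.

(** The radius [u = 1 / g] has derivative [- u^2 G], so the velocity is a polynomial in [u], [G],
    [cos] and [sin], all bounded and Lipschitz. The translation by [c] will undo the centering of
    the body. *)
Lemma polar_parameterization c : exists gamma L,
  C11_closed_parameterization (sim 1 c @` boundary Omega) gamma L.
Proof.
have [C C0 hC] := second_difference.
have cg : continuous g.
  move=> t; apply/cvgrPdist_lt => e e0.
  have er : 0 < r * e by rewrite mulr_gt0.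
  have nt : nbhs t [set s | `|t - s| < r * e]
    by apply/nbhs_ballP; exists (r * e) => // s; rewrite -ball_normE.
  suff : nbhs t [set s | `|g t - g s| < e] by [].
  apply: filterS nt => s ts.
  by apply: le_lt_trans (g_lipschitz _ _) _; rewrite ltr_pdivrMl.
have [G hG] := second_difference_derivative C0 cg hC.
have dg t : is_derive t 1 g (G t) by exact: quadratic_bound_derive hG.
pose u t := (g t)^-1.
pose d1 t := - (u t * u t * G t) * cos t - u t * sin t.
pose d2 t := - (u t * u t * G t) * sin t + u t * cos t.
pose gamma t : R * R := (u t * cos t + c.1, u t * sin t + c.2).
have gammaE t : gamma t = sim 1 c (point t).
  by rewrite /gamma /sim /point; congr pair; rewrite /= /GRing.scale /= mul1r.
have du t : is_derive t 1 u (- (u t * u t * G t)).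
  have h := @is_deriveV R g t (G t) 1 (lt0r_neq0 (g0 t)) (dg t).
  by rewrite (_ : - (u t * u t * G t) = - g t ^- 2 *: G t) // /u /GRing.scale /= mulNr -invfM -expr2.
have dgamma t : is_derive t 1 gamma (d1 t, d2 t).
  apply: is_derive_pair.
    have h := is_deriveD (is_deriveM (du t) (is_derive_cos t)) (is_derive_cst c.1 t 1).
    by apply: is_derive_eq h _; rewrite /d1 /GRing.scale /= addr0; ring.
  have h := is_deriveD (is_deriveM (du t) (is_derive_sin t)) (is_derive_cst c.2 t 1).
  by apply: is_derive_eq h _; rewrite /d2 /GRing.scale /= addr0; ring.
have dE : derive1 gamma = fun t => (d1 t, d2 t).
  by apply/funext => t; rewrite derive1E; apply: derive_val.
have blu : bounded_lipschitz u.
  exists (M + M ^+ 2 / r); first by rewrite addr_ge0 ?divr_ge0 ?exprn_ge0 ?ltW.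
  move=> s t; split.
    rewrite ger0_norm ?invr_ge0 ?(ltW (g0 s))//; apply: le_trans (uM s) _.
    by rewrite lerDl divr_ge0 ?exprn_ge0 ?ltW.
  by apply: le_trans (u_lipschitz _ _) _; rewrite ler_wpM2r// lerDr ltW.
(* The bound on [G] comes from [hG] with a step of length 1 and the Lipschitz bound for [g]. *)
have blG : bounded_lipschitz G.
  exists (6 * C + r^-1); first by rewrite addr_ge0 ?invr_ge0 ?mulr_ge0 ?ltW.
  move=> s t; split; last first.
    apply: le_trans (quadratic_bound_lipschitz hG s t) _.
    by rewrite ler_wpM2r// lerDl invr_ge0 ltW.
  have h1 := hG s (s + 1); have h2 := g_lipschitz (s + 1) s.
  have e1 : s + 1 - s = 1 by ring.
  rewrite e1 expr1n !mulr1 in h1; rewrite e1 normr1 mulr1 in h2.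
  by move: h1 h2; rewrite !ler_norml => /andP[? ?] /andP[? ?]; apply/andP; split; lra.
have bl1 : bounded_lipschitz d1.
  apply: bounded_lipschitzD.
    apply: bounded_lipschitzM; last exact: bounded_lipschitz_cos.
    by apply/bounded_lipschitzN/bounded_lipschitzM => //; exact: bounded_lipschitzM.
  by apply/bounded_lipschitzN/bounded_lipschitzM => //; exact: bounded_lipschitz_sin.
have bl2 : bounded_lipschitz d2.
  apply: bounded_lipschitzD.
    apply: bounded_lipschitzM; last exact: bounded_lipschitz_sin.
    by apply/bounded_lipschitzN/bounded_lipschitzM => //; exact: bounded_lipschitzM.
  by apply: bounded_lipschitzM => //; exact: bounded_lipschitz_cos.
have [k1 k10 hk1] := bl1; have [k2 k20 hk2] := bl2.
have lip s t : `|derive1 gamma s - derive1 gamma t| <= (k1 + k2) * `|s - t|.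
  rewrite dE prod_normE ge_max /=; apply/andP; split.
    by apply: le_trans (hk1 s t).2 _; rewrite ler_wpM2r// lerDl.
  by apply: le_trans (hk2 s t).2 _; rewrite ler_wpM2r// lerDr.
exists gamma, (pi *+ 2); split; split.
- by rewrite mulr2n addr_gt0// pi_gt0.
- by move=> t; rewrite /gamma /u /g /dir cosD2pi sinD2pi.
- move=> s t; rewrite !in_itv/= => hs ht; rewrite !gammaE /sim => /addIr; rewrite !scale1r => e.
  have eg : (g s)^-1 = (g t)^-1.
    have := congr1 euclid e; rewrite /point !euclidZ !euclid_dir !mulr1 !ger0_norm// invr_ge0 ltW//.
  apply: dir_injective => //; move: e; rewrite /point eg => /(congr1 (fun z => g t *: z)).
  by rewrite !scalerA mulfV ?scale1r// gt_eqF.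
- apply/seteqP; split => x.
    move=> [t _ <-]; rewrite gammaE; exists (point t) => //.
    by apply/(boundary_minkowski cO vO r0 M0 Or OM); exact: j_point.
  move=> [y /(boundary_minkowski cO vO r0 M0 Or OM) jy <-].
  have y0 : 0 < euclid y.
    rewrite lt_neqAle euclid_ge0 andbT eq_sym; apply/eqP => y0.
    by have := minkowski_le_euclid r0 Or y; rewrite y0 mul0r jy ler10.
  have y0n := lt0r_neq0 y0; have yV0 : 0 < (euclid y)^-1 by rewrite invr_gt0.
  have y1 : euclid ((euclid y)^-1 *: y) = 1 by rewrite euclidZ gtr0_norm// mulVf.
  have [t yt] := dir_surjective y1.
  exists t => //; rewrite gammaE; congr sim.
  by rewrite /point /g -yt (minkowskiZ vO r0 Or)// jy mulr1 invrK scalerA mulfV// scale1r.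
- by move=> t; case: (dgamma t).
- move=> t; apply/cvgrPdist_lt => e e0.
  have k0 : 0 < k1 + k2 + 1 by rewrite ltr_wpDl// addr_ge0.
  have ek : 0 < (k1 + k2 + 1)^-1 * e by rewrite mulr_gt0// invr_gt0.
  have nt : nbhs t [set s | `|t - s| < (k1 + k2 + 1)^-1 * e].
    by apply/nbhs_ballP; exists ((k1 + k2 + 1)^-1 * e) => // s; rewrite -ball_normE.
  suff : nbhs t [set s | `|derive1 gamma t - derive1 gamma s| < e] by [].
  apply: filterS nt => s ts.
  apply: le_lt_trans (lip _ _) _.
  apply: (@le_lt_trans _ _ ((k1 + k2 + 1) * `|t - s|)); first by rewrite ler_wpM2r// lerDl.
  by rewrite -ltr_pdivlMl.
- apply: (@klipschitzW _ _ _ (k1 + k2)).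
    exact: (@globally_properfilter _ _ (0, 0)).
  by move=> [s t] _ /=; exact: lip.
- move=> t; rewrite dE; apply/eqP => -[e1 e2].
  (* The component of the velocity orthogonal to the radius is [u], which is positive. *)
  have : cos t * d2 t - sin t * d1 t = u t.
    by rewrite /d1 /d2 -[RHS]mulr1 -(cos2Dsin2 t); ring.
  rewrite e1 e2 !mulr0 subrr => /esym/eqP; rewrite invr_eq0 gt_eqF//.
Qed.

End Polar.

Lemma minimizer_C11 (R : realType) (p lambda : R) (Omega : set (R * R)) :
  1 <= p -> 0 < lambda -> minimizer p lambda Omega -> C11_regular Omega.
Proof.
move=> p1 l0 mO; have p0 : 0 <= p by lra.
have [bO _] := (minimizerP _ _ p0).1 mO.
have [c Oc [r r0 hr]] := body_ball bO.
pose K := sim 1 (- c) @` Omega.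
have mK : minimizer p lambda K by exact: minimizer_sim.
have [bK _] := (minimizerP _ _ p0).1 mK; have [cK vK _] := bK.
have [M M0 hM] := body_bounded bK.
(* Half the radius, since the disk of [body_ball] is open and the gauge lemmas ask for a closed
   one. *)
have r20 : 0 < r / 2 by rewrite divr_gt0.
have Kr x : euclid x <= r / 2 -> K x.
  move=> hx; exists (x + c); last by rewrite /sim scale1r addrK.
  by apply: hr; rewrite addrK (le_lt_trans hx)// ltr_pdivrMr// ltr_pMr// ltr1n.
have ch := minimizer_cheeger p1 l0 mK.
have [gamma [L h]] := polar_parameterization cK vK r20 M0 Kr hM ch c.
exists gamma, L; move: h; rewrite -sim_boundary//; congr (C11_closed_parameterization (boundary _) _ _).
have := sim_image_inv (- c) Omega (oner_neq0 R).
by rewrite invr1 scale1r opprK.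
Qed.

Theorem theorem1p1 (R : realType) (p lambda : R)
    (hp : 1 <= p) (hlambda : 0 < lambda) :
  [/\ (exists Omega : set (R * R), minimizer p lambda Omega),
      (forall Omega : set (R * R), minimizer p lambda Omega ->
         [/\ compact Omega,
             convex_set (Omega : set (convex_lmodType (R * R)%type)),
             C11_regular Omega &
             hausdorff_dim Omega = 2%:E]) &
      (forall Omega : set (R * R), minimizer p lambda Omega ->
         perimeter_area_ratio Omega =
         (((p + 2) / (lambda * (p + 3)))%:E *
          ereal_inf [set energy p lambda Omega' | Omega' in admissible])%E)].
Proof.
split; first exact: minimizer_exists.
  by move=> Omega mO; have [[cO vO dO] _] := mO; split => //; exact: minimizer_C11 mO.
by move=> Omega mO; exact: minimizer_ratio.
Qed.
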